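(* Let $F_r$ be a free group of rank $r$ with free generating set $x_1,\ldots,x_r$, and let $\mathcal{A}$ be the algorithm for deciding primitivity of an element of $F_r$ obtained by running in parallel the fast-check algorithm $\mathcal{T}$ and the usual Whitehead algorithm $\mathcal{W}$ (all described in the context). Suppose the possible inputs of $\mathcal{A}$ are cyclically reduced words that are selected uniformly at random from the set of cyclically reduced words of length $n$ in $x_1^{\pm1},\ldots,x_r^{\pm1}$. Then the average-case time complexity (expected runtime) of the algorithm $\mathcal{A}$, working on a classical Turing machine, is $O(1)$, i.e., it is bounded by a constant that depends on $r$ but not on $n$. If one uses the ''Deque'' (double-ended queue) model of computing instead of a classical Turing machine, then the ''cyclically reduced'' condition on the input can be dropped: when inputs are selected uniformly at random from the set of all freely reduced words of length $n$, primitivity of the input is decided (by first cyclically reducing the input and then running $\mathcal{A}$ on the result) in expected time $O(1)$, i.e., bounded by a constant that depends on $r$ but not on $n$.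
   Context: An element $u\in F_r$ is called primitive if there is an automorphism of $F_r$ that takes $x_1$ to $u$ (equivalently, $u$ is part of a free basis of $F_r$). Elements of $F_r$ are given as freely reduced words in $x_1^{\pm1},\ldots,x_r^{\pm 1}$; $|u|$ denotes the length of such a word. Whitehead graph without the external edge: for a word $w$, this graph has $2r$ vertices, corresponding to $x_1,\ldots,x_r,x_1^{-1},\ldots,x_r^{-1}$, and for each occurrence in $w$ of a two-letter subword $ab$ (with $a,b\in\{x_1^{\pm1},\ldots,x_r^{\pm1}\}$) there is an edge connecting the vertex $a$ to the vertex $b^{-1}$. (The full Whitehead graph has one more edge, the external edge, connecting the last letter of $w$ to the inverse of the first letter of $w$; it is excluded here.) The graph is called complete if any two distinct vertices are connected by at least one edge. Algorithm $\mathcal{T}$: on a cyclically reduced input word $u$ of length $n$, it reads the initial segments of $u$ of length $k=1,2,\ldots$, adding one letter at a time, builds the Whitehead graph of this segment without the external edge, and checks whether this graph is complete. As soon as it is complete, $\mathcal{T}$ returns ''$u$ is not primitive''. If the graph is still not complete after all of $u$ has been read, $\mathcal{T}$ just stops without an answer. Algorithm $\mathcal{W}$: the usual Whitehead algorithm for deciding primitivity. Elementary Whitehead automorphisms of $F_r$ are (i) the automorphisms that permute the set $\{x_1^{\pm1},\ldots,x_r^{\pm1}\}$ and (ii) the automorphisms for which there is a fixed letter $a\in\{x_1^{\pm1},\ldots,x_r^{\pm1}\}$ such that $a\mapsto a$ and each generator $x_i\neq a^{\pm1}$ is mapped to one of $x_i,\ x_ia,\ a^{-1}x_i,\ a^{-1}x_ia$.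 The set of them is finite with cardinality depending only on $r$. $\mathcal{W}$ repeatedly applies an elementary Whitehead automorphism that strictly decreases the (cyclically reduced) length of the current word, as long as there is one; $u$ is declared primitive if and only if the final word has length $1$. Algorithm $\mathcal{A}$: runs $\mathcal{T}$ and $\mathcal{W}$ in parallel on the same input and terminates as soon as one of them returns an answer. The Deque model of computing is one in which one can move between the first and the last letter of a word in constant time (so that reading or deleting a letter at either end of the word takes constant time). *)

(* Defs.v *)
From HB Require Import structures.
From mathcomp Require Import all_boot all_order all_algebra all_fingroup.

Set Implicit Arguments.
Unset Strict Implicit.
Unset Printing Implicit Defensive.

Import Order.TTheory GRing.Theory Num.Theory.

(** * Words and the free group *)

(* With generators x_1, ..., x_r, (i, false) is x_(i+1) and (i, true) is its
   inverse. *)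
Definition letter (r : nat) : finType := ('I_r * bool)%type.

Definition linv (r : nat) (a : letter r) : letter r := (a.1, ~~ a.2).

Definition freely_reduced (r : nat) (w : seq (letter r)) : bool :=
  sorted (fun a b => b != linv a) w.

Definition cyclically_reduced (r : nat) (w : seq (letter r)) : bool :=
  freely_reduced w && (if w is a :: s then last a s != linv a else true).

(* Left multiplication of a reduced word by a letter. *)
Definition push (r : nat) (a : letter r) (w : seq (letter r)) :=
  if w is b :: s then if b == linv a then s else a :: w else [:: a].

Definition free_reduction (r : nat) (w : seq (letter r)) : seq (letter r) :=
  foldr (@push r) [::] w.

Definition strip_ends (r : nat) (w : seq (letter r)) : seq (letter r) :=
  if w is a :: b :: s then
    if last b s == linv a then belast b s else w
  else w.

Definition cyclic_reduction (r : nat) (w : seq (letter r)) : seq (letter r) :=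
  iter (size w) (@strip_ends r) w.

Lemma linvK r : involutive (@linv r).
Proof. by case=> i b; rewrite /linv /= negbK. Qed.

Lemma push_reduced r (a : letter r) w :
  freely_reduced w -> freely_reduced (push a w).
Proof.
case: w => [|b s] //=; case: ifP => [_ | /negbT ne]; first exact: path_sorted.
by rewrite /freely_reduced /= ne.
Qed.

Lemma free_reduction_reduced r (w : seq (letter r)) :
  freely_reduced (free_reduction w).
Proof. by elim: w => //= a w IHw; apply: push_reduced. Qed.

Lemma free_reduction_id r (w : seq (letter r)) :
  freely_reduced w -> free_reduction w = w.
Proof.
elim: w => // a w IHw red_aw; rewrite [LHS]/= IHw; last exact: path_sorted red_aw.
by case: w red_aw {IHw} => [|b s] //= /andP[/negbTE->].
Qed.

Lemma push_linv r (a : letter r) w :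
  freely_reduced w -> push a (push (linv a) w) = w.
Proof.
case: w => [|b s] /=; first by rewrite eqxx.
rewrite linvK; case: eqP => [->|_]; last by rewrite /= eqxx.
by case: s => //= c s /andP[/negbTE->].
Qed.

Lemma foldr_push_push r (a : letter r) w v :
  freely_reduced v ->
  foldr (@push r) v (push a w) = push a (foldr (@push r) v w).
Proof.
move=> red_v; case: w => [|b s] //=; case: eqP => [->|//].
rewrite push_linv //.
by elim: s => //= c s IHs; apply: push_reduced.
Qed.

Lemma free_reduction_cat r (u v : seq (letter r)) :
  free_reduction (u ++ v) = foldr (@push r) (free_reduction v) u.
Proof. by rewrite /free_reduction foldr_cat. Qed.

Lemma free_reduction_catl r (u v : seq (letter r)) :
  free_reduction (free_reduction u ++ v) = free_reduction (u ++ v).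
Proof.
rewrite !free_reduction_cat; elim: u => //= a u IHu.
by rewrite foldr_push_push ?IHu // free_reduction_reduced.
Qed.

Lemma free_reduction_catr r (u v : seq (letter r)) :
  free_reduction (u ++ free_reduction v) = free_reduction (u ++ v).
Proof.
by rewrite !free_reduction_cat (free_reduction_id (free_reduction_reduced v)).
Qed.

Record free_group (r : nat) : Type :=
  FreeGroup { fg_word :> seq (letter r); _ : freely_reduced fg_word }.

HB.instance Definition _ (r : nat) := [isSub for @fg_word r].
HB.instance Definition _ (r : nat) := [Choice of free_group r by <:].

Definition reduce (r : nat) (w : seq (letter r)) : free_group r :=
  FreeGroup (free_reduction_reduced w).

Definition fg_one (r : nat) : free_group r := reduce [::].
Definition fg_mul (r : nat) (u v : free_group r) : free_group r :=
  reduce (fg_word u ++ fg_word v).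
Definition fg_inv (r : nat) (u : free_group r) : free_group r :=
  reduce (rev (map (@linv r) u)).

Lemma fg_mulA r : associative (@fg_mul r).
Proof.
move=> u v w; apply: val_inj.
by rewrite /= free_reduction_catl free_reduction_catr catA.
Qed.

Lemma fg_mul1g r : left_id (fg_one r) (@fg_mul r).
Proof. by move=> u; apply: val_inj => /=; apply/free_reduction_id/valP. Qed.

Lemma fg_mulg1 r : right_id (fg_one r) (@fg_mul r).
Proof.
by move=> u; apply: val_inj; rewrite /= cats0; apply/free_reduction_id/valP.
Qed.

Lemma free_reduction_mulV r (w : seq (letter r)) :
  free_reduction (w ++ rev (map (@linv r) w)) = [::].
Proof.
elim: w => //= a w IHw; rewrite rev_cons -cats1 catA.
by rewrite -free_reduction_catl IHw /= eqxx.
Qed.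

Lemma fg_mulgV r : right_inverse (fg_one r) (@fg_inv r) (@fg_mul r).
Proof.
move=> u; apply: val_inj.
by rewrite /= free_reduction_catr free_reduction_mulV.
Qed.

Lemma fg_mulVg r : left_inverse (fg_one r) (@fg_inv r) (@fg_mul r).
Proof.
move=> u; apply: val_inj; rewrite /= free_reduction_catl.
have /= := free_reduction_mulV (rev (map (@linv r) u)).
by rewrite map_rev revK (mapK (@linvK r)).
Qed.

HB.instance Definition _ (r : nat) :=
  isGroup.Build (free_group r)
    (@fg_mulA r) (@fg_mul1g r) (@fg_mulg1 r) (@fg_mulVg r) (@fg_mulgV r).

Definition gen (r : nat) (a : letter r) : free_group r := reduce [:: a].

Definition automorphism (r : nat) (phi : free_group r -> free_group r) : Prop :=
  bijective phi /\ {morph phi : x y / (x * y)%g}.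

Definition primitive (r : nat) (u : free_group r) : Prop :=
  exists phi : free_group r -> free_group r, automorphism phi /\
    exists2 i : 'I_r, i = 0 :> nat & phi (gen (i, false)) = u.

(** * Whitehead graphs and Whitehead automorphisms *)

(* The edge given by an occurrence of ab joins a to b^-1; only the support of
   the multigraph is recorded. *)
Definition whitehead_graph (r : nat) (w : seq (letter r)) :
    {set letter r * letter r} :=
  [set e | (e.1, linv e.2) \in zip w (behead w)].

Definition complete_graph (V : finType) (G : {set V * V}) : bool :=
  [forall v, forall w, (v != w) ==> ((v, w) \in G) || ((w, v) \in G)].

Definition letter_permutation (r : nat) (phi : free_group r -> free_group r) :=
  automorphism phi /\
  exists s : {perm letter r}, forall a, phi (gen a) = gen (s a).

Definition multiplier_automorphism (r : nat)
    (phi : free_group r -> free_group r) :=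
  automorphism phi /\
  exists2 a : letter r, phi (gen a) = gen a &
    forall i : 'I_r, i != a.1 ->
      let x := gen (i, false) in
      phi x \in [:: x; x * gen a; (gen a)^-1 * x; (gen a)^-1 * x * gen a]%g.

Definition elementary_whitehead (r : nat)
    (phi : free_group r -> free_group r) : Prop :=
  letter_permutation phi \/ multiplier_automorphism phi.

Definition whitehead_step (r : nat) (w w' : seq (letter r)) : Prop :=
  exists2 phi : free_group r -> free_group r, elementary_whitehead phi &
    w' = cyclic_reduction (phi (reduce w)) /\ size w' < size w.

(** * Machines *)

(* A deterministic machine with finitely many two-way infinite tapes.  Besides
   the usual moves there are jumps to the first and to the last letter of the
   word on a tape: a machine that does not use them is a classical Turing
   machine, a machine that may use them works in the Deque model. *)

Inductive move := GoLeft | Stay | GoRight | ToFirst | ToLast.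

Definition jump (m : move) : bool :=
  match m with ToFirst | ToLast => true | _ => false end.

Inductive status := Running | Stopped | Answer of bool.

Definition running (s : status) : bool := if s is Running then true else false.

(* None is the blank. *)
Definition symbol (r : nat) (X : finType) : finType :=
  option (letter r + X)%type.

Section Tapes.
Variables (r : nat) (X : finType).
Local Notation sym := (symbol r X).

(* (l, s): l lists the cells strictly to the left of the head, nearest first,
   and s lists the scanned cell and those to its right; all other cells are
   blank. Blanks at the far ends of l and s are never stored. *)
Definition tape : Type := (seq sym * seq sym)%type.

Definition scons (x : sym) (s : seq sym) : seq sym :=
  if (x == None) && nilp s then [::] else x :: s.

Definition tape_read (t : tape) : sym := head None t.2.

Definition tape_write (x : sym) (t : tape) : tape :=
  (t.1, scons x (behead t.2)).

Definition drop_blanks (s : seq sym) : seq sym := drop (find isSome s) s.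

Definition tape_contents (t : tape) : seq sym :=
  rev (drop_blanks (rev (drop_blanks (rev t.1 ++ t.2)))).

Definition tape_move (m : move) (t : tape) : tape :=
  match m with
  | Stay => t
  | GoLeft => (behead t.1, scons (head None t.1) t.2)
  | GoRight => (scons (head None t.2) t.1, behead t.2)
  | ToFirst => ([::], tape_contents t)
  | ToLast => if rev (tape_contents t) is x :: p then (p, [:: x])
              else ([::], [::])
  end.

Definition encode (w : seq (letter r)) : seq sym :=
  [seq Some (inl a) | a <- w].

End Tapes.

(* k.+1 tapes, with tape symbols the letters, the elements of X and a blank. *)
Record machine (r k : nat) (X : finType) := Machine {
  state : finType;
  start : state;
  stat : state -> status;
  delta : state -> {ffun 'I_k.+1 -> symbol r X} ->
          state * {ffun 'I_k.+1 -> symbol r X * move}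
}.

Section Runs.
Variables (r k : nat) (X : finType).
Implicit Type M : machine r k X.

Definition tapes : Type := {ffun 'I_k.+1 -> tape r X}.

Definition config M : Type := (state M * tapes)%type.

Definition input_tapes (u : seq (letter r)) : tapes :=
  [ffun i => if i == ord0 then ([::], encode X u) else ([::], [::])].

Definition step M (c : config M) : config M :=
  if running (stat c.1) then
    let d := delta c.1 [ffun i => tape_read (c.2 i)] in
    (d.1, [ffun i => tape_move (d.2 i).2 (tape_write (d.2 i).1 (c.2 i))])
  else c.

Definition run M (u : seq (letter r)) (t : nat) : config M :=
  iter t (@step M) (start M, input_tapes u).

Definition halts_at M (u : seq (letter r)) (t : nat) : Prop :=
  ~~ running (stat (run M u t).1) /\
  forall s, s < t -> running (stat (run M u s).1).

Definition classical M : Prop :=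
  forall q v i, ~~ jump ((@delta _ _ _ M q v).2 i).2.

End Runs.

(** * The algorithm T *)

Section AlgorithmT.
Variable r : nat.

(* inl (a, G): a is the last letter read and G the Whitehead graph of the
   segment read so far; inr true: the answer "not primitive" has been given;
   inr false: the end of the input was reached without an answer. *)
Definition T_state : finType :=
  ((option (letter r) * {set letter r * letter r}) + bool)%type.

Definition T_stat (q : T_state) : status :=
  match q with
  | inl _ => Running
  | inr true => Answer false
  | inr false => Stopped
  end.

Definition T_extend (last : option (letter r))
    (G : {set letter r * letter r}) (a : letter r) :=
  if last is Some b then whitehead_graph [:: b; a] :|: G else G.

Definition T_delta (q : T_state) (v : {ffun 'I_1 -> symbol r void}) :
    T_state * {ffun 'I_1 -> symbol r void * move} :=
  match q, v ord0 with
  | inl (last, G), Some (inl a) =>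
      let G' := T_extend last G a in
      ((if complete_graph G' then inr true else inl (Some a, G')),
       [ffun i => (v i, GoRight)])
  | inl _, _ => (inr false, [ffun i => (v i, Stay)])
  | inr _, _ => (q, [ffun i => (v i, Stay)])
  end.

Definition machine_T : machine r 0 void :=
  @Machine r 0 void T_state (inl (None, set0)) T_stat T_delta.

End AlgorithmT.

(* While T has not stopped, its state after k steps holds the
   Whitehead graph of the initial segment of length k. *)
Lemma whitehead_graph_rcons r (w : seq (letter r)) (b a : letter r) :
  whitehead_graph (rcons (rcons w b) a) =
  whitehead_graph [:: b; a] :|: whitehead_graph (rcons w b).
Proof.
have zipE : zip (rcons (rcons w b) a) (behead (rcons (rcons w b) a)) =
            rcons (zip (rcons w b) (behead (rcons w b))) (b, a).
  elim: w => [|c w IHw] //; rewrite !rcons_cons [behead _]/=.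
  by case: w IHw => [|d w] //= ->.
by apply/setP=> e; rewrite !inE zipE mem_rcons !inE.
Qed.

Lemma machine_T_run r (u : seq (letter r)) (k : nat) :
  k <= size u ->
  (forall j, 0 < j <= k -> ~~ complete_graph (whitehead_graph (take j u))) ->
  run (machine_T r) u k =
    (inl (ohead (rev (take k u)), whitehead_graph (take k u)),
     [ffun=> (rev (encode void (take k u)), encode void (drop k u))]).
Proof.
have G0 : whitehead_graph [::] = set0 :> {set letter r * letter r}.
  by apply/setP=> e; rewrite !inE.
have G1 a : whitehead_graph [:: a] = set0 :> {set letter r * letter r}.
  by apply/setP=> e; rewrite !inE.
elim: k => [|k IHk] le_ku inc.
  rewrite /run /= take0 drop0 /= G0; congr pair.
  by apply/ffunP=> i; rewrite !ffunE ord1.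
rewrite [LHS]iterS -[iter _ _ _]/(run (machine_T r) u k).
rewrite IHk ?(ltnW le_ku) //; last first.
  by move=> j /andP[j0 jk]; apply: inc; rewrite j0 (leq_trans jk).
have [x0 _] : exists x0 : letter r, true by case: u le_ku {IHk inc} => // x0; exists x0.
have Ek := take_nth x0 le_ku; set a := nth x0 u k in Ek.
have Ed : drop k u = a :: drop k.+1 u by rewrite (drop_nth x0 le_ku).
rewrite /step /= /T_delta /= !ffunE /tape_read Ed /=.
have -> : T_extend (ohead (rev (take k u))) (whitehead_graph (take k u)) a
          = whitehead_graph (take k.+1 u).
  rewrite Ek; case: (lastP (take k u)) => [|w b] /=.
    by rewrite G1.
  by rewrite rev_rcons /= whitehead_graph_rcons.
rewrite (negbTE (inc k.+1 _)) ?leqnn //=.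
rewrite [in RHS]Ek rev_rcons /= -Ek; congr pair.
apply/ffunP=> i; rewrite !ffunE /tape_move /tape_write /= /scons /= Ek.
by rewrite /encode map_rcons rev_rcons /=.
Qed.

(** * The algorithm W *)

(* On input u the run of M exhibits a run of Whitehead's algorithm: some fixed
   tape holds, at successive moments tau 0 < ... < tau m, the successive current
   words w 0 = u, ..., w m. *)
Definition runs_whitehead (r k : nat) (X : finType) (M : machine r k X) : Prop :=
  exists j : 'I_k.+1,
  forall u : seq (letter r), cyclically_reduced u ->
  exists (m : nat) (w : nat -> seq (letter r)) (tau : nat -> nat) (t : nat),
    [/\ w 0 = u,
        forall i, i < m -> whitehead_step (w i) (w i.+1)
      & forall v, ~ whitehead_step (w m) v] /\
    [/\ {homo tau : i i' / i < i'},
        forall i, i <= m ->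
          tape_contents ((run M u (tau i)).2 j) = encode X (w i),
        tau m <= t,
        halts_at M u t
      & stat (run M u t).1 = Answer (size (w m) == 1)].

(** * Running two machines in parallel, and one after the other *)

(* A simulates M1 and M2 in parallel on the inputs satisfying P: s1 u t and
   s2 u t are the numbers of steps of M1 and M2 simulated by the first t steps
   of A, the configurations reached by M1 and M2 can be read off that of A, and
   A halts as soon as M1 or M2 has returned an answer, with that answer.
   (A machine that has halted is allowed to idle.) *)
Definition runs_in_parallel (r k k1 k2 : nat) (X X1 X2 : finType)
    (P : pred (seq (letter r)))
    (A : machine r k X) (M1 : machine r k1 X1) (M2 : machine r k2 X2) : Prop :=
  exists (dec : config A -> config M1 * config M2)
         (s1 s2 : seq (letter r) -> nat -> nat),
  forall u, P u ->
    [/\ s1 u 0 = 0 /\ s2 u 0 = 0,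
        forall t, s1 u t <= s1 u t.+1 <= (s1 u t).+1 /\
                  s2 u t <= s2 u t.+1 <= (s2 u t).+1,
        forall t, s1 u t <= (s2 u t).+1 /\ s2 u t <= (s1 u t).+1,
        forall t, dec (run A u t) = (run M1 u (s1 u t), run M2 u (s2 u t))
      & forall t, stat (run A u t).1 =
          match stat (run M1 u (s1 u t)).1, stat (run M2 u (s2 u t)).1 with
          | Answer b, _ => Answer b
          | _, Answer b => Answer b
          | _, _ => Running
          end].

Section Sequence.
Variables (r k : nat) (X : finType) (M1 M2 : machine r k X).

Definition seq_enter (q : state M1) : (state M1 + state M2)%type :=
  if running (stat q) then inl q else inr (start M2).

Definition seq_stat (q : (state M1 + state M2)%type) : status :=
  match q with inl _ => Running | inr q2 => stat q2 end.

Definition seq_delta (q : (state M1 + state M2)%type)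
    (v : {ffun 'I_k.+1 -> symbol r X}) :=
  match q with
  | inl q1 => let d := delta q1 v in (seq_enter d.1, d.2)
  | inr q2 => let d := delta q2 v in (inr d.1, d.2)
  end.

(* Runs M1 and, when M1 halts, runs M2 on the tapes left by M1. *)
Definition seq_machine : machine r k X :=
  @Machine r k X (state M1 + state M2)%type
    (seq_enter (start M1)) seq_stat seq_delta.

End Sequence.

(* The tapes are left exactly as if the cyclic reduction of u were the input. *)
Definition reduces_cyclically (r k : nat) (X : finType) (M : machine r k X) :
    Prop :=
  forall u : seq (letter r), freely_reduced u ->
  exists t, halts_at M u t /\
    (run M u t).2 = input_tapes k X (cyclic_reduction u).

(** * Deciding primitivity, and expected time *)

Definition decides_primitivity (r k : nat) (X : finType)
    (P : pred (seq (letter r))) (M : machine r k X) : Prop :=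
  forall u : free_group r, P u ->
  exists t b, [/\ halts_at M u t, stat (run M u t).1 = Answer b
                & b <-> primitive u].

Definition words (r n : nat) (P : pred (seq (letter r))) :
    {set n.-tuple (letter r)} := [set u : n.-tuple (letter r) | P u].

(* Mean of f under the uniform distribution on words n P. *)
Definition expectation (r n : nat) (P : pred (seq (letter r)))
    (f : seq (letter r) -> nat) : rat :=
  ((\sum_(u in words n P) (f u)%:R) / #|words n P|%:R)%R.

Definition constant_expected_time (r k : nat) (X : finType)
    (P : pred (seq (letter r))) (M : machine r k X) : Prop :=
  exists time : seq (letter r) -> nat,
    (forall u, P u -> halts_at M u (time u)) /\
    exists C : rat, forall n : nat, (expectation n P time <= C)%R.

(* Main.v *)
(* The Whitehead graph of a cyclically reduced word u of length at least 2 that is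
   primitive has a cut vertex or is disconnected. Indeed, take a bouquet of r
   circles labelled by a basis of the free group containing u, and fold it to the
   rose. By homology mod 2 no fold lowers the rank, so just before the closed path
   read by u visits a single vertex, it runs in a graph with two vertices where
   every label occurs at most once, except possibly for the label a being folded.
   Then a separates the letters ending at one vertex from those ending at the
   other one in the Whitehead graph. So this graph is not complete, which makes T
   correct, and the corresponding Whitehead automorphism shortens u, which makes W
   correct.

   W runs in cubic time on three tapes. For some L depending only on r, every
   nonempty reduced word has an extension by L letters whose Whitehead graph is
   complete. Hence T fails to answer within k letters with exponentially small
   probability, which absorbs the cubic cost of W. For arbitrary reduced words, the
   words of length n + 2 that lose their end letters are at most 2r times as many
   as the reduced words of length n, which is at most half of the reduced words of
   length n + 2 when r > 1, so the expected time satisfies a contracting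
   recursion. When r = 1, reduced words lose no letter. *)
Require Import Defs.
From mathcomp Require Import all_boot all_order all_algebra.
From mathcomp Require Import perm zify ring lra.
From Stdlib Require Import ClassicalEpsilon.
From HB Require Import structures.

Set Implicit Arguments.
Unset Strict Implicit.
Unset Printing Implicit Defensive.

Import Order.TTheory GRing.Theory Num.Theory.

(** * Homomorphisms of the free group *)

(** Fundamental groups are replaced by counting. A graph that is [generating] has at least |V| + r -
    1 edges, while the bouquet of a basis, and every graph obtained from it by folds, has at most
    that many; this tightness is what forbids any coincidence of edges beyond the pair being folded.
    Elementary Whitehead automorphisms are only given as maps satisfying a proposition, so they
    enter the machine through a finite table of the images of the letters. Averages are taken over
    all reduced words, because there the number of continuations of a nonempty word does not depend
    on that word. The cyclically reduced words are at least half of them, so both claims on expected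
    time come from one mean, [machine_A_mean]; for this the parallel machine has to halt in cubic
    time on every word, cyclically reduced or not. *)

Section FreeGroup.
Variable r : nat.
Implicit Types (a b c : letter r) (u v w : seq (letter r)) (g h : free_group r).
Local Open Scope group_scope.

Definition winv w := rev (map (@linv r) w).

Lemma linv_neq a : linv a != a.
Proof. by case: a => i []; rewrite /linv /= xpair_eqE eqxx. Qed.

Lemma linv_eq a b : (linv a == b) = (a == linv b).
Proof. by apply/eqP/eqP => [<-|->]; rewrite linvK. Qed.

Lemma reduce_cat u v : reduce (u ++ v) = reduce u * reduce v.
Proof. by apply: val_inj; rewrite /= free_reduction_catl free_reduction_catr. Qed.

Lemma reduce_nil : reduce [::] = 1 :> free_group r. Proof. by []. Qed.

Lemma reduce_cons a w : reduce (a :: w) = gen a * reduce w.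
Proof. by rewrite -cat1s reduce_cat. Qed.

Lemma reduce_rcons w a : reduce (rcons w a) = reduce w * gen a.
Proof. by rewrite -cats1 reduce_cat. Qed.

Lemma reduce_word g : reduce g = g.
Proof. by apply: val_inj; apply/free_reduction_id/valP. Qed.

Lemma fg_word_reduced g : freely_reduced g.
Proof. exact: valP. Qed.

Lemma fg_word_reduce w : freely_reduced w -> fg_word (reduce w) = w.
Proof. exact: free_reduction_id. Qed.

Lemma gen_linv a : gen (linv a) = (gen a)^-1.
Proof. by []. Qed.

Lemma reduce_winv w : reduce (winv w) = (reduce w)^-1.
Proof.
apply: (mulgI (reduce w)); rewrite mulgV -reduce_cat.
by apply: val_inj; rewrite /= free_reduction_mulV.
Qed.

Section Extension.
Variables (G : groupType) (f : letter r -> G).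
Hypothesis f_linv : forall a, f (linv a) = (f a)^-1.

Definition wordprod w : G := \prod_(a <- w) f a.

Lemma wordprod_push a w : wordprod (push a w) = f a * wordprod w.
Proof.
case: w => [|b s]; first by rewrite /wordprod /= big_cons.
rewrite /push; case: eqP => [->|_]; last by rewrite /wordprod big_cons.
by rewrite /wordprod big_cons f_linv mulgA mulgV mul1g.
Qed.

Lemma wordprod_reduction w : wordprod (free_reduction w) = wordprod w.
Proof.
elim: w => //= a w IHw; rewrite wordprod_push IHw.
by rewrite /wordprod big_cons.
Qed.

Definition fg_ext g : G := wordprod g.

Lemma fg_extM : {morph fg_ext : g h / g * h}.
Proof.
by move=> g h; rewrite /fg_ext [fg_word _]/= wordprod_reduction /wordprod big_cat.
Qed.

Lemma fg_ext_gen a : fg_ext (gen a) = f a.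
Proof. by rewrite /fg_ext /wordprod /= big_seq1. Qed.

End Extension.

Section Morphism.
Variables (G : groupType) (phi : free_group r -> G).
Hypothesis phiM : {morph phi : x y / x * y}.

Lemma fg_morph1 : phi 1 = 1.
Proof. by apply: (mulgI (phi 1)); rewrite -phiM !mulg1. Qed.

Lemma fg_morphV g : phi g^-1 = (phi g)^-1.
Proof. by apply: (mulIg (phi g)); rewrite -phiM !mulVg fg_morph1. Qed.

Lemma fg_morph_reduce w : phi (reduce w) = \prod_(a <- w) phi (gen a).
Proof.
elim: w => [|a w IHw]; first by rewrite big_nil reduce_nil fg_morph1.
by rewrite reduce_cons phiM IHw big_cons.
Qed.

End Morphism.

Lemma reduce_prod w : reduce w = \prod_(a <- w) gen a.
Proof. exact: (@fg_morph_reduce _ id). Qed.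

Lemma fg_morph_id (phi : free_group r -> free_group r) :
  {morph phi : x y / x * y} -> (forall a, phi (gen a) = gen a) -> phi =1 id.
Proof.
move=> phiM phi_id g; rewrite -[g in LHS]reduce_word fg_morph_reduce //.
by rewrite (eq_bigr _ (fun a _ => phi_id a)) -reduce_prod reduce_word.
Qed.

Lemma fg_ext_automorphism (f f' : letter r -> free_group r) :
    (forall a, f (linv a) = (f a)^-1) -> (forall a, f' (linv a) = (f' a)^-1) ->
    (forall a, fg_ext f' (f a) = gen a) -> (forall a, fg_ext f (f' a) = gen a) ->
  automorphism (fg_ext f).
Proof.
move=> fV f'V ff' f'f; split; last exact: fg_extM.
by exists (fg_ext f'); apply: fg_morph_id => [x y|a];
  rewrite ?fg_extM ?fg_ext_gen.
Qed.

Lemma automorphism_comp (phi psi : free_group r -> free_group r) :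
  automorphism phi -> automorphism psi -> automorphism (phi \o psi).
Proof.
case=> [bphi Mphi] [bpsi Mpsi]; split; first exact: bij_comp.
by move=> x y; rewrite /= Mpsi Mphi.
Qed.

Lemma automorphism_inv (phi : free_group r -> free_group r) :
  automorphism phi -> exists psi,
    [/\ automorphism psi, cancel phi psi & cancel psi phi].
Proof.
case=> [[psi phiK psiK] Mphi]; exists psi; split=> //; split; first by exists phi.
by move=> x y; apply: (can_inj phiK); rewrite Mphi !psiK.
Qed.

Lemma primitive_automorphism (phi : free_group r -> free_group r) g :
  automorphism phi -> primitive (phi g) <-> primitive g.
Proof.
have half chi h : automorphism chi -> primitive h -> primitive (chi h).
  move=> auto_chi [psi [auto_psi [i i0 def_h]]].
  exists (chi \o psi); split; first exact: automorphism_comp.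
  by exists i => //=; rewrite def_h.
move=> auto_phi; split; last exact: half.
have [psi [auto_psi phiK _]] := automorphism_inv auto_phi.
by move/(half _ _ auto_psi); rewrite phiK.
Qed.

Lemma automorphism_conj h : automorphism (fun g => h * g * h^-1).
Proof.
split; last by move=> x y; rewrite !mulgA mulgVK.
by exists (fun g => h^-1 * g * h) => g; rewrite -!mulgA ?(mulVg, mulgV) mulg1 ?(mulKg, mulVKg).
Qed.

Lemma primitive_conj h g : primitive (h * g * h^-1) <-> primitive g.
Proof. by apply: (primitive_automorphism _ (automorphism_conj h)). Qed.

Lemma primitive_gen (a : letter r) : primitive (gen a).
Proof.
have i0P : (0 < r)%N by case: a => [[]]; case: (r).
pose i0 := Ordinal i0P.
(* [s] swaps the indices of x_1 and of [a], and flips the signs at these two indices when [a] is an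
   inverse. It commutes with [linv] and is an involution, so it induces an automorphism that is its
   own inverse. *)
pose s b := (tperm i0 a.1 b.1, b.2 (+) (a.2 && ((b.1 == i0) || (b.1 == a.1)))).
pose f (b : letter r) := gen (s b).
have s_linv b : s (linv b) = linv (s b) by rewrite /s /linv /= addNb.
have fV b : f (linv b) = (f b)^-1 by rewrite /f s_linv gen_linv.
have sK b : s (s b) = b.
  case: b => i x; rewrite /s /= tpermK -addbA; congr (_, _).
  by case: tpermP => [->|->|/eqP/negbTE-> /eqP/negbTE->];
     rewrite ?eqxx ?orbT ?orbF ?andbF ?addbb ?addbF.
have f_f b : fg_ext f (f b) = gen b by rewrite fg_ext_gen // /f sK.
exists (fg_ext f); split; first exact: (@fg_ext_automorphism f f).
exists i0 => //; rewrite fg_ext_gen // /f /s tpermL /= andbT.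
by rewrite -surjective_pairing.
Qed.

End FreeGroup.

(** * Cyclic reduction *)

Section CyclicReduction.
Variable r : nat.
Implicit Types (a b c : letter r) (u v w : seq (letter r)) (g h : free_group r).

(** Cyclic reduction consumes a word from both ends, so the matching induction removes a first and a
    last letter together. *)
Lemma seq_ends_ind (T : Type) (P : seq T -> Prop) :
    P [::] -> (forall x, P [:: x]) ->
    (forall x s y, P s -> P (x :: rcons s y)) ->
  forall s, P s.
Proof.
move=> P0 P1 P2 s; have [n] := ubnP (size s).
elim: n s => // n IHn [|x s] //; case/lastP: s => // s y /=.
by rewrite size_rcons ltnS => lt_sn; apply/P2/IHn/ltnW.
Qed.

Lemma strip_endsE a v b :
  strip_ends (a :: rcons v b) = if b == linv a then v else a :: rcons v b.
Proof.
case: v => [|c v] /=; first by case: eqP.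
by rewrite last_rcons belast_rcons.
Qed.

Lemma iter_strip_ends w n :
  size w <= n -> iter n (@strip_ends r) w = cyclic_reduction w.
Proof.
suff fixw v : strip_ends v = v -> forall m, iter m (@strip_ends r) v = v.
  rewrite /cyclic_reduction.
  elim/seq_ends_ind: w n => [|a|a v b IHv] n le_n; try by rewrite !fixw.
  rewrite /= size_rcons in le_n; case: n le_n => // n le_n.
  rewrite [size _]/= size_rcons iterSr [RHS]iterSr strip_endsE.
  case: eqP => [_|/eqP ne_ab]; first by rewrite IHv ?[RHS]IHv // ltnW.
  by rewrite !fixw // strip_endsE (negbTE ne_ab).
by move=> fix_v; elim=> //= m ->.
Qed.

Lemma cyclic_reduction1 a : cyclic_reduction [:: a] = [:: a].
Proof. by []. Qed.

Lemma cyclic_reductionE a v b :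
  cyclic_reduction (a :: rcons v b) =
  if b == linv a then cyclic_reduction v else a :: rcons v b.
Proof.
have szE : size (a :: rcons v b) = (size v).+2 by rewrite /= size_rcons.
rewrite -[LHS](@iter_strip_ends _ (size v).+2) ?szE //.
rewrite iterSr strip_endsE; case: eqP => [_|/eqP ne_ab].
  by rewrite iter_strip_ends ?leqnSn.
by elim: _.+1 => //= m ->; rewrite strip_endsE (negbTE ne_ab).
Qed.

Lemma freely_reduced_cons a w :
  freely_reduced (a :: w) =
  (if w is b :: _ then b != linv a else true) && freely_reduced w.
Proof. by case: w. Qed.

Lemma freely_reduced_behead a w : freely_reduced (a :: w) -> freely_reduced w.
Proof. by rewrite freely_reduced_cons => /andP[]. Qed.

Lemma freely_reduced_rcons w b :
  freely_reduced (rcons w b) =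
  (if w is a :: s then b != linv (last a s) else true) && freely_reduced w.
Proof. by case: w => //= a s; rewrite /freely_reduced /= rcons_path andbC. Qed.

Lemma freely_reduced_ends a v b :
  freely_reduced (a :: rcons v b) -> freely_reduced v.
Proof. by move/freely_reduced_behead; rewrite freely_reduced_rcons => /andP[]. Qed.

Lemma freely_reduced_cat v w :
  freely_reduced (v ++ w) -> freely_reduced v /\ freely_reduced w.
Proof.
case: v => [|a v] //; rewrite /freely_reduced /= cat_path => /andP[-> ].
by move/path_sorted.
Qed.

Lemma cyclically_reducedE a v b :
  cyclically_reduced (a :: rcons v b) =
  freely_reduced (a :: rcons v b) && (b != linv a).
Proof. by rewrite /cyclically_reduced last_rcons. Qed.

Lemma cyclically_reduced_free w : cyclically_reduced w -> freely_reduced w.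
Proof. by case/andP. Qed.

Lemma cyclic_reductionP w :
  freely_reduced w -> cyclically_reduced (cyclic_reduction w).
Proof.
elim/seq_ends_ind: w => // [a _|a v b IHv red].
  by rewrite /cyclically_reduced cyclic_reduction1 /= eq_sym linv_neq.
rewrite cyclic_reductionE; case: eqP => [_|/eqP ne].
  exact/IHv/freely_reduced_ends/red.
by rewrite cyclically_reducedE red.
Qed.

Lemma size_cyclic_reduction w : size (cyclic_reduction w) <= size w.
Proof.
elim/seq_ends_ind: w => // a v b IHv; rewrite cyclic_reductionE.
by case: ifP => _; rewrite /= size_rcons //; exact/leqW/leqW/IHv.
Qed.

Lemma cyclic_reduction_conj w :
  exists h, reduce w = (h * reduce (cyclic_reduction w) * h^-1)%g.
Proof.
have triv v : cyclic_reduction v = v ->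
    exists h, reduce v = (h * reduce (cyclic_reduction v) * h^-1)%g.
  by move->; exists 1%g; rewrite mul1g invg1 mulg1.
elim/seq_ends_ind: w => [|a|a v b [h IHv]]; try exact: triv.
case: (b =P linv a) => [->|/eqP ne].
  exists (gen a * h)%g; rewrite cyclic_reductionE eqxx reduce_cons reduce_rcons.
  by rewrite IHv gen_linv invgM !mulgA.
by apply: triv; rewrite cyclic_reductionE (negbTE ne).
Qed.

Lemma primitive_cyclic_reduction w :
  primitive (reduce (cyclic_reduction w)) <-> primitive (reduce w).
Proof.
by have [h ->] := cyclic_reduction_conj w; split => /primitive_conj.
Qed.

(** By [clen_conj] this is an invariant of the conjugacy class of [g]. *)
Definition clen g := size (cyclic_reduction g).

Lemma clen_reduce w : freely_reduced w -> clen (reduce w) = size (cyclic_reduction w).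
Proof. by move=> red_w; rewrite /clen fg_word_reduce. Qed.

(** The cases are whether [a] cancels the first letter of the word and whether its inverse cancels
    the last one. If both happen, conjugation strips the word as cyclic reduction does; if one
    happens, it rotates a cyclically reduced word; if neither, it adds a pair of ends that cyclic
    reduction removes at once. *)
Lemma clen_gen_conj a g : clen (gen a * g * (gen a)^-1)%g = clen g.
Proof.
rewrite -[g]reduce_word; have := fg_word_reduced g; move: (fg_word g) => w {g}.
rewrite -gen_linv -reduce_cons -reduce_rcons rcons_cons.
have nostrip x v y : y != linv x -> freely_reduced (x :: rcons v y) ->
    clen (reduce (x :: rcons v y)) = (size v).+2.
  move=> ne red; rewrite clen_reduce // cyclic_reductionE (negbTE ne) /=.
  by rewrite size_rcons.
have outer b s : b != linv a -> last b s != a -> freely_reduced (b :: s) ->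
    clen (reduce (a :: rcons (b :: s) (linv a))) = clen (reduce (b :: s)).
  move=> nP nQ red; rewrite !clen_reduce // ?cyclic_reductionE ?eqxx //.
  rewrite /= /freely_reduced /= nP rcons_path -/(freely_reduced (b :: s)).
  by move: red; rewrite /freely_reduced /= => ->; rewrite (inj_eq (can_inj (@linvK r))) eq_sym.
elim/seq_ends_ind: w => [_|b _|b v c _ red].
- by congr clen; rewrite reduce_cons reduce_rcons reduce_nil gen_linv mul1g mulgV.
- case: (b =P linv a) => [->|/eqP nP].
    by congr clen; rewrite reduce_cons reduce_rcons !gen_linv mulVKg.
  case: (b =P a) => [->|/eqP nQ]; last exact: outer.
  by congr clen; rewrite rcons_cons !reduce_cons !gen_linv reduce_nil mulgV mulg1.
- case: (b =P linv a) => [def_b|/eqP nP]; case: (c =P a) => [def_c|/eqP nQ].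
  + rewrite [in RHS]clen_reduce // cyclic_reductionE def_b def_c linvK eqxx.
    rewrite -clen_reduce; last by move: red; apply: freely_reduced_ends.
    congr clen; rewrite -rcons_cons !reduce_rcons !reduce_cons !gen_linv.
    by rewrite mulVKg reduce_rcons mulgK.
  + have -> : reduce (a :: rcons (b :: rcons v c) (linv a)) =
              reduce (rcons (rcons v c) b).
      rewrite def_b [RHS]reduce_rcons reduce_cons reduce_rcons reduce_cons gen_linv.
      by rewrite -mulgA mulVKg.
    have bc : b != linv c by rewrite def_b linv_eq linvK eq_sym.
    rewrite [RHS]nostrip //; last by rewrite eq_sym linv_eq.
    case: v red => [|d v] red.
      by rewrite (nostrip c [::]) // /freely_reduced /= bc.
    have := red; rewrite rcons_cons freely_reduced_cons => /andP[db redv].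
    rewrite !rcons_cons nostrip ?size_rcons //.
      by rewrite eq_sym linv_eq.
    by rewrite -rcons_cons freely_reduced_rcons last_rcons bc.
  + have -> : reduce (a :: rcons (b :: rcons v c) (linv a)) = reduce (a :: b :: v).
      by rewrite def_c !reduce_cons !reduce_rcons gen_linv mulgK.
    rewrite [RHS]nostrip //; last by rewrite def_c eq_sym linv_eq.
    move: red; rewrite -rcons_cons freely_reduced_rcons def_c => /andP[nl red].
    case/lastP: v => [|v d] in nl red *.
      by rewrite (nostrip a [::]) // /freely_reduced /= nP.
    rewrite -rcons_cons nostrip ?size_rcons //.
      by rewrite last_rcons eq_sym linv_eq in nl.
    by rewrite rcons_cons /freely_reduced /= nP.
  + by apply: outer => //; rewrite /= last_rcons.
Qed.

Lemma clen_conj h g : clen (h * g * h^-1)%g = clen g.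
Proof.
rewrite -[h]reduce_word; elim: (fg_word h) => [|a w IHw].
  by rewrite reduce_nil mul1g invg1 mulg1.
by rewrite reduce_cons invgM -[RHS]IHw -[RHS](clen_gen_conj a) !mulgA.
Qed.

Lemma size_free_reduction w : size (free_reduction w) <= size w.
Proof.
elim: w => //= a w IHw; case: (free_reduction w) IHw => [|b s] //=.
by case: ifP => _ /=; lia.
Qed.

Lemma clen_reduce_le w : clen (reduce w) <= size w.
Proof. exact: leq_trans (size_cyclic_reduction _) (size_free_reduction w). Qed.

End CyclicReduction.

(** * Cut vertices *)

Section Traces.
Variables (r : nat) (V : finType).

Definition traversal : Type := (V * letter r * V)%type.
Definition src (t : traversal) := t.1.1.
Definition lab (t : traversal) := t.1.2.
Definition tgt (t : traversal) := t.2.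

Definition chained (t t' : traversal) := tgt t == src t'.

End Traces.

Section CutVertex.
Variable r : nat.
Implicit Types (a b l : letter r) (u v w : seq (letter r)).
Local Open Scope group_scope.

(** The vertices are the booleans. Only the end reached by reading [a] is exempt, so [a] may label
    both a loop at [false] and an edge from [false] to [true]. *)
Definition cut_ok a (al : pred (letter r)) (t : traversal r bool) :=
  ((lab t == a) || (tgt t == al (lab t))) &&
  ((lab t == linv a) || (src t == al (linv (lab t)))).

(** The traversals, in either direction, of the edge labelled [a] from [false] to [true]: these are
    the letters that the Whitehead automorphism deletes. *)
Definition collapsed a (t : traversal r bool) :=
  (lab t == a) && tgt t || (lab t == linv a) && src t.

(* The cyclic word u is read by a closed path in a graph with two vertices, in
   which an edge labelled a leads from false to true, and every other letter l
   ends at the vertex al l, except that a may also label a loop at false. In the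
   Whitehead graph of u, the vertex a then separates al from its complement. *)
Definition cut_word u : Prop :=
  exists a (al : pred (letter r)) (c : seq (traversal r bool)),
    [/\ al a = false, al (linv a) = false, map (@lab r _) c = u,
        all (cut_ok a al) c /\ has (collapsed a) c
      & cycle (@chained r _) c].

Definition wh_tail a (b : bool) : free_group r := if b then gen a else 1.

(** The Whitehead automorphism with multiplier [a] given by the cut [al]. Its inverse [wh_image_inv]
    sends [l] to the label of the loop at [false] through the edge [l], with the edge [a] from
    [false] to [true] as spanning tree. *)
Definition wh_image a (al : pred (letter r)) l : free_group r :=
  (wh_tail a (al (linv l)))^-1 * gen l * wh_tail a (al l).

Definition wh_image_inv a (al : pred (letter r)) l : free_group r :=
  wh_tail a (al (linv l)) * gen l * (wh_tail a (al l))^-1.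

Section Automorphism.
Variables (a : letter r) (al : pred (letter r)).
Hypotheses (al_a : al a = false) (al_aV : al (linv a) = false).

Lemma wh_image_linv l : wh_image a al (linv l) = (wh_image a al l)^-1.
Proof. by rewrite /wh_image linvK gen_linv !invgM invgK mulgA. Qed.

Lemma wh_image_inv_linv l : wh_image_inv a al (linv l) = (wh_image_inv a al l)^-1.
Proof. by rewrite /wh_image_inv linvK gen_linv !invgM invgK mulgA. Qed.

Lemma wh_image_mult : wh_image a al a = gen a.
Proof. by rewrite /wh_image al_a al_aV /= invg1 mulg1 mul1g. Qed.

Lemma wh_image_inv_mult : wh_image_inv a al a = gen a.
Proof. by rewrite /wh_image_inv al_a al_aV /= invg1 mulg1 mul1g. Qed.

Lemma wh_automorphism : automorphism (fg_ext (wh_image a al)).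
Proof.
apply: (@fg_ext_automorphism _ _ (wh_image_inv a al)) => [||l|l].
- exact: wh_image_linv.
- exact: wh_image_inv_linv.
- have tailE (b : bool) : fg_ext (wh_image_inv a al) (wh_tail a b) = wh_tail a b.
    case: b; rewrite /= ?fg_ext_gen ?wh_image_inv_mult //.
    exact/fg_morph1/fg_extM/wh_image_inv_linv.
  have extM := fg_extM wh_image_inv_linv.
  rewrite {1}/wh_image !extM fg_morphV // !tailE fg_ext_gen /wh_image_inv.
  by rewrite -!mulgA mulVg mulg1 mulKg.
- have tailE (b : bool) : fg_ext (wh_image a al) (wh_tail a b) = wh_tail a b.
    case: b; rewrite /= ?fg_ext_gen ?wh_image_mult //.
    exact/fg_morph1/fg_extM/wh_image_linv.
  have extM := fg_extM wh_image_linv.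
  rewrite {1}/wh_image_inv !extM fg_morphV // !tailE fg_ext_gen /wh_image.
  by rewrite -!mulgA mulgV mulg1 mulVKg.
Qed.

Lemma wh_elementary : elementary_whitehead (fg_ext (wh_image a al)).
Proof.
right; split; first exact: wh_automorphism.
exists a; first by rewrite fg_ext_gen wh_image_mult.
move=> i _ /=; rewrite fg_ext_gen /wh_image !inE.
by case: (al _); case: (al _); rewrite /= ?invg1 ?mul1g ?mulg1 eqxx ?orbT.
Qed.

(** The outer factors depend only on the vertices, so they telescope along a path. On a collapsed
    traversal the letter itself is the quotient of the two tails, hence nothing is left between
    them. *)
Lemma wh_image_traversal t : cut_ok a al t ->
  wh_image a al (lab t) =
  (wh_tail a (src t))^-1 * (if collapsed a t then 1 else gen (lab t)) *
  wh_tail a (tgt t).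
Proof.
rewrite /cut_ok /collapsed.
case: (lab t =P a) => [->|_] /=.
  rewrite eq_sym (negbTE (linv_neq a)) /= al_aV orbF => /eqP->.
  rewrite wh_image_mult /= invg1 mul1g.
  by case: (tgt t); rewrite /= ?mul1g ?mulg1.
case: (lab t =P linv a) => [->|_] /= /andP[/eqP-> // h].
  rewrite al_aV wh_image_linv wh_image_mult /= mulg1 gen_linv.
  by case: (src t); rewrite /= ?mulg1 // invg1 mul1g.
by rewrite (eqP h).
Qed.

Lemma wh_image_path t s : path (@chained r _) t s -> all (cut_ok a al) (t :: s) ->
  \prod_(x <- t :: s) wh_image a al (lab x) =
  (wh_tail a (src t))^-1 *
  reduce [seq lab x | x <- t :: s & ~~ collapsed a x] *
  wh_tail a (tgt (last t s)).
Proof.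
elim: s t => [|t' s IHs] t /=.
  move=> _ /andP[ok _]; rewrite big_seq1 wh_image_traversal //.
  by case: collapsed; rewrite ?reduce_nil.
move=> /andP[/eqP ch p] /andP[ok oks]; rewrite big_cons IHs //.
rewrite wh_image_traversal // ch -!mulgA mulVKg /=.
case: (collapsed a t) => /=; first by rewrite mul1g.
by rewrite reduce_cons !mulgA.
Qed.

End Automorphism.

(** Around a closed path the tails telescope to a conjugation, which [clen] ignores. What remains is
    the word without its collapsed letters, and there is at least one of these. *)
Lemma cut_word_step u : cut_word u -> exists v, whitehead_step u v.
Proof.
case=> a [al [c [al_a al_aV <- [ok hasc] cyc]]].
exists (cyclic_reduction (fg_ext (wh_image a al) (reduce (map (@lab r _) c)))).
exists (fg_ext (wh_image a al)); first exact: wh_elementary.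
split=> //; rewrite -/(clen _) fg_morph_reduce; last first.
  exact: fg_extM (wh_image_linv a al).
rewrite big_map; under eq_bigr do rewrite fg_ext_gen.
case: c ok hasc cyc => // t s ok hasc /= cyc.
move: cyc; rewrite rcons_path => /andP[p /eqP tgt_src].
rewrite wh_image_path // tgt_src.
rewrite -{2}[wh_tail _ _]invgK clen_conj.
apply: leq_ltn_trans (clen_reduce_le _) _.
rewrite !size_map size_filter ltn_neqAle count_size andbT -all_count.
by rewrite (@all_predC _ (collapsed a)) hasc.
Qed.

Lemma cyclically_reduced_cycle u :
  cyclically_reduced u -> cycle (fun a b => b != linv a) u.
Proof.
case: u => // a s /andP[red ne]; rewrite /= rcons_path -/(freely_reduced (a :: s)).
by move: red; rewrite /freely_reduced /= => ->; rewrite eq_sym linv_eq.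
Qed.

Lemma path_zip (T : eqType) (e : rel T) x s y z :
  path e x s -> (y, z) \in zip (x :: s) s -> e y z.
Proof.
elim: s x => // x' s IHs x /= /andP[exx' p].
by rewrite inE => /orP[/eqP[-> ->] //|]; apply: IHs.
Qed.

Lemma mem_zip (T : eqType) (s s' : seq T) x y :
  (x, y) \in zip s s' -> x \in s /\ y \in s'.
Proof.
elim: s s' => [|z s IHs] [|z' s'] //=; rewrite !inE.
by case/orP => [/eqP[-> ->]|/IHs[-> ->]]; rewrite ?eqxx ?orbT.
Qed.

Lemma zip_map (T S : Type) (f : T -> S) (s s' : seq T) :
  zip (map f s) (map f s') = [seq (f x.1, f x.2) | x <- zip s s'].
Proof. by elim: s s' => [|x s IHs] [|y s'] //=; rewrite IHs. Qed.

(** No edge joins [linv a] to a letter [p] with [al p]. Such an edge would come from reading [p] and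
    then [a], or the inverse of this; as only the end of [a] is ambiguous, the two traversals would
    meet at [true] and at [false] at once. *)
Lemma cut_word_incomplete u :
  cyclically_reduced u -> cut_word u -> ~~ complete_graph (whitehead_graph u).
Proof.
move=> red [a [al [c [al_a al_aV def_u [ok hasc] cyc]]]].
have aVa := linv_neq a.
have okP t : t \in c -> (lab t != a -> tgt t = al (lab t)) /\
                     (lab t != linv a -> src t = al (linv (lab t))).
  by move/(allP ok) => /andP[h1 h2]; split=> /negbTE ne;
    [move: h1 | move: h2]; rewrite ne => /eqP.
have cred : cycle (fun t t' => lab t' != linv (lab t)) c.
  by have := cyclically_reduced_cycle red; rewrite -def_u cycle_map.
(* The neighbour of a collapsed traversal at the vertex [true] does not cancel it, as the word is
   cyclically reduced; so its end at [true] is not the exempt one and gives [p]. *)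
have [p al_p] : exists p, al p.
  have /hasP[t tc /orP[/andP[/eqP lt tt]|/andP[/eqP lt st]]] := hasc.
    have t'c : next c t \in c by rewrite mem_next.
    have /eqP ch := next_cycle cyc tc; have rd := next_cycle cred tc.
    rewrite lt in rd; exists (linv (lab (next c t))).
    by rewrite -(okP _ t'c).2 // -ch.
  have t'c : prev c t \in c by rewrite mem_prev.
  have /eqP ch := prev_cycle cyc tc; have rd := prev_cycle cred tc.
  exists (lab (prev c t)); rewrite -(okP _ t'c).1 ?ch //.
  by apply: contraNneq rd => ->; rewrite lt.
have pa : p != a by apply: contraTneq al_p => ->; rewrite al_a.
have paV : p != linv a by apply: contraTneq al_p => ->; rewrite al_aV.
have edgeP l l' : (l, l') \in zip u (behead u) ->
    exists t t', [/\ t \in c, t' \in c, lab t = l, lab t' = l' & tgt t = src t'].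
  rewrite -def_u behead_map zip_map => /mapP[[t t'] tt' [-> ->]]; exists t, t'.
  move: tt' cyc; case: (c) => // t0 s /= tt'; rewrite rcons_path => /andP[pth _].
  have [tc t'c] := mem_zip tt'.
  by split=> //; [rewrite inE t'c orbT | exact/eqP/(path_zip pth)].
apply/negP => /forallP/(_ p)/forallP/(_ (linv a)); rewrite paV /= !inE /= linvK.
case/orP => /edgeP[t [t' [tc t'c lt lt' ch]]].
  have := (okP _ tc).1; have := (okP _ t'c).2.
  by rewrite lt lt' ch al_p al_aV eq_sym aVa pa => -> // /(_ isT).
have := (okP _ tc).1; have := (okP _ t'c).2.
by rewrite lt lt' ch linvK al_p al_aV (can_eq (@linvK r)) aVa pa => -> // /(_ isT).
Qed.

End CutVertex.

(** * Labelled graphs and Stallings folds *)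

Section Graphs.
Variable r : nat.
Implicit Types (a b l : letter r) (u v w : seq (letter r)).

Definition graph (V : finType) := {set V * 'I_r * V}.

Definition uedge (V : finType) (t : traversal r V) : V * 'I_r * V :=
  if (lab t).2 then (tgt t, (lab t).1, src t) else (src t, (lab t).1, tgt t).

Definition reversal (V : finType) (t : traversal r V) : traversal r V :=
  (tgt t, linv (lab t), src t).

Lemma uedge_reversal (V : finType) (t : traversal r V) :
  uedge (reversal t) = uedge t.
Proof. by case: t => [[x [i b]] y]; rewrite /uedge /=; case: b. Qed.

Lemma reversalK (V : finType) : involutive (@reversal V).
Proof. by case=> [[x l] y]; rewrite /reversal /= linvK. Qed.

Definition edge (V : finType) (E : graph V) x a y := uedge (x, a, y) \in E.

Lemma edge_linv (V : finType) (E : graph V) x a y :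
  edge E x (linv a) y = edge E y a x.
Proof. by rewrite /edge -[in RHS]uedge_reversal. Qed.

Fixpoint walk (V : finType) (E : graph V) (x : V) w (y : V) : bool :=
  if w is a :: w' then [exists z, edge E x a z && walk E z w' y] else x == y.

Section Walks.
Variables (V : finType) (E : graph V).
Implicit Types (x y z : V).

Lemma walk_cons x a w y :
  reflect (exists2 z, edge E x a z & walk E z w y) (walk E x (a :: w) y).
Proof.
by apply: (iffP existsP) => [[z /andP[]]|[z h1 h2]]; exists z; rewrite ?h1.
Qed.

Lemma walk1 x a y : walk E x [:: a] y = edge E x a y.
Proof.
by apply/walk_cons/idP => [[z e /eqP<-]|e] //; exists y => /=.
Qed.

Lemma walk_cat x u v y :
  reflect (exists2 z, walk E x u z & walk E z v y) (walk E x (u ++ v) y).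
Proof.
elim: u x => [|a u IHu] x.
  by apply: (iffP idP) => [|[z /eqP<-]]; first by exists x => /=.
apply: (iffP (walk_cons _ _ _ _)) => [[z e /IHu[z' h1 h2]]|].
  by exists z' => //; apply/walk_cons; exists z.
by case=> z' /walk_cons[z e h1] h2; exists z => //; apply/IHu; exists z'.
Qed.

Lemma walk_rev x w y : walk E x w y -> walk E y (winv w) x.
Proof.
elim: w x => [|a w IHw] x; first by rewrite /= eq_sym.
case/walk_cons=> z e /IHw h; rewrite /winv /= rev_cons -cats1.
by apply/walk_cat; exists z => //; rewrite walk1 edge_linv.
Qed.

Lemma walk_flatten x (f : letter r -> seq (letter r)) w :
  (forall a, walk E x (f a) x) -> walk E x (flatten (map f w)) x.
Proof.
by move=> fx; elim: w => [|a w IHw] //=; apply/walk_cat; exists x.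
Qed.

(* For the fundamental group at v0, this says that the labelling maps it onto
   the free group. *)
Definition generating (v0 : V) : Prop :=
  (forall a, exists2 w, walk E v0 w v0 & reduce w = gen a) /\
  (forall x, exists w, walk E v0 w x).

Definition folded : Prop :=
  forall x a y z, edge E x a y -> edge E x a z -> y = z.

Lemma folded_dec :
  folded \/ exists x a y z, [/\ edge E x a y, edge E x a z & y != z].
Proof.
case: (boolP [exists x, exists a, exists y, exists z,
                [&& edge E x a y, edge E x a z & y != z]]) => [|/negP no].
  by case/existsP=> x /existsP[a /existsP[y /existsP[z /and3P[]]]]; right; exists x, a, y, z.
left=> x a y z xy xz; apply/eqP; apply: contraT => ne; case: no.
apply/existsP; exists x; apply/existsP; exists a; apply/existsP; exists y.
by apply/existsP; exists z; rewrite xy xz.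
Qed.

Lemma folded_free_reduction x w y :
  folded -> walk E x w y -> walk E x (free_reduction w) y.
Proof.
move=> fE; elim: w x => //= a w IHw x /existsP[z /andP[e /IHw]].
case: (free_reduction w) => [|b s] h; rewrite [push _ _]/=.
  by rewrite walk1 -(eqP h).
case: eqP => [def_b|_]; last by apply/walk_cons; exists z.
have /walk_cons[z' ez hz'] := h.
by rewrite def_b in ez; rewrite (fE z (linv a) x z') // edge_linv.
Qed.

(** A word for a generator reduces, inside a folded graph, to a single edge; so every letter labels
    a loop at [v0], and determinism keeps all walks from [v0] there. *)
Lemma folded_generating (v0 : V) x : folded -> generating v0 -> x = v0.
Proof.
move=> fE [gen_a reach].
have loop a : edge E v0 a v0.
  have [w h red_w] := gen_a a; have := folded_free_reduction fE h.
  by rewrite -[free_reduction w]/(fg_word (reduce w)) red_w walk1.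
have [w] := reach x.
elim: w => [/eqP-> //|a w IHw /walk_cons[z e]].
by rewrite -(fE _ _ _ _ (loop a) e).
Qed.

(* The cochains f of the free group and g of the vertices mod 2 are determined by
   g v0 and by the cochain they induce on the edges: this is the inequality between
   the first Betti numbers. *)
Lemma rank_bound (v0 : V) : generating v0 -> #|V| + r <= #|E|.+1.
Proof.
case=> gen_a reach.
pose T := ({ffun 'I_r -> bool} * {ffun V -> bool})%type.
pose h (p : T) : bool * {ffun {e | e \in E} -> bool} :=
  (p.2 v0, [ffun e => let t := val e in p.1 t.1.2 (+) (p.2 t.1.1 (+) p.2 t.2)]).
have inj_h : injective h.
  move=> [f g] [f' g'] [eq0 /ffunP eqh].
  (* As [h] is additive, injectivity amounts to the vanishing of the differences [F] and [D]. [F]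
     extends to a homomorphism [S] to Z/2 that depends only on the ends of a walk: it vanishes on
     the closed walks representing the generators, hence everywhere, and then [D] is constant along
     walks from [v0]. *)
  pose F i := f i (+) f' i; pose D x := g x (+) g' x.
  have FD x a y : edge E x a y -> F a.1 = D x (+) D y.
    case: a => i b /= e; have := eqh (exist (fun e => e \in E) _ e);
      rewrite !ffunE /= /F /D /uedge /=.
    case: b {e} => /=; move: (f i) (f' i) (g x) (g' x) (g y) (g' y);
      by do 6!case.
  pose S := foldr (fun a s => F a.1 (+) s) false.
  have S_push a w : S (push a w) = F a.1 (+) S w.
    case: w => [|b s] //=; case: eqP => [->|//] /=.
    by rewrite addbA addbb addFb.
  have S_red w : S (free_reduction w) = S w by elim: w => //= a w IHw; rewrite S_push IHw.
  have S_walk x w y : walk E x w y -> S w = D x (+) D y.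
    elim: w x => [|a w IHw] x; first by move/eqP->; rewrite addbb.
    case/walk_cons=> z /FD/= -> /IHw->.
    by rewrite addbA -(addbA (D x)) addbb addbF.
  have F0 i : F i = false.
    have [w /S_walk] := gen_a (i, false); rewrite -S_red addbb => <-.
    by move/(congr1 (@fg_word r)) => /= ->; rewrite /= addbF.
  have S0 w : S w = false by elim: w => //= a w ->; rewrite F0.
  have D0 x : D x = false.
    have [w /S_walk] := reach x; rewrite S0 /D eq0 addbb addFb => /esym.
    by [].
  congr (_, _); apply/ffunP=> i; apply/eqP.
    by have := F0 i; rewrite /F; case: (f i); case: (f' i).
  by have := D0 i; rewrite /D; case: (g i); case: (g' i).
have := leq_card h inj_h; rewrite !card_prod !card_ffun !card_bool card_ord.
by rewrite card_sig -expnD -expnS leq_exp2l // addnC.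
Qed.

End Walks.

Definition map_edge (V V' : finType) (f : V -> V') (e : V * 'I_r * V) :=
  (f e.1.1, e.1.2, f e.2).
Definition map_graph (V V' : finType) (f : V -> V') (E : graph V) : graph V' :=
  [set map_edge f e | e in E].
Definition map_traversal (V V' : finType) (f : V -> V') (t : traversal r V) :
    traversal r V' := (f (src t), lab t, f (tgt t)).

Lemma uedge_map (V V' : finType) (f : V -> V') t :
  uedge (map_traversal f t) = map_edge f (uedge t).
Proof. by rewrite /uedge /=; case: (lab t).2. Qed.

Lemma edge_map (V V' : finType) (f : V -> V') (E : graph V) x a y :
  edge E x a y -> edge (map_graph f E) (f x) a (f y).
Proof.
move=> e; rewrite /edge -[(f x, a, f y)]/(map_traversal f (x, a, y)) uedge_map.
exact: imset_f.
Qed.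

Lemma walk_morph (V V' : finType) (f : V -> V') (E : graph V) (E' : graph V') :
    (forall x a y, edge E x a y -> edge E' (f x) a (f y)) ->
  forall x w y, walk E x w y -> walk E' (f x) w (f y).
Proof.
move=> fE x w y; elim: w x => [x /eqP->|a w IHw x /walk_cons[z /fE e /IHw h]].
  exact: eqxx.
by apply/walk_cons; exists (f z).
Qed.

Definition traces (V : finType) (E : graph V) (c : seq (traversal r V)) : Prop :=
  cycle (@chained r V) c /\ all (fun t => uedge t \in E) c.

Lemma cycle_tgt (V : finType) (c : seq (traversal r V)) t :
  cycle (@chained r V) c -> t \in c -> exists2 t', t' \in c & tgt t = src t'.
Proof.
by move=> cyc tc; exists (next c t); rewrite ?mem_next //; apply/eqP/(next_cycle cyc).
Qed.

Lemma cycle_crossing (V : finType) (c : seq (traversal r V)) t1 t2 :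
    cycle (@chained r V) c -> t1 \in c -> t2 \in c -> src t1 != src t2 ->
  exists2 t, t \in c & src t != tgt t.
Proof.
move=> cyc t1c t2c ne; apply/hasP; apply: contraR ne => /hasPn no.
suff [x srcx] : exists x, forall t, t \in c -> src t = x by rewrite !srcx.
case: c cyc no {t1c t2c} => [|t s] /=; first by exists (src t1).
rewrite rcons_path => /andP[p _] no; exists (src t) => t'.
elim: s t p no => [|t0 s IHs] t /= p no; first by rewrite inE => /eqP->.
rewrite inE => /predU1P[-> //|t's].
have /eqP e : src t == tgt t by apply/negPn/no; rewrite mem_head.
have [/eqP ch p'] := andP p; rewrite e ch; apply: IHs => // t'' t''s.
by apply: no; rewrite inE t''s orbT.
Qed.

Definition traversed (V : finType) (c : seq (traversal r V)) t :=
  (t \in c) || (reversal t \in c).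

(** Sending [q] to [true] and all other vertices to [false] gives the required path on two vertices.
    For [l] other than [a], whether [l] ends at [q] is well defined by assumption; applied to
    [linv a], this also makes every [a] start at [p]. *)
Lemma two_vertex_cut (V : finType) (c : seq (traversal r V)) (p q : V) a :
    cycle (@chained r V) c -> p != q -> traversed c (p, a, q) ->
    (forall t t', traversed c t -> traversed c t' -> lab t = lab t' ->
       lab t != a -> tgt t = tgt t') ->
  cut_word (map (@lab r V) c).
Proof.
move=> cyc pq cross functional.
have travP t : t \in c -> traversed c t /\ traversed c (reversal t).
  by move=> tc; rewrite /traversed reversalK tc orbT.
pose al l := (l != a) && has (fun t => [&& lab t == l & tgt t == q]
                                    || [&& lab t == linv l & src t == q]) c.
have alP t : traversed c t -> lab t != a -> (tgt t == q) = al (lab t).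
  move=> ct la; rewrite /al la /=; apply/eqP/hasP => [tq|[t' t'c]].
    case/orP: ct => tc; first by exists t; rewrite ?eqxx ?tq ?eqxx.
    exists (reversal t) => //.
    by rewrite -[src (reversal t)]/(tgt t) -[lab (reversal t)]/(linv (lab t)) tq !eqxx orbT.
  have [ct' ct'r] := travP _ t'c.
  case/orP => /andP[/eqP l' /eqP <-]; first exact: functional.
  by apply: (functional _ (reversal t')); rewrite // /lab /= -/(lab t') l' linvK.
have al_aV : al (linv a) = false.
  have crossV : traversed c (reversal (p, a, q)) by rewrite /traversed reversalK orbC.
  by have := alP _ crossV (linv_neq a) => /= <-; rewrite /tgt /= (negbTE pq).
exists a, al, (map (fun t => (src t == q, lab t, tgt t == q)) c); split=> //.
- by rewrite /al eqxx.
- by rewrite -map_comp; apply: eq_map.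
- rewrite all_map has_map; split.
    apply/allP=> t tc; rewrite /= /cut_ok /=; have [ct ctr] := travP _ tc.
    apply/andP; split.
      by case: eqP => //= /eqP la; rewrite -(alP t).
    rewrite /lab /= -/(lab t); case: eqP => //= /eqP la; rewrite /src /= -/(src t).
    by rewrite -(alP (reversal t)) //= /lab /= -/(lab t) linv_eq.
  apply/hasP; case/orP: cross => tc; first by exists (p, a, q);
    rewrite //= /collapsed /lab /tgt /= !eqxx.
  by exists (reversal (p, a, q)); rewrite //= /collapsed /lab /src /= !eqxx orbT.
- rewrite cycle_map; apply: sub_cycle cyc => t t' /eqP ch.
  by rewrite /= /chained /tgt /src /= -/(tgt t) ch.
Qed.

End Graphs.

(** * Folding a closed path until two vertices remain *)

Section Folding.
Variable r : nat.
Implicit Types (a b l : letter r) (u v w : seq (letter r)).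

Lemma uedge_inj (V : finType) a (x y x' y' : V) :
  uedge (x, a, y) = uedge (x', a, y') -> x = x' /\ y = y'.
Proof. by rewrite /uedge /src /tgt /=; case: (lab _).2 => -[-> ->]. Qed.

Lemma uedge_eq (V : finType) (t t' : traversal r V) :
  uedge t = uedge t' -> t = t' \/ t = reversal t'.
Proof.
case: t t' => [[x [i b]] y] [[x' [i' b']] y'].
rewrite /uedge /reversal /lab /src /tgt /linv /=.
by case: b; case: b' => -[-> -> ->]; [left | right | right | left].
Qed.

Lemma traversed_uedge (V : finType) (E : graph r V) c t :
  all (fun t => uedge t \in E) c -> traversed c t -> uedge t \in E.
Proof.
by move=> /allP tr /orP[/tr //|/tr]; rewrite uedge_reversal.
Qed.

Lemma map_graph_setD1 (V V' : finType) (E : graph r V) (f : V -> V') d d' :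
    d' \in E -> d != d' -> map_edge f d = map_edge f d' ->
  map_graph f E = map_edge f @: (E :\ d).
Proof.
move=> d'E ne fd; apply/eqP.
rewrite /map_graph eqEsubset [X in _ && X]imsetS ?subsetDl // andbT.
apply/subsetP=> _ /imsetP[e eE ->]; case: (e =P d) => [->|/eqP ned].
  by rewrite fd; apply: imset_f; rewrite !inE eq_sym ne.
by apply: imset_f; rewrite !inE ned.
Qed.

(* The images of the edges at a fold are pairwise distinct, except for the two
   edges that are folded: otherwise the rank would drop. *)
Lemma fold_injective (V V' : finType) (E : graph r V) (f : V -> V') (v' : V') e1 e2 :
    generating (map_graph f E) v' -> #|V| = #|V'|.+1 -> #|E| + 1 <= #|V| + r ->
    e1 \in E -> e2 \in E -> e1 != e2 -> map_edge f e1 = map_edge f e2 ->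
  forall e e', e \in E -> e' \in E -> map_edge f e = map_edge f e' ->
    e != e' -> ((e == e1) && (e' == e2)) || ((e == e2) && (e' == e1)).
Proof.
move=> gen cardV cardE e1E e2E ne12 f12.
have bound := rank_bound gen.
(* Deleting one of two edges with equal images does not change the image, and [rank_bound] then
   leaves room for no other coincidence. Applied to [e1] and to [e2], this forces a coinciding pair
   to contain both. *)
have injD d d' : d \in E -> d' \in E -> d != d' -> map_edge f d = map_edge f d' ->
    {in E :\ d &, injective (map_edge f)}.
  move=> dE d'E ne fd; apply/imset_injP; rewrite eqn_leq leq_imset_card /=.
  rewrite -(map_graph_setD1 d'E ne fd).
  have arith (n m m' k : nat) :
    n + r <= m'.+1 -> m + 1 <= n.+1 + r -> m = 1 + k -> k <= m' by lia.
  rewrite cardV in cardE; apply: arith bound cardE _.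
  by have := cardsD1 d E; rewrite dE.
have inj1 := injD _ _ e1E e2E ne12 f12.
have inj2 : {in E :\ e2 &, injective (map_edge f)}.
  by apply: (injD e2 e1) => //; rewrite eq_sym.
move=> e e' eE e'E fe ne.
have in1 : (e == e1) || (e' == e1).
  apply: contraR ne; rewrite negb_or => /andP[n n'].
  by apply/eqP/inj1 => //; rewrite !inE ?n ?n'.
have in2 : (e == e2) || (e' == e2).
  apply: contraR ne; rewrite negb_or => /andP[n n'].
  by apply/eqP/inj2 => //; rewrite !inE ?n ?n'.
case/orP: in1 => /eqP d1; case/orP: in2 => /eqP d2; subst.
- by rewrite eqxx in ne12.
- by rewrite !eqxx.
- by rewrite !eqxx orbT.
- by rewrite eqxx in ne12.
Qed.

(* Fold until the closed path read by the cyclic word visits a single vertex. Just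
   before the last fold it visits exactly the two vertices identified by it, and
   by fold_injective only the folded label can occur on two traversed edges. *)
Lemma fold_cut (V : finType) (E : graph r V) (v0 : V) (c : seq (traversal r V)) t1 t2 :
    generating E v0 -> #|E| + 1 <= #|V| + r -> traces E c ->
    t1 \in c -> t2 \in c -> src t1 != src t2 ->
  cut_word (map (@lab r V) c).
Proof.
have [n] := ubnP #|V|; elim: n V E v0 c t1 t2 => // n IHn V E v0 c t1 t2.
rewrite ltnS => le_Vn gen cardE tr t1c t2c ne.
case: (folded_dec E) => [fE|[x [a [y [z [xy xz neyz]]]]]].
  by case/eqP: ne;
    rewrite (folded_generating (src t1) fE gen) (folded_generating (src t2) fE gen).
(* The fold identifies [z] with [y], which stays as the representative. *)
pose V' := {x : V | x != z}.
pose f (x' : V) : V' := insubd (exist (fun x => x != z) y neyz) x'.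
have fE (x' : V) : val (f x') = if x' == z then y else x' by rewrite val_insubd; case: eqP.
have f_surj (w : V') : f (val w) = w.
  by apply: val_inj; rewrite fE (negbTE (valP w)).
have f_yz : f y = f z by apply: val_inj; rewrite !fE eqxx (negbTE neyz).
have f_eq (w w' : V) : f w = f w' -> w != w' -> ((w == y) && (w' == z)) || ((w == z) && (w' == y)).
  move/(congr1 val); rewrite !fE.
  case: (w =P z) => [->|nw]; case: (w' =P z) => [->|nw'] //=; rewrite ?eqxx //.
  - by move=> <-; rewrite eqxx orbT.
  - by move=> ->; rewrite eqxx.
  - by move=> ->; rewrite eqxx.
have cardV : #|V| = #|{: V'}|.+1 by rewrite card_sig cardC1 prednK //; apply/card_gt0P;
  exists z.
have fgen : generating (map_graph f E) (f v0).
  have fwalk := walk_morph (@edge_map _ _ _ f E).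
  have [gen_a reach] := gen; split=> [b|w'].
    by have [w h red] := gen_a b; exists w => //; apply: fwalk.
  by have [w /fwalk] := reach (val w'); rewrite f_surj; exists w.
pose e1 := uedge (x, a, y); pose e2 := uedge (x, a, z).
have ne12 : e1 != e2 by apply/eqP => /uedge_inj[_ /eqP]; rewrite (negbTE neyz).
have f12 : map_edge f e1 = map_edge f e2.
  by rewrite -!uedge_map /map_traversal /tgt /src /= f_yz.
have collapse := fold_injective fgen cardV cardE xy xz ne12 f12.
have [cyc sup] := tr.
case: (boolP (all (fun t => f (src t) == f (src t1)) c)) => [/allP const|]; last first.
  (* The image of the path still visits two vertices. The fold has removed one vertex and at least
     one edge, so the bound on the edges persists and the induction applies. *)
  case/allPn => t tc ne_f.
  have -> : map (@lab r V) c = map (@lab r _) (map (map_traversal f) c).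
    by rewrite -map_comp; apply: eq_map.
  apply: (IHn _ (map_graph f E) (f v0) _ (map_traversal f t) (map_traversal f t1)).
  - by move: le_Vn; rewrite cardV.
  - exact: fgen.
  - have : #|map_graph f E| <= #|E :\ e2|.
      by rewrite (map_graph_setD1 (d' := e1) _ _ (esym f12)) 1?eq_sym // leq_imset_card.
    have arith (m k k' p : nat) : k <= k' -> m + 1 <= p.+1 + r -> m = 1 + k' ->
      k + 1 <= p + r by lia.
    rewrite cardV in cardE => le_k; apply: arith le_k cardE _.
    by have := cardsD1 e2 E; rewrite [e2 \in E]xz.
  - split; first by rewrite cycle_map; apply: sub_cycle cyc => s s' /eqP ch; apply/eqP;
    rewrite /tgt /= /src /= -/(tgt s) ch.
    by rewrite all_map; apply/allP => s /(allP sup) sE; rewrite /= uedge_map imset_f.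
  - exact: map_f.
  - exact: map_f.
  - exact: ne_f.
(* Here the image of the path visits a single vertex. As [src t1] and [src t2] differ but have the
   same image, they are [y] and [z], so the path stays on these two. *)
have vis t : traversed c t -> f (src t) = f y /\ f (tgt t) = f y.
  have f1 : f (src t1) = f y.
    have /eqP/esym/f_eq/(_ ne) := const _ t2c.
    by case/orP => /andP[/eqP-> _].
  have srcP s : s \in c -> f (src s) = f y by move/const/eqP->.
  have tgtP s : s \in c -> f (tgt s) = f y.
    by move=> sc; have [s' /srcP <- ->] := cycle_tgt cyc sc.
  by case/orP => tc; have := (srcP _ tc, tgtP _ tc) => -[].
have amb t t' : traversed c t -> traversed c t' -> lab t = lab t' -> tgt t <> tgt t' ->
    (uedge t == e1) && (uedge t' == e2) || (uedge t == e2) && (uedge t' == e1).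
  move=> ct ct' lab_t ne_t; apply: collapse; try exact: traversed_uedge sup _.
    rewrite -!uedge_map /map_traversal lab_t.
    by have [-> ->] := vis _ ct; have [-> ->] := vis _ ct'.
  apply/eqP => eq_sup; case: ne_t; move: eq_sup lab_t.
  by case: (t) (t') => [[s l] d] [[s' l'] d'] eq_sup /= e; move: eq_sup;
    rewrite -[l]/(lab (s,l,d)) e => /uedge_inj[].
(* If both folded edges are traversed, their common origin [x] is one of [y] and [z]: one folded
   edge is a loop at [x], the other leads to the other vertex, and [a] is the exceptional label. *)
case: (boolP (has (fun t => uedge t == e1) c && has (fun t => uedge t == e2) c)).
  case/andP=> /hasP[s1 s1c /eqP sup1] /hasP[s2 s2c /eqP sup2].
  have trav t e : uedge t = uedge e -> t \in c -> traversed c e.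
    by case/uedge_eq => -> tc; rewrite /traversed tc ?orbT.
  have c1 : traversed c (x, a, y) := trav _ (x, a, y) sup1 s1c.
  have c2 : traversed c (x, a, z) := trav _ (x, a, z) sup2 s2c.
  have [q xq cq] : exists2 q, x != q & traversed c (x, a, q).
    case: (x =P y) => [e|/eqP nxy]; first by exists z; rewrite ?e // -e.
    by exists y.
  apply: (two_vertex_cut cyc xq cq) => t t' ct ct' lab_t la.
  apply/eqP; apply: contraT => /eqP ne_t.
  have tgt_x s e : uedge s = uedge (x, a, e) -> lab s != a -> tgt s = x.
    by case/uedge_eq => -> //; rewrite eqxx.
  have la' : lab t' != a by rewrite -lab_t.
  by case: (ne_t); case/orP: (amb _ _ ct ct' lab_t ne_t) => /andP[/eqP h /eqP h'];
     rewrite (tgt_x _ _ h la) (tgt_x _ _ h' la').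
(* Otherwise no label is ambiguous on the path, and any edge between the two vertices can play the
   role of [a]. *)
move=> no; have [t tc ne_t] := cycle_crossing cyc t1c t2c ne.
apply: (two_vertex_cut (p := src t) (q := tgt t) (a := lab t)) => //.
  by rewrite /traversed; case: (t) tc => -[s l] d ->.
move=> t' t'' ct' ct'' lab_t _; apply/eqP; apply: contraR no => /eqP ne_tgt.
have in_c s e : traversed c s -> uedge s == e -> has (fun t => uedge t == e) c.
  by case/orP => sc se; apply/hasP; [exists s | exists (reversal s)]; rewrite ?uedge_reversal.
by case/orP: (amb _ _ ct' ct'' lab_t ne_tgt) => /andP[/in_c-> // /in_c->].
Qed.

End Folding.

(** * The subdivided bouquet of a basis *)

Section Bouquets.
Variable r : nat.
Implicit Types (a b l : letter r) (u v w : seq (letter r)).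

Definition embeds (V V' : finType) (E : graph r V) (E' : graph r V') (f : V -> V') : Prop :=
  injective f /\ forall x a y, edge E x a y -> edge E' (f x) a (f y).

(** Vertices created by an attachment must stay reachable from the base point, as [generating]
    demands. *)
Definition covers (V V' : finType) (E' : graph r V') (f : V -> V') (s : V) : Prop :=
  forall v' : V', (exists x, v' = f x) \/ exists w, walk E' (f s) w v'.

Lemma embeds_comp (V V' V'' : finType) (E : graph r V) (E' : graph r V')
    (E'' : graph r V'') f g :
  embeds E E' f -> embeds E' E'' g -> embeds E E'' (g \o f).
Proof.
by case=> inj_f fE [inj_g gE]; split=> [|x a y /fE/gE //]; apply: inj_comp.
Qed.

Lemma embeds_walk (V V' : finType) (E : graph r V) (E' : graph r V') f :
  embeds E E' f -> forall x w y, walk E x w y -> walk E' (f x) w (f y).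
Proof. by case=> _ fE; apply: walk_morph. Qed.

Definition hang (V : finType) (E : graph r V) (s : V) a : graph r (option V) :=
  uedge (Some s, a, None) |: map_graph some E.

Lemma hang_embeds (V : finType) (E : graph r V) s a : embeds E (hang E s a) some.
Proof.
split=> [x y [] //|x b y /(edge_map some) e].
by apply/setU1P; right.
Qed.

Lemma hang_edge (V : finType) (E : graph r V) s a : edge (hang E s a) (Some s) a None.
Proof. exact: setU11. Qed.

Lemma card_hang (V : finType) (E : graph r V) s a : #|hang E s a| <= #|E|.+1.
Proof.
rewrite cardsU1; case: (_ \notin _); rewrite ?add1n ?add0n ?ltnS.
  exact: leq_imset_card.
by apply: leqW; exact: leq_imset_card.
Qed.

(** Each new vertex comes with one new edge, and the last edge closes the path, so |E| - |V| grows
    by at most one. It is only an inequality because the closing edge may already be present. *)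
Lemma attach_walk w (V : finType) (E : graph r V) (s t : V) : w != [::] ->
  exists (V' : finType) (E' : graph r V') (f : V -> V'),
    [/\ embeds E E' f, walk E' (f s) w (f t), #|E'| + #|V| <= #|E| + #|V'| + 1
      & covers E' f s].
Proof.
elim: w V E s t => // a w IHw V E s t _; case: (w =P [::]) => [->|/eqP w_n0].
  exists V, (uedge (s, a, t) |: E), id; split=> [||| v']; last by left; exists v'.
  - by split=> // x b y; rewrite /edge !inE => ->; rewrite orbT.
  - by rewrite walk1 /edge !inE eqxx.
  - by rewrite cardsU1; case: (_ \notin _); rewrite ?add1n ?add0n; lia.
have [V' [E' [f [emb wk card_le cov]]]] := IHw _ (hang E s a) None (Some t) w_n0.
have emb' := hang_embeds E s a; have e := hang_edge E s a.
have fe : edge E' (f (Some s)) a (f None) by case: emb => _; apply.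
exists V', E', (f \o some); split=> [|||v'].
- exact: embeds_comp emb.
- by apply/walk_cons; exists (f None).
- by move: card_le (card_hang E s a); rewrite card_option; lia.
case: (cov v') => [[[v|] ->]|[w' wk']]; first by left; exists v.
  by right; exists [:: a]; rewrite walk1.
by right; exists (a :: w'); apply/walk_cons; exists (f None).
Qed.

Lemma attach_loops ws (V : finType) (E : graph r V) (s : V) :
    all (fun w => w != [::]) ws ->
  exists (V' : finType) (E' : graph r V') (f : V -> V'),
    [/\ embeds E E' f, forall w, w \in ws -> walk E' (f s) w (f s),
        #|E'| + #|V| <= #|E| + #|V'| + size ws & covers E' f s].
Proof.
elim: ws V E s => [|w ws IHws] V E s /=.
  exists V, E, id; split=> [|//||v']; [by split| by lia | by left; exists v'].
case/andP=> /(attach_walk E s s)[V1 [E1 [f1 [emb1 wk1 card1 cov1]]]].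
case/(IHws _ E1 (f1 s)) => V2 [E2 [f2 [emb2 wk2 card2 cov2]]].
exists V2, E2, (f2 \o f1); split=> [|w'||v'].
- exact: embeds_comp emb2.
- by rewrite inE => /predU1P[->|/wk2 //]; apply: embeds_walk emb2 _ _ _ wk1.
- by move: card1 card2; rewrite /=; lia.
- case: (cov2 v') => [[v1 ->]|]; last by right.
  case: (cov1 v1) => [[v ->]|[w' wk']]; first by left; exists v.
  by right; exists w'; apply: embeds_walk emb2 _ _ _ wk'.
Qed.

(** Unlike [walk], this keeps the edges that are traversed, which the folds have to follow. *)
Fixpoint trail (V : finType) x (c : seq (traversal r V)) y : bool :=
  if c is t :: c' then (src t == x) && trail (tgt t) c' y else x == y.

Lemma walk_trail (V : finType) (E : graph r V) x w y : walk E x w y ->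
  exists c, [/\ map (@lab r V) c = w, all (fun t => uedge t \in E) c & trail x c y].
Proof.
elim: w x => [|a w IHw] x; first by exists [::].
case/walk_cons=> z e /IHw[c [<- sup tr]]; exists ((x, a, z) :: c).
by split=> //=; [apply/andP | rewrite eqxx].
Qed.

Lemma trail_cycle (V : finType) x (c : seq (traversal r V)) :
  trail x c x -> cycle (@chained r V) c.
Proof.
case: c => // t s /= /andP[/eqP<-].
elim: s {1 3}t => [|t1 s IHs] t' /=; first by rewrite andbT.
by case/andP=> /eqP src1 /IHs->; rewrite /chained src1 eqxx.
Qed.

Lemma trail_map (V V' : finType) (f : V -> V') x (c : seq (traversal r V)) y :
  trail x c y -> trail (f x) (map (map_traversal f) c) (f y).
Proof.
by elim: c x => [x /eqP->|t c IHc x /= /andP[/eqP<- /IHc->]] /=; rewrite eqxx.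
Qed.

Lemma primitive_cut_word u : 1 < size u -> primitive (reduce u) -> freely_reduced u ->
  cut_word u.
Proof.
move=> u_gt1 [phi [auto_phi [i0 i00 phi_x]]] red_u.
have [psi [[_ psiM] phiK psiK]] := automorphism_inv auto_phi.
have [_ phiM] := auto_phi.
pose W i := fg_word (phi (gen (i, false))).
have W0 : W i0 = u by rewrite /W phi_x fg_word_reduce.
have W_n0 i : W i != [::].
  apply/eqP => Wi; have : phi (gen (i, false)) = phi 1%g.
    by rewrite fg_morph1 //; apply: val_inj; rewrite /= -/(W i) Wi.
  by move/(can_inj phiK)/(congr1 (@fg_word r)).
have [a [w [def_u w_n0]]] : exists a w, u = a :: w /\ w != [::].
  by case: (u) u_gt1 => [|a [|b w]] // _; exists a, (b :: w).
(* The circle of [u] is started by hand with its first letter: this exhibits two distinct vertices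
   on the closed path, as [fold_cut] requires. *)
pose E1 := hang (set0 : graph r unit) tt a.
have e1 : edge E1 (Some tt) a None := hang_edge _ _ _.
have [V2 [E2 [f2 [emb2 wk2 card2 cov2]]]] := attach_walk E1 None (Some tt) w_n0.
have fe2 : edge E2 (f2 (Some tt)) a (f2 None) by case: emb2 => _; apply.
pose ws := [seq W i | i <- enum 'I_r & i != i0].
have ws_n0 : all (fun w => w != [::]) ws by apply/allP=> _ /mapP[i _ ->].
have [V3 [E3 [f3 [emb3 wk3 card3 cov3]]]] := attach_loops E2 (f2 (Some tt)) ws_n0.
pose v0 := f3 (f2 (Some tt)).
have [c2 [lab2 sup2 tr2]] := walk_trail wk2.
pose c := map (map_traversal f3) ((f2 (Some tt), a, f2 None) :: c2).
have lab_c : map (@lab r V3) c = u.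
  by rewrite /c /= def_u -lab2 -!map_comp; congr (_ :: _).
have tr_c : trail v0 c v0 by apply: trail_map; rewrite /= eqxx.
have size_ws : size ws = r.-1.
  rewrite size_map size_filter -sum1_count big_enum_cond /= sum1_card.
  by rewrite cardC1 card_ord.
have wkW i : walk E3 v0 (W i) v0.
  case: (i =P i0) => [->|/eqP ne]; last by apply: wk3; rewrite map_f // mem_filter ne mem_enum.
  rewrite W0 def_u; apply: embeds_walk emb3 _ _ _ _; apply/walk_cons; by exists (f2 None).
pose Wl (l : letter r) := if l.2 then winv (W l.1) else W l.1.
have wkWl l : walk E3 v0 (Wl l) v0 by rewrite /Wl; case: l.2 => //; apply: walk_rev.
have redWl l : reduce (Wl l) = phi (gen l).
  case: l => i [] /=; rewrite /Wl /= ?reduce_winv /W reduce_word //.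
  by rewrite -fg_morphV // -gen_linv.
have gen3 : generating E3 v0.
  split=> [l|v'].
    (* The word of [psi (gen l)] expresses [gen l] in the basis; replacing its letters by the loops
       of the bouquet gives a closed walk representing [gen l]. *)
    exists (flatten (map Wl (fg_word (psi (gen l))))); first exact: walk_flatten.
    rewrite -[RHS]psiK -[psi (gen l) in RHS]reduce_word fg_morph_reduce //.
    elim: (fg_word _) => [|l' w' IHw]; first by rewrite big_nil.
    by rewrite big_cons -IHw /= reduce_cat redWl.
  case: (cov3 v') => [[v2 ->]|//].
  have w3 w' x : walk E2 (f2 (Some tt)) w' x -> walk E3 v0 w' (f3 x).
    exact: embeds_walk emb3 _ _ _.
  case: (cov2 v2) => [[[[]|] ->]|[w' wk']].
  - by exists [::]; rewrite /= eqxx.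
  - by exists [:: a]; apply: w3; rewrite walk1.
  - by exists (a :: w'); apply: w3; apply/walk_cons; exists (f2 None).
(* The first edge gives |E| - |V| at most -1, and the remaining path of [u] and the r - 1 other
   circles add at most one each. *)
have card_le : #|E3| + 1 <= #|V3| + r.
  have := card_hang (set0 : graph r unit) tt a; rewrite cards0 -/E1.
  have r_gt0 : 0 < r by case: (i0) => [m]; case: (r).
  move: card2 card3; rewrite size_ws card_option card_unit; move: r_gt0; clear.
  by lia.
have [inj2 _] := emb2; have [inj3 emb3E] := emb3.
have sup3 : all (fun t => uedge t \in E3) c.
  rewrite all_map; apply/allP=> t; rewrite inE /= => tc.
  case: t tc => [[x b] y] tc; apply: (emb3E x b y).
  by case/predU1P: tc => [[-> -> ->]|/(allP sup2)].
case: c2 => [|t2 c2] in lab2 sup2 tr2 c lab_c tr_c sup3 *.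
  by rewrite -lab2 in w_n0.
rewrite -lab_c.
apply: (@fold_cut _ _ E3 v0 c (map_traversal f3 (f2 (Some tt), a, f2 None)) (map_traversal f3 t2)) => //.
- by split=> //; apply: trail_cycle tr_c.
- by rewrite mem_head.
- by rewrite inE mem_head orbT.
- case/andP: tr2 => /eqP src2 _; rewrite /src /= -/(src t2) src2.
  by rewrite (inj_eq inj3) (inj_eq inj2).
Qed.

End Bouquets.

(** * Whitehead steps *)

Section WhiteheadSteps.
Variable r : nat.
Implicit Types (a b l : letter r) (u v w : seq (letter r)).

Lemma primitive_neq1 (g : free_group r) : primitive g -> g <> 1%g.
Proof.
case=> phi [[[psi phiK psiK] phiM] [i _ phi_i]] g1.
have : phi (gen (i, false)) = phi 1%g by rewrite phi_i g1 fg_morph1.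
by move/(can_inj phiK)/(congr1 (@fg_word r)).
Qed.

Lemma primitive_step u :
  cyclically_reduced u -> primitive (reduce u) -> size u != 1 ->
  exists v, whitehead_step u v.
Proof.
case: u => [|a [|b w]] // red prim _; first by have := primitive_neq1 prim.
by apply/cut_word_step/primitive_cut_word => //; apply: cyclically_reduced_free.
Qed.

Lemma complete_not_primitive u :
  0 < r -> cyclically_reduced u -> complete_graph (whitehead_graph u) ->
  ~ primitive (reduce u).
Proof.
move=> r_gt0 red compl prim; case: (ltnP 1 (size u)) => [u_gt1|].
  have cut := primitive_cut_word u_gt1 prim (cyclically_reduced_free red).
  by have := cut_word_incomplete red cut; rewrite compl.
move=> u_le1; have noedge e : e \notin whitehead_graph u.
  by rewrite inE; case: (u) u_le1 => [|a []].
have /forallP/(_ (Ordinal r_gt0, false))/forallP/(_ (Ordinal r_gt0, true)) := compl.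
by rewrite !(negbTE (noedge _)).
Qed.

Lemma whitehead_step_primitive u v :
  whitehead_step u v -> (primitive (reduce v) <-> primitive (reduce u)).
Proof.
case=> phi elem [-> _].
have auto_phi : automorphism phi by case: elem => [] [].
rewrite -[X in _ <-> X](primitive_automorphism _ auto_phi).
rewrite -[phi _ in X in _ <-> X]reduce_word.
exact: primitive_cyclic_reduction.
Qed.

Lemma whitehead_step_reduced u v : whitehead_step u v -> cyclically_reduced v.
Proof. by case=> phi _ [-> _]; apply/cyclic_reductionP/fg_word_reduced. Qed.

(** The values of an elementary automorphism on the letters, of length at most 3 as for [a^-1 x a]:
    finite data that a machine can hold. *)
Definition images : Type := {ffun letter r -> 3.-bseq (letter r)}.

Definition substitute (f : images) w := flatten [seq (f a : seq _) | a <- w].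

Definition substituted (f : images) w :=
  cyclic_reduction (free_reduction (substitute f w)).

Definition images_of (f : images) (phi : free_group r -> free_group r) : Prop :=
  forall a, phi (gen a) = reduce (f a).

Lemma substituteE f phi w : {morph phi : x y / (x * y)%g} -> images_of f phi ->
  phi (reduce w) = reduce (substitute f w).
Proof.
move=> phiM f_phi; rewrite fg_morph_reduce //; elim: w => [|a w IHw].
  by rewrite big_nil.
by rewrite big_cons IHw /substitute /= reduce_cat f_phi.
Qed.

Lemma size_fg_mul (g h : free_group r) :
  size (fg_word (g * h)%g) <= size (fg_word g) + size (fg_word h).
Proof. by rewrite -size_cat; apply: size_free_reduction. Qed.

Lemma size_fg_inv (g : free_group r) : size (fg_word g^-1%g) <= size (fg_word g).
Proof.
by apply: leq_trans (size_free_reduction _) _; rewrite size_rev size_map.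
Qed.

Lemma elementary_size phi l : elementary_whitehead phi -> size (fg_word (phi (gen l))) <= 3.
Proof.
have le1 a : size (fg_word (gen a)) <= 1 by [].
case=> [[_ [s ->]]|[[_ phiM] [a phi_a phi_x]]]; first exact: leq_trans (le1 _) _.
have phiV b : phi (gen (linv b)) = (phi (gen b))^-1%g.
  by rewrite gen_linv fg_morphV.
have inv3 (g : free_group r) : size (fg_word g) <= 3 -> size (fg_word g^-1%g) <= 3.
  by apply: leq_trans; apply: size_fg_inv.
suff le3 : size (fg_word (phi (gen (l.1, false)))) <= 3.
  case: l le3 => i [] //= le3.
  by rewrite -[(i, true)]/(linv (i, false)) phiV; apply: inv3.
case: (l.1 =P a.1) => [->|/eqP/phi_x].
  case: a phi_a {phi_x} => i [] /= phi_a; last by rewrite phi_a; apply: leq_trans (le1 _) _.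
  by rewrite -[(i, false)]/(linv (i, true)) phiV phi_a inv3.
have le_mul (g h : free_group r) m n : size (fg_word g) <= m -> size (fg_word h) <= n ->
    size (fg_word (g * h)%g) <= m + n.
  by move=> gm hn; apply: leq_trans (size_fg_mul _ _) (leq_add gm hn).
have le1V b : size (fg_word (gen b)^-1%g) <= 1 by apply: leq_trans (size_fg_inv _) _.
rewrite /= !inE => /or4P[] /eqP->; first exact: leq_trans (le1 _) _.
- exact: leq_trans (le_mul _ _ 1 1 _ _) _.
- exact: leq_trans (le_mul _ _ 1 1 _ _) _.
- by apply: (le_mul _ _ 2 1) => //; apply: (le_mul _ _ 1 1).
Qed.

Lemma elementary_images phi : elementary_whitehead phi -> exists f, images_of f phi.
Proof.
move=> elem; exists [ffun a => insub_bseq 3 (fg_word (phi (gen a)))] => a.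
rewrite ffunE /insub_bseq insubdK ?reduce_word //.
exact: elementary_size.
Qed.

(** Which tables come from elementary automorphisms is settled by excluded middle, once for each
    rank and outside the machine. *)
Lemma whitehead_images : exists S : seq images, forall w w',
  whitehead_step w w' <->
  exists2 f, f \in S & w' = substituted f w /\ size w' < size w.
Proof.
pose P f := exists2 phi, elementary_whitehead phi & images_of f phi.
have auto_elem (phi : free_group r -> free_group r) : elementary_whitehead phi -> automorphism phi by case=> [] [].
exists [seq f <- enum {: images} | if excluded_middle_informative (P f) then true else false].
move=> w w'; split=> [[phi elem [w'E lt_w'w]]|[f]].
  have [f f_phi] := elementary_images elem; exists f.
    rewrite mem_filter mem_enum andbT; case: excluded_middle_informative => // -[].
    by exists phi.
  by split=> //; rewrite w'E (substituteE _ _ f_phi) //; have [] := auto_elem _ elem.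
rewrite mem_filter; case: excluded_middle_informative => // -[phi elem f_phi] _ [w'E lt_w'w].
exists phi => //; split=> //; rewrite w'E (substituteE _ _ f_phi) //.
by have [] := auto_elem _ elem.
Qed.

End WhiteheadSteps.

(** * Machines with three tapes *)

Section ThreeTapes.
Variable r : nat.
Implicit Types (a b c : letter r) (u v w p s : seq (letter r)).
Local Notation sym := (symbol r void).
Local Notation tp := (tape r void).

Definition letter_sym a : sym := Some (inl a).
Arguments letter_sym : simpl never.
Definition cells w : seq sym := encode void w.

Definition act (x : sym * move) (t : tp) : tp := tape_move x.2 (tape_write x.1 t).

(* The word p ++ s with the head on the first letter of s (or after p). *)
Definition scan_right p s : tp := (rev (cells p), cells s).
(* The word p ++ s with the head on the last letter of p (or before s). *)
Definition scan_left p s : tp := tape_move GoLeft (scan_right p s).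

Definition blank_tape : tp := ([::], [::]).

Lemma scan_left_rcons p c s : scan_left (rcons p c) s = scan_right p (c :: s).
Proof.
by rewrite /scan_left /scan_right /cells /encode map_rcons rev_rcons.
Qed.

Lemma read_right p c s : tape_read (scan_right p (c :: s)) = letter_sym c.
Proof. by []. Qed.
Lemma read_right_nil p : tape_read (scan_right p [::]) = None.
Proof. by []. Qed.
Lemma read_left p c s : tape_read (scan_left (rcons p c) s) = letter_sym c.
Proof. by rewrite scan_left_rcons. Qed.
Lemma read_left_nil s : tape_read (scan_left [::] s) = None.
Proof. by case: s. Qed.

Lemma act_left p c s :
  act (letter_sym c, GoLeft) (scan_left (rcons p c) s) = scan_left p (c :: s).
Proof. by rewrite scan_left_rcons. Qed.
Lemma act_erase p c : act (None, GoLeft) (scan_left (rcons p c) [::]) = scan_left p [::].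
Proof. by rewrite scan_left_rcons. Qed.
Lemma act_turn_right s : act (None, GoRight) (scan_left [::] s) = scan_right [::] s.
Proof. by case: s. Qed.
Lemma act_right p c s :
  act (letter_sym c, GoRight) (scan_right p (c :: s)) = scan_right (rcons p c) s.
Proof. by rewrite /act /scan_right /cells /encode map_rcons rev_rcons. Qed.
Lemma act_pop c s : act (None, GoRight) (scan_right [::] (c :: s)) = scan_right [::] s.
Proof. by case: s. Qed.
Lemma act_copy c s : act (letter_sym c, GoLeft) (scan_left [::] s) = scan_left [::] (c :: s).
Proof. by case: s. Qed.
Lemma act_stay_right p s :
  act (tape_read (scan_right p s), Stay) (scan_right p s) = scan_right p s.
Proof. by case: s. Qed.
Lemma act_stay_left p s :
  act (tape_read (scan_left p s), Stay) (scan_left p s) = scan_left p s.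
Proof. by case/lastP: p => [|p c]; rewrite ?scan_left_rcons //; case: s. Qed.
Lemma act_append p c :
  act (letter_sym c, GoRight) (scan_right p [::]) = scan_right (rcons p c) [::].
Proof. by rewrite /act /scan_right /cells /encode map_rcons rev_rcons. Qed.

Lemma rev_cells w : rev (cells w) = cells (rev w).
Proof. by rewrite /cells /encode map_rev. Qed.

Lemma contents_left w : tape_contents (scan_right [::] w) = cells w.
Proof.
have dropE v : drop_blanks (cells v) = cells v by case: v.
by rewrite /tape_contents /scan_right /= dropE rev_cells dropE -rev_cells revK.
Qed.

Lemma contents_right w : tape_contents (scan_right w [::]) = cells w.
Proof. by rewrite -contents_left /tape_contents /scan_right /= cats0 revK. Qed.

Definition triple (T : Type) (x y z : T) : {ffun 'I_3 -> T} :=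
  [ffun i : 'I_3 => nth x [:: x; y; z] i].

Definition tape1 : 'I_3 := inord 1.
Definition tape2 : 'I_3 := inord 2.

Lemma triple0 (T : Type) (x y z : T) : triple x y z ord0 = x. Proof. by rewrite ffunE. Qed.
Lemma triple1 (T : Type) (x y z : T) : triple x y z tape1 = y. Proof. by rewrite ffunE inordK. Qed.
Lemma triple2 (T : Type) (x y z : T) : triple x y z tape2 = z. Proof. by rewrite ffunE inordK. Qed.

Lemma triple_map (T : Type) (f : 'I_3 -> T) (x y z : T) :
  f ord0 = x -> f tape1 = y -> f tape2 = z -> [ffun i => f i] = triple x y z.
Proof.
move=> f0 f1 f2; apply/ffunP=> i; rewrite !ffunE.
case: i => [[|[|[|//]]] lt_i] /=.
- by rewrite -f0; congr f; apply: val_inj.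
- by rewrite -f1; congr f; apply: val_inj; rewrite /= inordK.
- by rewrite -f2; congr f; apply: val_inj; rewrite /= inordK.
Qed.

Section Machine3.
Variables (Q : finType) (q0 : Q) (st : Q -> status).
Variable d : Q -> sym -> sym -> sym -> Q * (sym * move) * (sym * move) * (sym * move).

Definition machine3 : machine r 2 void :=
  @Machine r 2 void Q q0 st (fun q (x : {ffun 'I_3 -> sym}) =>
    let d := d q (x ord0) (x tape1) (x tape2) in
    (d.1.1.1, triple d.1.1.2 d.1.2 d.2)).

Lemma step_machine3 q t0 t1 t2 : running (st q) ->
  let d := d q (tape_read t0) (tape_read t1) (tape_read t2) in
  @step _ _ _ machine3 (q, triple t0 t1 t2) =
  (d.1.1.1, triple (act d.1.1.2 t0) (act d.1.2 t1) (act d.2 t2)).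
Proof.
move=> run_q /=; rewrite /step /= run_q; congr (_, _).
  by rewrite !ffunE !inordK.
apply: triple_map; rewrite ?triple0 ?triple1 ?triple2 !ffunE ?inordK //.
Qed.

End Machine3.

End ThreeTapes.

(** * Halting configurations and the first halting time *)

Section Halting.
Variables (r k : nat) (X : finType) (M : machine r k X) (u : seq (letter r)).

Lemma run_add s t : run M u (s + t) = iter s (@step _ _ _ M) (run M u t).
Proof. exact: iterD. Qed.

Lemma step_halted (c : config M) : ~~ running (stat c.1) -> step c = c.
Proof. by rewrite /step => /negbTE->. Qed.

Lemma iter_step_halted n (c : config M) :
  ~~ running (stat c.1) -> iter n (@step _ _ _ M) c = c.
Proof. by move=> h; elim: n => //= n ->; apply: step_halted. Qed.

Lemma run_halted s t :
  s <= t -> ~~ running (stat (run M u s).1) -> run M u t = run M u s.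
Proof. by move=> /subnK<- h; rewrite run_add iter_step_halted. Qed.

Lemma halts_exists t : ~~ running (stat (run M u t).1) ->
  exists2 s, s <= t & halts_at M u s /\ run M u s = run M u t.
Proof.
move=> ht; have ex : exists s, ~~ running (stat (run M u s).1) by exists t.
case: (ex_minnP ex) => s hs min_s; exists s; first exact: min_s.
split; last by rewrite (run_halted (min_s _ ht)).
split=> // s' lt_s's; apply: contraLR lt_s's => /min_s.
by rewrite -leqNgt.
Qed.

End Halting.

(** * A classical machine for Whitehead's algorithm *)

Section WhiteheadStates.
Variables (r N : nat).

(* Tape 0 is the input, tape 1 holds the current word and tape 2 its image under
   the automorphism of index i. Next i is the entry point of the round i. *)
Inductive wstate :=
| Copy
| Next of 'I_N.+1
| Scan of 'I_N.+1
| Push of 'I_N.+1 & 3.-bseq (letter r)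
| Write of 'I_N.+1 & letter r & 3.-bseq (letter r)
| CycStart of 'I_N.+1
| CycRight of 'I_N.+1 & letter r
| CycTest of 'I_N.+1 & letter r
| CycLeft of 'I_N.+1 & bool
| CycFirst of 'I_N.+1 & bool
| Compare of 'I_N.+1 & bool
| EraseImage of 'I_N.+1
| EraseWord
| CopyBack
| Rewind
| Test1
| Test2
| Done of bool.

(** A product with one slot for each kind of argument, used to make [wstate] a finite type. *)
Definition wcode : finType :=
  ('I_18 * 'I_N.+1 * option (letter r) * 3.-bseq (letter r) * bool)%type.

Definition wencode (q : wstate) : wcode :=
  let e n i := (inord n, i, None, [bseq], false) in
  match q with
  | Copy => e 0 ord0
  | Next i => e 1 i
  | Scan i => e 2 i
  | Push i p => (inord 3, i, None, p, false)
  | Write i b p => (inord 4, i, Some b, p, false)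
  | CycStart i => e 5 i
  | CycRight i a => (inord 6, i, Some a, [bseq], false)
  | CycTest i a => (inord 7, i, Some a, [bseq], false)
  | CycLeft i s => (inord 8, i, None, [bseq], s)
  | CycFirst i s => (inord 9, i, None, [bseq], s)
  | Compare i s => (inord 10, i, None, [bseq], s)
  | EraseImage i => e 11 i
  | EraseWord => e 12 ord0
  | CopyBack => e 13 ord0
  | Rewind => e 14 ord0
  | Test1 => e 15 ord0
  | Test2 => e 16 ord0
  | Done b => (inord 17, ord0, None, [bseq], b)
  end.

Definition wdecode (x : wcode) : option wstate :=
  let: (n, i, l, p, s) := x in
  match nat_of_ord n, l with
  | 0, _ => Some Copy
  | 1, _ => Some (Next i)
  | 2, _ => Some (Scan i)
  | 3, _ => Some (Push i p)
  | 4, Some b => Some (Write i b p)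
  | 5, _ => Some (CycStart i)
  | 6, Some a => Some (CycRight i a)
  | 7, Some a => Some (CycTest i a)
  | 8, _ => Some (CycLeft i s)
  | 9, _ => Some (CycFirst i s)
  | 10, _ => Some (Compare i s)
  | 11, _ => Some (EraseImage i)
  | 12, _ => Some EraseWord
  | 13, _ => Some CopyBack
  | 14, _ => Some Rewind
  | 15, _ => Some Test1
  | 16, _ => Some Test2
  | 17, _ => Some (Done s)
  | _, _ => None
  end.

Lemma wencodeK : pcancel wencode wdecode.
Proof. by case=> *; rewrite /= inordK. Qed.

HB.instance Definition _ := Finite.copy wstate (pcan_type wencodeK).

End WhiteheadStates.

Section WhiteheadMachine.
Variables (r : nat) (S : seq (images r)).
Implicit Types (a b c : letter r) (u v w p s : seq (letter r)).
Local Notation sym := (symbol r void).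
Local Notation tp := (tape r void).
Local Notation N := (size S).
Local Notation Q := (wstate r N).

Definition nth_images i : images r := nth [ffun=> [bseq]] S i.

Definition sym_letter (x : sym) : option (letter r) :=
  if x is Some (inl a) then Some a else None.

(* The new state and the actions on tapes 1 and 2; tape 0 is only used in the
   state Copy. *)
Definition wdelta (q : Q) (s0 s1 s2 : sym) : Q * (sym * move) * (sym * move) :=
  match q with
  | Copy => if sym_letter s0 is Some _ then (Copy _ _, (s0, GoRight), (s2, Stay))
            else (Next r ord0, (s1, Stay), (s2, Stay))
  | Next i => (if i < N then Scan r i else Test1 _ _, (s1, GoLeft), (s2, Stay))
  | Scan i => if sym_letter s1 is Some c then
                (Push i (insub_bseq 3 (rev (nth_images i c))), (s1, GoLeft), (s2, Stay))
              else (CycStart r i, (s1, GoRight), (s2, Stay))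
  | Push i x => match bseqval x with
                | b :: x' =>
                    if s2 == letter_sym (linv b) then
                      (Push i (insub_bseq 3 x'), (s1, Stay), (None, GoRight))
                    else (Write i b (insub_bseq 3 x'), (s1, Stay), (s2, GoLeft))
                | [::] => (Scan r i, (s1, Stay), (s2, Stay))
                end
  | Write i b x => (Push i x, (s1, Stay), (letter_sym b, Stay))
  | CycStart i => if sym_letter s2 is Some a then
                    (CycRight i a, (s1, Stay), (s2, GoRight))
                  else (Compare r i false, (s1, Stay), (s2, Stay))
  | CycRight i a => if s2 is Some _ then (CycRight i a, (s1, Stay), (s2, GoRight))
                    else (CycTest i a, (s1, Stay), (s2, GoLeft))
  | CycTest i a => if s2 == letter_sym (linv a) then
                     (CycLeft r i true, (s1, Stay), (None, GoLeft))
                   else (CycLeft r i false, (s1, Stay), (s2, GoLeft))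
  | CycLeft i x => if s2 is Some _ then (CycLeft r i x, (s1, Stay), (s2, GoLeft))
                   else (CycFirst r i x, (s1, Stay), (s2, GoRight))
  | CycFirst i x => if x then (CycStart r i, (s1, Stay), (None, GoRight))
                    else (Compare r i false, (s1, Stay), (s2, Stay))
  | Compare i x => match s1, s2 with
                   | Some _, Some _ => (Compare r i x, (s1, GoRight), (s2, GoRight))
                   | Some _, None => (Compare r i true, (s1, GoRight), (s2, Stay))
                   | None, Some _ => (Compare r i x, (s1, Stay), (s2, GoRight))
                   | None, None => (if x then EraseWord _ _ else EraseImage r i,
                                    (s1, if x then GoLeft else Stay), (s2, GoLeft))
                   end
  | EraseImage i => if s2 is Some _ then (EraseImage r i, (s1, Stay), (None, GoLeft))
                    else (Next r (inord i.+1), (s1, Stay), (s2, Stay))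
  | EraseWord => if s1 is Some _ then (EraseWord _ _, (None, GoLeft), (s2, Stay))
                 else (CopyBack _ _, (s1, Stay), (s2, Stay))
  | CopyBack => if s2 is Some _ then (CopyBack _ _, (s2, GoLeft), (None, GoLeft))
                else (Rewind _ _, (s1, GoRight), (s2, Stay))
  | Rewind => if s1 is Some _ then (Rewind _ _, (s1, GoRight), (s2, Stay))
              else (Next r ord0, (s1, Stay), (s2, Stay))
  | Test1 => if s1 is Some _ then (Test2 _ _, (s1, GoLeft), (s2, Stay))
             else (Done r _ false, (s1, Stay), (s2, Stay))
  | Test2 => (Done r _ (~~ isSome s1), (s1, Stay), (s2, Stay))
  | Done b => (q, (s1, Stay), (s2, Stay))
  end.

Definition wstat (q : Q) : status := if q is Done b then Answer b else Running.

Definition is_copy (q : Q) : bool := if q is Copy then true else false.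

Definition winput (q : Q) (s0 : sym) : sym * move :=
  (s0, if is_copy q && isSome (sym_letter s0) then GoRight else Stay).

Definition machine_W : machine r 2 void :=
  machine3 (Copy r N) wstat (fun q (s0 s1 s2 : sym) =>
    let d := wdelta q s0 s1 s2 in (d.1.1, winput q s0, d.1.2, d.2)).

Lemma wdelta_classical q (s0 s1 s2 : sym) :
  ~~ jump (wdelta q s0 s1 s2).1.2.2 && ~~ jump (wdelta q s0 s1 s2).2.2.
Proof.
case: q => *; rewrite /wdelta;
  by repeat match goal with |- context [match ?x with _ => _ end] => case: x => * end.
Qed.

Lemma machine_W_classical : classical machine_W.
Proof.
move=> q x i; rewrite [delta _ _]/= ffunE /winput.
have := wdelta_classical q (x ord0) (x tape1) (x tape2).
by case: i => [[|[|[|//]]] lt_i] /= /andP[] //; case: ifP.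
Qed.

Definition wconfig : Type := (Q * tp * tp)%type.

(** After the copying phase the head of tape 0 rests on the blank behind the input, so this tape is
    dropped and its symbol is [None]. *)
Definition wstep (x : wconfig) : wconfig :=
  let: (q, t1, t2) := x in
  if running (wstat q) then
    let d := wdelta q None (tape_read t1) (tape_read t2) in
    (d.1.1, act d.1.2 t1, act d.2 t2)
  else x.


Definition reach n (x y : wconfig) := exists2 t, t <= n & iter t wstep x = y.

Lemma reach0 x : reach 0 x x. Proof. by exists 0. Qed.

Lemma reach_le m n x y : m <= n -> reach m x y -> reach n x y.
Proof. by move=> le_mn [t le_tm <-]; exists t => //; apply: leq_trans le_mn. Qed.

Lemma reach_trans m n x y z : reach m x y -> reach n y z -> reach (m + n) x z.
Proof.
case=> t le_t <- [t' le_t' <-]; exists (t' + t); last by rewrite iterD.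
by rewrite addnC leq_add.
Qed.

Lemma reach_step n x y z : wstep x = y -> reach n y z -> reach n.+1 x z.
Proof. by move=> xy [t le_t <-]; exists t.+1; rewrite // iterSr xy. Qed.

Lemma size_images (f : images r) c : size (f c) <= 3. Proof. exact: size_bseq. Qed.

Lemma insub_bseqK (x : seq (letter r)) : size x <= 3 -> bseqval (insub_bseq 3 x) = x.
Proof. by move=> le3; rewrite /insub_bseq insubdK. Qed.

Lemma stay_right p s x : x = tape_read (scan_right p s) ->
  act (x, Stay) (scan_right p s) = scan_right p s.
Proof. by move->; apply: act_stay_right. Qed.

Lemma reach_push i (x : 3.-bseq (letter r)) p s v :
  reach ((size x).*2).+1
    (Push i x, scan_left p s, scan_right [::] v)
    (Scan r i, scan_left p s, scan_right [::] (foldl (fun v b => push b v) v x)).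
Proof.
have [n] := ubnP (size x); elim: n x v => // n IHn x v; rewrite ltnS => le_xn.
have := size_bseq x; case def_x: (bseqval x) => [|b x'] le3 /=.
  apply: (reach_step (y := (Scan r i, scan_left p s, scan_right [::] v))).
    by rewrite /= def_x /= act_stay_left act_stay_right.
  exact: reach0.
have le3' : size x' <= 3 by apply: ltnW.
have IH := IHn (insub_bseq 3 x'); rewrite insub_bseqK // in IH.
have {}IH v' := IH v' (leq_trans _ le_xn); rewrite def_x /= in IH.
case: v => [|b' v].
  apply: (reach_step (y := (Write i b (insub_bseq 3 x'), scan_left p s, scan_left [::] [::]))).
    by rewrite /= def_x /= act_stay_left.
  apply: (reach_step (y := (Push i (insub_bseq 3 x'), scan_left p s, scan_right [::] [:: b]))).
    by rewrite /wstep /= act_stay_left.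
  exact/IH/leqnn.
case: (b' =P linv b) => [->|/eqP ne].
  apply: (reach_step (y := (Push i (insub_bseq 3 x'), scan_left p s, scan_right [::] v))).
    by rewrite /wstep /wdelta def_x read_right eqxx /= act_stay_left act_pop.
  by rewrite [push _ _]/= eqxx; apply: reach_le (leqnSn _) (IH _ _); apply: leqnn.
apply: (reach_step (y := (Write i b (insub_bseq 3 x'), scan_left p s, scan_left [::] (b' :: v)))).
  have /negbTE ne' : letter_sym b' != letter_sym (linv b).
    by apply: contraNneq ne => -[->].
  by rewrite /wstep /wdelta def_x read_right ne' /= act_stay_left.
apply: (reach_step (y := (Push i (insub_bseq 3 x'), scan_left p s, scan_right [::] [:: b, b' & v]))).
  by rewrite /wstep /= act_stay_left.
by rewrite [push _ _]/= (negbTE ne); exact/IH/leqnn.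
Qed.

(** Reading the word from its last letter and pushing each image in reverse performs literally the
    [foldr] of [push] that defines free reduction. A letter costs one step of [Scan] and at most 7
    of [Push] and [Write]. *)
Lemma reach_scan i p s v :
  reach (8 * size p).+1
    (Scan r i, scan_left p s, scan_right [::] v)
    (CycStart r i, scan_right [::] (p ++ s),
     scan_right [::] (foldr (@push r) v (substitute (nth_images i) p))).
Proof.
elim/last_ind: p s v => [|p c IHp] s v.
  apply: (reach_step _ (reach0 _)).
  by rewrite /wstep /wdelta read_left_nil /= act_turn_right act_stay_right.
have step1 : wstep (Scan r i, scan_left (rcons p c) s, scan_right [::] v) =
    (Push i (insub_bseq 3 (rev (nth_images i c))), scan_left p (c :: s), scan_right [::] v).
  by rewrite /wstep /wdelta read_left /= act_left act_stay_right.
have push3 : size (rev (nth_images i c)) <= 3 by rewrite size_rev size_images.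
have step2 := reach_push i (insub_bseq 3 (rev (nth_images i c))) p (c :: s) v.
rewrite insub_bseqK // foldl_rev in step2.
have := reach_step step1 (reach_trans step2 (IHp _ _)).
rewrite cat_rcons /substitute map_rcons flatten_rcons foldr_cat.
apply: reach_le; rewrite size_rcons; move: push3; move: (size _) (size _).
by lia.
Qed.

Lemma reach_cyc_right i a w p s :
  reach (size s).+1
    (CycRight i a, scan_right [::] w, scan_right p s)
    (CycTest i a, scan_right [::] w, scan_left (p ++ s) [::]).
Proof.
elim: s p => [|c s IHs] p.
  apply: (reach_step _ (reach0 _)).
  by rewrite /wstep /wdelta /= act_stay_right cats0.
rewrite -cat_rcons; apply: reach_step (IHs _).
by rewrite /wstep /wdelta read_right /= act_stay_right act_right.
Qed.

Lemma reach_cyc_left i x w p s :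
  reach (size p).+1
    (CycLeft r i x, scan_right [::] w, scan_left p s)
    (CycFirst r i x, scan_right [::] w, scan_right [::] (p ++ s)).
Proof.
elim/last_ind: p s => [|p c IHp] s.
  apply: (reach_step _ (reach0 _)).
  by rewrite /wstep /wdelta read_left_nil /= act_stay_right act_turn_right.
rewrite cat_rcons size_rcons; apply: reach_step (IHp _).
by rewrite /wstep /wdelta read_left /= act_stay_right act_left.
Qed.

(** Without jumps, each comparison of the two end letters sweeps over the word and back; this is the
    only quadratic phase of a round. *)
Lemma reach_cyc i w v :
  reach ((size v).+1 * (2 * size v + 6))
    (CycStart r i, scan_right [::] w, scan_right [::] v)
    (Compare r i false, scan_right [::] w, scan_right [::] (cyclic_reduction v)).
Proof.
have start a v' : wstep (CycStart r i, scan_right [::] w, scan_right [::] (a :: v')) =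
    (CycRight i a, scan_right [::] w, scan_right [:: a] v').
  by rewrite /wstep /wdelta read_right /= act_stay_right act_right.
have stop v' : wstep (CycFirst r i false, scan_right [::] w, scan_right [::] v') =
    (Compare r i false, scan_right [::] w, scan_right [::] v').
  by rewrite /wstep /wdelta /= !act_stay_right.
have nostrip a b p : b != linv a ->
    wstep (CycTest i a, scan_right [::] w, scan_left (rcons p b) [::]) =
    (CycLeft r i false, scan_right [::] w, scan_left p [:: b]).
  move=> ne; have /negbTE ne' : letter_sym b != letter_sym (linv a).
    by apply: contraNneq ne => -[->].
  by rewrite /wstep /wdelta read_left ne' /= act_stay_right act_left.
have strip a p : wstep (CycTest i a, scan_right [::] w, scan_left (rcons p (linv a)) [::]) =
    (CycLeft r i true, scan_right [::] w, scan_left p [::]).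
  by rewrite /wstep /wdelta read_left eqxx /= act_stay_right act_erase.
elim/seq_ends_ind: v => [|a|a v b IHv].
- apply: (reach_le (m := 1)) => //; apply: (reach_step _ (reach0 _)).
  by rewrite /wstep /wdelta /= !act_stay_right.
- have test := nostrip a a [::]; rewrite eq_sym linv_neq in test.
  apply: reach_le (reach_step (start a [::]) (reach_trans
    (reach_cyc_right i a w [:: a] [::]) (reach_step (test isT) (reach_trans
    (reach_cyc_left i false w [::] [:: a]) (reach_step (stop _) (reach0 _)))))).
  by [].
have := reach_step (start a (rcons v b)) (reach_cyc_right i a w [:: a] (rcons v b)).
rewrite cyclic_reductionE cat1s -rcons_cons.
case: (b =P linv a) => [->|/eqP ne] cyc1.
  apply: reach_le (reach_trans cyc1 (reach_step (strip _ _) (reach_trans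
      (reach_cyc_left _ _ _ _ _) (reach_step _ IHv)))).
  - rewrite /= !size_rcons; move: (size v) => n; nia.
  - by rewrite /wstep /wdelta /= cats0 act_stay_right act_pop.
apply: reach_le (reach_trans cyc1 (reach_step (nostrip _ _ _ ne) (reach_trans
      (reach_cyc_left _ _ _ _ _) (reach_step _ (reach0 _))))).
- rewrite /= !size_rcons; move: (size v) => n; nia.
- by rewrite stop cats1.
Qed.

(** The flag turns true once tape 2 is exhausted before tape 1, that is, when the image is strictly
    shorter than the current word. *)
Lemma reach_compare i x p1 s1 p2 s2 :
  reach (size s1 + size s2).+1
    (Compare r i x, scan_right p1 s1, scan_right p2 s2)
    (if x || (size s2 < size s1)
     then (EraseWord r _, scan_left (p1 ++ s1) [::], scan_left (p2 ++ s2) [::])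
     else (EraseImage r i, scan_right (p1 ++ s1) [::], scan_left (p2 ++ s2) [::])).
Proof.
elim: s1 s2 x p1 p2 => [|c1 s1 IHs1] s2 x p1 p2.
  elim: s2 p2 => [|c2 s2 IHs2] p2.
    rewrite !cats0 orbF; apply: (reach_step _ (reach0 _)).
    by rewrite /wstep /wdelta /=; case: x; rewrite //= ?act_stay_right.
  rewrite -(cat_rcons c2); apply: reach_step (IHs2 _).
  by rewrite /wstep /wdelta read_right /= act_stay_right act_right.
rewrite -(cat_rcons c1); case: s2 => [|c2 s2].
  rewrite orbT; have := IHs1 [::] true (rcons p1 c1) p2; apply: reach_step.
  by rewrite /wstep /wdelta read_right /= act_stay_right act_right.
rewrite -(cat_rcons c2) ltnS; have := IHs1 s2 x (rcons p1 c1) (rcons p2 c2).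
move/(reach_le (n := (size s1 + size (c2 :: s2)).+1)) => h.
apply: reach_step; last by apply: h; rewrite /= addnS ltnW.
by rewrite /wstep /wdelta !read_right /= !act_right.
Qed.

Lemma reach_erase_image i w p :
  reach (size p).+1
    (EraseImage r i, scan_right w [::], scan_left p [::])
    (Next r (inord i.+1), scan_right w [::], blank_tape r).
Proof.
elim/last_ind: p => [|p c IHp].
  apply: (reach_step _ (reach0 _)).
  by rewrite /wstep /wdelta read_left_nil /= act_stay_right.
rewrite size_rcons; apply: reach_step IHp.
by rewrite /wstep /wdelta read_left /= act_stay_right act_erase.
Qed.

Lemma reach_erase_word v p :
  reach (size p).+1
    (EraseWord r _, scan_left p [::], scan_left v [::])
    (CopyBack r _, scan_left [::] [::], scan_left v [::]).
Proof.
elim/last_ind: p => [|p c IHp].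
  apply: (reach_step _ (reach0 _)).
  by rewrite /wstep /wdelta read_left_nil /= act_stay_left.
rewrite size_rcons; apply: reach_step IHp.
by rewrite /wstep /wdelta read_left /= act_stay_left act_erase.
Qed.

Lemma reach_copy_back p s :
  reach (size p).+1
    (CopyBack r _, scan_left [::] s, scan_left p [::])
    (Rewind r _, scan_right [::] (p ++ s), blank_tape r).
Proof.
elim/last_ind: p s => [|p c IHp] s.
  apply: (reach_step _ (reach0 _)).
  by rewrite /wstep /wdelta !read_left_nil /= act_turn_right.
rewrite size_rcons cat_rcons; apply: reach_step (IHp _).
by rewrite /wstep /wdelta read_left /= act_copy act_erase.
Qed.

Lemma reach_rewind p s :
  reach (size s).+1
    (Rewind r _, scan_right p s, blank_tape r)
    (Next r ord0, scan_right (p ++ s) [::], blank_tape r).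
Proof.
elim: s p => [|c s IHs] p.
  apply: (reach_step _ (reach0 _)).
  by rewrite /wstep /wdelta read_right_nil /= cats0.
rewrite -cat_rcons; apply: reach_step (IHs _).
by rewrite /wstep /wdelta read_right /= act_right.
Qed.

Definition at_next (i : 'I_N.+1) w : wconfig :=
  (Next r i, scan_right w [::], blank_tape r).

(** The image has at most 3 n letters before cyclic reduction, and the phases of a round then add up
    to at most 18 n^2 + 43 n + 12 steps. *)
Definition round_bound n := 43 * (n.+1 * n.+1).

Lemma size_substitute f w : size (substitute f w) <= 3 * size w.
Proof.
elim: w => //= a w IHw; rewrite size_cat mulnS; exact: leq_add (size_images f a) IHw.
Qed.

Lemma reach_round (i : 'I_N.+1) w : i < N ->
  let v := substituted (nth_images i) w in
  reach (round_bound (size w)) (at_next i w)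
    (if size v < size w then at_next ord0 v else at_next (inord i.+1) w).
Proof.
move=> lt_iN v; pose v0 := free_reduction (substitute (nth_images i) w).
have size_v0 : size v0 <= 3 * size w.
  exact: leq_trans (size_free_reduction _) (size_substitute _ _).
have size_v : size v <= 3 * size w := leq_trans (size_cyclic_reduction v0) size_v0.
have step1 : wstep (at_next i w) = (Scan r i, scan_left w [::], scan_right [::] [::]).
  by rewrite /wstep /wdelta /= lt_iN.
have h1 := reach_step step1 (reach_scan i w [::] [::]); rewrite cats0 in h1.
have h2 := reach_trans h1 (reach_cyc i w v0).
have h3 := reach_trans h2 (reach_compare i false [::] w [::] v).
move: h3; rewrite -/v !cat0s orFb; case: ifP => _ h3.
  have h4 := reach_trans h3 (reach_trans (reach_erase_word v w)
      (reach_trans (reach_copy_back v [::]) (reach_rewind [::] (v ++ [::])))).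
  rewrite cats0 in h4; apply: reach_le h4; rewrite /round_bound.
  by move: size_v0 size_v; move: (size w) (size v0) (size v); clear; nia.
have h4 := reach_trans h3 (reach_erase_image i w v).
apply: reach_le h4; rewrite /round_bound.
by move: size_v0 size_v; move: (size w) (size v0) (size v); clear; nia.
Qed.

End WhiteheadMachine.

(** * Complete runs of the search and their cubic cost *)

Section WhiteheadRun.
Variables (r : nat) (S : seq (images r)).
Implicit Types (a b c : letter r) (u v w p s : seq (letter r)).
Local Notation N := (size S).
Local Notation at_next := (@at_next r S).
Local Notation wstep := (@wstep r S).
Local Notation reach := (@reach r S).

Lemma reach_rounds (i : 'I_N.+1) w :
  (exists2 f, f \in S & size (substituted f w) < size w /\
     reach ((N - i) * round_bound (size w)) (at_next i w) (at_next ord0 (substituted f w))) \/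
  (forall f, f \in drop i S -> size w <= size (substituted f w)) /\
     reach ((N - i) * round_bound (size w)) (at_next i w) (at_next ord_max w).
Proof.
have [k] := ubnP (N - i); elim: k i => // k IHk i; rewrite ltnS => le_k.
case: (ltnP i N) => [lt_iN|le_Ni]; last first.
  right; rewrite drop_oversize //; split=> //.
  have -> : i = ord_max by apply: val_inj; apply/eqP; rewrite eqn_leq le_Ni -ltnS ltn_ord.
  by rewrite /= subnn; apply: reach0.
have fS : nth_images S i \in S by apply: mem_nth.
have := reach_round w lt_iN; rewrite /=; case: ifP => [lt_size|/negbT].
  move=> h; left; exists (nth_images S i) => //; split=> //; apply: reach_le h.
  by rewrite -[leqLHS]mul1n leq_mul2r subn_gt0 lt_iN orbT.
rewrite -leqNgt => le_size h; have iS : (inord i.+1 : 'I_N.+1) = i.+1 :> nat by rewrite inordK.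
have split_mul : (N - i) * round_bound (size w) =
    round_bound (size w) + (N - (inord i.+1 : 'I_N.+1)) * round_bound (size w).
  by rewrite iS -mulSn subnSK.
have /IHk : N - (inord i.+1 : 'I_N.+1) < k by rewrite iS; lia.
rewrite split_mul; case=> [[f fS' [lt_f h']]|[ge_f h']]; [left|right].
  by exists f => //; split=> //; apply: reach_trans h h'.
split; last exact: reach_trans h h'.
move=> f; rewrite (drop_nth [ffun=> [bseq]]) // inE => /predU1P[->//|].
by rewrite -iS; apply: ge_f.
Qed.

Lemma reach_test w : exists t1 t2,
  reach 3 (at_next ord_max w) (Done r _ (size w == 1), t1, t2).
Proof.
have step1 : wstep (at_next ord_max w) = (Test1 r _, scan_left w [::], blank_tape r).
  by rewrite /wstep /wdelta /= ltnn.
case/lastP: w => [|p c] in step1 *.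
  do 2!eexists; apply: (reach_le (m := 2)) => //; apply: reach_step step1 _.
  apply: (reach_step _ (reach0 _)); first by [].
have step2 : wstep (Test1 r _, scan_left (rcons p c) [::], blank_tape r) =
    (Test2 r _, scan_left p [:: c], blank_tape r).
  by rewrite /wstep /wdelta read_left /= act_left.
do 2!eexists; apply: reach_step step1 _; apply: reach_step step2 _.
apply: (reach_step _ (reach0 _)).
rewrite /wstep /wdelta /=; congr (Done _ _ _, _, _); rewrite size_rcons.
by case/lastP: p => [|p b]; rewrite ?read_left_nil ?read_left // size_rcons.
Qed.

(** Every successful search shortens the word, so there are at most n + 1 searches of at most [N]
    rounds; the 3 pays for the final length test. *)
Definition search_bound n := n.+1 * (N * round_bound n + 3).

Hypothesis S_steps : forall w w', whitehead_step w w' <->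
  exists2 f, f \in S & w' = substituted f w /\ size w' < size w.

Lemma whitehead_search w : exists m (ws : nat -> seq (letter r)) (tau : nat -> nat) t,
  [/\ ws 0 = w, forall i, i < m -> whitehead_step (ws i) (ws i.+1)
    & forall v, ~ whitehead_step (ws m) v] /\
  [/\ {homo tau : i i' / i < i'},
      forall i, i <= m -> iter (tau i) wstep (at_next ord0 w) = at_next ord0 (ws i),
      tau m <= t <= search_bound (size w)
    & exists t1 t2, iter t wstep (at_next ord0 w) = (Done r _ (size (ws m) == 1), t1, t2)].
Proof.
have [n] := ubnP (size w); elim: n w => // n IHn w; rewrite ltnS => le_wn.
case: (reach_rounds ord0 w) => [[f fS [lt_size [t1 le_t1 run1]]]|[ge_size h]].
  have step_w : whitehead_step w (substituted f w) by apply/S_steps; exists f.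
  have [m [ws [tau [t [[ws0 wsS wsm] [tau_homo tau_ws /andP[le_t le_T] fin]]]]]] :=
    IHn _ (leq_trans lt_size le_wn).
  (* The two configurations carry words of different lengths, so time has passed; this makes [tau]
     strictly increasing. *)
  have t1_gt0 : 0 < t1.
    case: (posnP t1) run1 => // -> [/(congr1 size)]; rewrite !size_rev !size_map => eq_size.
    by rewrite eq_size ltnn in lt_size.
  exists m.+1, (fun i => if i is i'.+1 then ws i' else w),
    (fun i => if i is i'.+1 then t1 + tau i' else 0), (t1 + t); split; split=> //.
  - by move=> [|i] /=; rewrite ?ws0 //; apply: wsS.
  - move=> [|i] [|j] // lt_ij; first by rewrite addn_gt0 t1_gt0.
    by rewrite ltn_add2l; apply: tau_homo.
  - by move=> [|i] // le_im; rewrite addnC iterD run1 tau_ws.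
  - rewrite leq_add2l le_t /=; apply: leq_trans (leq_add le_t1 le_T) _.
    rewrite /search_bound subn0; move: lt_size; move: (size w) (size _) => a b lt_ba.
    have : b.+1 * (N * round_bound b + 3) <= a * (N * round_bound a + 3).
      rewrite leq_mul // leq_add2r leq_mul2l /round_bound.
      by rewrite leq_pmul2l // leq_mul ?orbT // leqW.
    move: (b.+1 * _) => y; rewrite mulSn -addnA leq_add2l => h.
    exact: leq_trans h (leq_addl _ _).
  - by have [x1 [x2 fin']] := fin; exists x1, x2; rewrite addnC iterD run1.
have [x1 [x2 h']] := reach_test w; have [t le_t run_t] := reach_trans h h'.
exists 0, (fun=> w), id, t; split; split=> //.
- by move=> v /S_steps[f fS [-> ]]; rewrite ltnNge ge_size // drop0.
- by case.
- rewrite /=; apply: leq_trans le_t _; rewrite /search_bound subn0 mulSn.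
  by rewrite leq_addr.
- by exists x1, x2.
Qed.

Lemma wdelta_not_copy q (s0 s1 s2 : symbol r void) :
  ~~ is_copy q -> ~~ is_copy (@wdelta r S q s0 s1 s2).1.1.
Proof.
by case: q => // *; rewrite /wdelta;
  repeat match goal with |- context [match ?x with _ => _ end] => destruct x end.
Qed.

Section Simulation.
Variable u : seq (letter r).

Definition with_input (x : wconfig S) : config (machine_W S) :=
  (x.1.1, triple (scan_right u [::]) x.1.2 x.2).

Lemma step_with_input x : ~~ is_copy x.1.1 ->
  step (with_input x) = with_input (wstep x) /\ ~~ is_copy (wstep x).1.1.
Proof.
case: x => [[q t1 t2]] /= q_nc; rewrite /with_input /=.
case run_q: (running (wstat q)) => /=; last by rewrite /step /= run_q.
split.
  by rewrite step_machine3 //= /winput (negbTE q_nc) /= stay_right.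
exact: wdelta_not_copy.
Qed.

Lemma iter_with_input t x : ~~ is_copy x.1.1 ->
  iter t (@step _ _ _ (machine_W S)) (with_input x) = with_input (iter t wstep x).
Proof.
move=> x_nc; suff [] : iter t (@step _ _ _ (machine_W S)) (with_input x) =
    with_input (iter t wstep x) /\ ~~ is_copy (iter t wstep x).1.1 by [].
elim: t => //= t [-> nc]; exact: step_with_input.
Qed.

Lemma run_copy k : k <= size u ->
  run (machine_W S) u k = (Copy r N,
    triple (scan_right (take k u) (drop k u)) (scan_right (take k u) [::]) (blank_tape r)).
Proof.
elim: k => [|k IHk] le_k.
  rewrite /run /= take0 drop0; congr (_, _); apply/ffunP=> i; rewrite !ffunE.
  by case: i => [[|[|[|]]]].
have [x0 _] : exists x0 : letter r, true by case: (u) le_k => // x0; exists x0.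
rewrite /run iterS -/(run _ _ _) (IHk (ltnW le_k)).
rewrite (drop_nth x0) // (take_nth x0) // step_machine3 //.
by rewrite read_right /= /winput /= act_right act_append.
Qed.

Lemma run_copied : run (machine_W S) u (size u).+1 = with_input (at_next ord0 u).
Proof.
rewrite /run iterS -/(run _ _ _) run_copy // take_size drop_size step_machine3 //.
Qed.

End Simulation.

Lemma machine_W_search u : exists m (ws : nat -> seq (letter r)) (tau : nat -> nat) t,
  [/\ ws 0 = u, forall i, i < m -> whitehead_step (ws i) (ws i.+1)
    & forall v, ~ whitehead_step (ws m) v] /\
  [/\ {homo tau : i i' / i < i'},
      forall i, i <= m ->
        tape_contents ((run (machine_W S) u (tau i)).2 tape1) = encode void (ws i),
      tau m <= t <= (size u).+1 + search_bound (size u), halts_at (machine_W S) u t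
    & stat (run (machine_W S) u t).1 = Answer (size (ws m) == 1)].
Proof.
have [m [ws [tau [t [ws_steps [tau_homo tau_ws /andP[le_t le_T] [x1 [x2 fin]]]]]]]] :=
  whitehead_search u.
have runE t' : run (machine_W S) u (t' + (size u).+1) =
    with_input u (iter t' wstep (at_next ord0 u)).
  by rewrite /run iterD -/(run _ _ _) run_copied iter_with_input.
have run_fin : stat (run (machine_W S) u (t + (size u).+1)).1 = Answer (size (ws m) == 1).
  by rewrite runE fin.
have [t' le_t' [halt_t' run_t']] : exists2 s, s <= t + (size u).+1 &
    halts_at (machine_W S) u s /\
    run (machine_W S) u s = run (machine_W S) u (t + (size u).+1).
  by apply: halts_exists; rewrite run_fin.
exists m, ws, (fun i => tau i + (size u).+1), t'; split; first exact: ws_steps.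
split=> //.
- by move=> i j lt_ij; rewrite ltn_add2r tau_homo.
- by move=> i le_i; rewrite runE tau_ws // triple1 contents_right.
- apply/andP; split; last by apply: leq_trans le_t' _; rewrite addnC leq_add2l.
  (* At time [tau m] the machine is still in a state [Next], so it has not halted before. *)
  rewrite leqNgt; apply/negP => /ltnW lt_t'.
  have [nrun _] := halt_t'; have := run_halted lt_t' nrun.
  by move=> E; move: nrun; rewrite -E runE tau_ws.
- by rewrite run_t'.
Qed.

End WhiteheadRun.

(** * Running both algorithms in parallel *)

Section AlgorithmTRuns.
Variable r : nat.
Implicit Types (a b c : letter r) (u v w p s : seq (letter r)).

Lemma whitehead_graph_catl u v : whitehead_graph u \subset whitehead_graph (u ++ v).
Proof.
apply/subsetP=> e; rewrite !inE; case: u => [|z s] //=; elim: s z => [|z' s IHs] z //=.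
by rewrite !inE => /predU1P[->|/IHs->]; rewrite ?eqxx ?orbT.
Qed.

Lemma complete_prefix u k :
  complete_graph (whitehead_graph (take k u)) -> complete_graph (whitehead_graph u).
Proof.
move=> /forallP compl; apply/forallP=> x; apply/forallP=> y; apply/implyP=> ne.
have /forallP/(_ y)/implyP/(_ ne) := compl x.
have /subsetP sub := whitehead_graph_catl (take k u) (drop k u).
rewrite cat_take_drop in sub.
by case/orP => /sub->; rewrite ?orbT.
Qed.

Local Opaque complete_graph.

Lemma machine_T_complete u k : 0 < k <= size u ->
    complete_graph (whitehead_graph (take k u)) ->
  exists2 t, t <= k & stat (run (machine_T r) u t).1 = Answer false.
Proof.
case/andP=> k_gt0 le_k compl.
have ex : exists k, (0 < k <= size u) && complete_graph (whitehead_graph (take k u)).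
  by exists k; rewrite k_gt0 le_k.
case: (ex_minnP ex) => -[|n] // /andP[le_n compl_n] min_n; exists n.+1.
  by apply: min_n; rewrite k_gt0 le_k compl.
have inc j : 0 < j <= n -> ~~ complete_graph (whitehead_graph (take j u)).
  case/andP=> j_gt0 le_jn; apply/negP => compl_j; have := min_n j.
  by rewrite j_gt0 (leq_trans le_jn (ltnW le_n)) compl_j ltnNge le_jn => /(_ isT).
rewrite /run iterS -/(run _ _ _) (machine_T_run (ltnW le_n) inc).
have [x0 _] : exists x0 : letter r, true by case: (u) le_n => // x0; exists x0.
have Ek := take_nth x0 le_n; set a := nth x0 u n in Ek.
rewrite /step /= /T_delta /= !ffunE /tape_read (drop_nth x0 le_n) -/a /=.
have -> : T_extend (ohead (rev (take n u))) (whitehead_graph (take n u)) a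
          = whitehead_graph (take n.+1 u).
  rewrite Ek; case: (lastP (take n u)) => [|w b] /=.
    by apply/setP=> e; rewrite !inE.
  by rewrite rev_rcons /= whitehead_graph_rcons.
by rewrite compl_n.
Qed.

Lemma machine_T_sound u t (b : bool) :
  stat (run (machine_T r) u t).1 = Answer b ->
  b = false /\ complete_graph (whitehead_graph u).
Proof.
move=> ans; split.
  by move: ans; case: (run _ _ _).1 => [[]|[]] //= -[].
apply: contraT => incompl.
have inc k j : 0 < j <= k -> ~~ complete_graph (whitehead_graph (take j u)).
  by move=> _; apply: contra incompl; apply: complete_prefix.
have run_T k (le_k : k <= size u) := machine_T_run le_k (inc k).
have stopped : (run (machine_T r) u (size u).+1).1 = inr false.
  rewrite /run iterS -/(run _ _ _) (run_T _ (leqnn _)) /step /= /T_delta.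
  by rewrite !ffunE drop_size.
case: (leqP t (size u)) => [le_t|lt_t]; first by rewrite run_T in ans.
by move: ans; rewrite (run_halted lt_t) stopped.
Qed.

End AlgorithmTRuns.

Section Parallel.
Variables (r : nat) (S : seq (images r)).
Implicit Types (a b c : letter r) (u v w p s : seq (letter r)).
Local Notation sym := (symbol r void).
Local Notation T := (machine_T r).
Local Notation W := (machine_W S).

Definition both_stat (q : state T * state W) : status :=
  match stat q.1, stat q.2 with
  | Answer b, _ => Answer b
  | _, Answer b => Answer b
  | _, _ => Running
  end.

(** T has no tape of its own: it reads tape 0, whose head is moved by W. The two machines thus share
    the input. *)
Definition machine_A : machine r 2 void :=
  @Machine r 2 void (state T * state W)%type (start T, start W) both_stat
    (fun q (x : {ffun 'I_3 -> sym}) =>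
       (((@delta _ _ _ T q.1 [ffun=> x ord0]).1, (@delta _ _ _ W q.2 x).1),
        (@delta _ _ _ W q.2 x).2)).

Lemma machine_A_classical : classical machine_A.
Proof. by move=> q x i; apply: (@machine_W_classical r S). Qed.

Definition decode (x : config machine_A) : config T * config W :=
  ((x.1.1, [ffun=> x.2 ord0]), (x.1.2, x.2)).

(* As long as T reads, W copies: the two heads on the input tape move together. *)
Definition synchronous (x : config machine_A) : Prop :=
  (exists p s, x.2 ord0 = scan_right p s) /\
  (running (stat x.1.1) = is_copy x.1.2 \/ stat x.1.1 = Answer false).

Lemma step_decode x : synchronous x -> running (stat x.1) ->
  decode (step x) = (step (decode x).1, step (decode x).2) /\ synchronous (step x).
Proof.
case: x => [[qT qW] tp] [[p [s tp0]] /= sync] run_x.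
have run_W : running (wstat qW).
  move: run_x; rewrite /both_stat /=; clear.
  by case: (T_stat qT) => [||?]; case: qW.
have not_ans : T_stat qT <> Answer false by move=> e; rewrite /both_stat /= e in run_x.
case: sync => // sync.
have stepE : step (M := machine_A) (qT, qW, tp) =
    (((@delta _ _ _ T qT [ffun=> tape_read (tp ord0)]).1,
      (wdelta qW (tape_read (tp ord0)) (tape_read (tp tape1)) (tape_read (tp tape2))).1.1),
     (step (M := W) (qW, tp)).2).
  by rewrite /step /= run_x run_W /= !ffunE /=.
have tp0' : (step (M := W) (qW, tp)).2 ord0 = act (winput qW (tape_read (tp ord0))) (tp ord0).
  by rewrite /step /= run_W /= !ffunE /=.
have read0 : tape_read (tp ord0) = tape_read (scan_right p s) by rewrite tp0.
have stW : step (M := W) (qW, tp) = (((wdelta qW (tape_read (tp ord0))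
    (tape_read (tp tape1)) (tape_read (tp tape2))).1.1 : state W), (step (M := W) (qW, tp)).2).
  by rewrite /step /= run_W /= !ffunE.
have argE (t : tape r void) :
    [ffun i : 'I_1 => tape_read ([ffun=> t] i)] = [ffun=> tape_read t].
  by apply/ffunP=> i; rewrite !ffunE.
pose qT' := (@delta _ _ _ T qT [ffun=> tape_read (tp ord0)]).1.
pose qW' := (wdelta qW (tape_read (tp ord0)) (tape_read (tp tape1)) (tape_read (tp tape2))).1.1.
pose tpi := act (winput qW (tape_read (tp ord0))) (tp ord0).
suff [tpT syn1 syn2] : [/\ step (M := T) (qT, [ffun=> tp ord0]) = (qT', [ffun=> tpi]),
    exists p' s', tpi = scan_right p' s'
  & running (T_stat qT') = is_copy qW' \/ T_stat qT' = Answer false].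
  rewrite tpT stepE; split; last by split=> //; rewrite [_ ord0]tp0'.
  by rewrite /decode /= tp0'; congr (_, _); rewrite [RHS]stW.
rewrite {}/tpi {}/qT' {}/qW'; rewrite /= in tp0; rewrite tp0.
(* If T has stopped without an answer, W is past its copying phase and leaves tape 0 alone.
   Otherwise both read the same cell: on a letter both move right, on the blank both stay. *)
case: qT sync not_ans {run_x stepE} => [[l G]|[]] //= sync _; last first.
  have W_nc : ~~ is_copy qW by rewrite -sync.
  rewrite /winput (negbTE W_nc) /= act_stay_right; split; first by [].
    by exists p, s.
  by left; rewrite (negbTE (wdelta_not_copy _ _ _ W_nc)).
have qW_copy : qW = Copy r _ by case: (qW) sync.
rewrite /step /= argE qW_copy.
case: s read0 tp0 => [|c s] read0 tp0; rewrite /T_delta !ffunE /=.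
  split; last by left.
    by congr (_, _); apply/ffunP=> i; rewrite !ffunE.
  by exists p, [::].
split.
- by congr (_, _); apply/ffunP=> i; rewrite !ffunE.
- by exists (rcons p c), s; rewrite act_right.
- by case: complete_graph; [right | left].
Qed.

(** Each step of the parallel machine is one step of T and one of W, until it freezes at the first
    answer; the simulated time stops there too. *)
Definition busy_steps u t := \sum_(t' < t) running (stat (run machine_A u t').1).

Lemma busy_stepsS u t :
  busy_steps u t.+1 = busy_steps u t + running (stat (run machine_A u t).1).
Proof. by rewrite /busy_steps big_ord_recr. Qed.

Lemma run_decode u t :
  decode (run machine_A u t) = (run T u (busy_steps u t), run W u (busy_steps u t)) /\
  synchronous (run machine_A u t).
Proof.
elim: t => [|t [IHd IHs]].
  rewrite /busy_steps big_ord0; split.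
    by congr (_, _, _); apply/ffunP=> i; rewrite !ffunE /= ord1 eqxx.
  by split; [exists [::], u; rewrite ffunE | left].
have runS : run machine_A u t.+1 = step (run machine_A u t) by [].
rewrite busy_stepsS runS; case run_t: (running _); last first.
  by rewrite addn0 -IHd step_halted ?run_t.
have [dec_t syn_t] := step_decode IHs run_t.
by rewrite addn1; split=> //; rewrite dec_t IHd.
Qed.

Lemma stat_machine_A u t : stat (run machine_A u t).1 =
  match stat (run T u (busy_steps u t)).1, stat (run W u (busy_steps u t)).1 with
  | Answer b, _ => Answer b
  | _, Answer b => Answer b
  | _, _ => Running
  end.
Proof.
have [dec_t _] := run_decode u t.
have -> : run T u (busy_steps u t) = (decode (run machine_A u t)).1 by rewrite dec_t.
by have -> : run W u (busy_steps u t) = (decode (run machine_A u t)).2 by rewrite dec_t.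
Qed.

Lemma machine_A_parallel (P : pred (seq (letter r))) : runs_in_parallel P machine_A T W.
Proof.
exists decode, busy_steps, busy_steps => u _.
split=> [|t|t|t|t]; rewrite ?leqnSn //.
- by rewrite /busy_steps big_ord0.
- by rewrite busy_stepsS; case: (running _); rewrite ?addn0 ?addn1 ?leqnn ?leqnSn.
- by have [] := run_decode u t.
- exact: stat_machine_A.
Qed.

Lemma busy_steps_id u t :
  (forall t', t' < t -> running (stat (run machine_A u t').1)) -> busy_steps u t = t.
Proof.
move=> busy; rewrite /busy_steps; under eq_bigr => i _ do rewrite busy //.
by rewrite sum1_card card_ord.
Qed.

Lemma machine_A_halts u t (b : bool) :
    stat (run T u t).1 = Answer b \/ stat (run W u t).1 = Answer b ->
  exists2 s, s <= t & halts_at machine_A u s.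
Proof.
move=> ans; case: (boolP [exists s : 'I_t, ~~ running (stat (run machine_A u s).1)]).
  case/existsP=> s /halts_exists[s' le_s' [h _]]; exists s' => //.
  exact: leq_trans le_s' (ltnW (ltn_ord s)).
move=> /existsPn all_run.
have busy t' : t' < t -> running (stat (run machine_A u t').1).
  by move=> lt_t'; have := all_run (Ordinal lt_t'); rewrite negbK.
have [|s le_s [h _]] := @halts_exists _ _ _ machine_A u t; last by exists s.
rewrite stat_machine_A busy_steps_id //.
by case: (stat (run T u t).1) ans => [||b'] [] // ->.
Qed.

Hypothesis r_gt0 : 0 < r.
Hypothesis S_steps : forall w w', whitehead_step w w' <->
  exists2 f, f \in S & w' = substituted f w /\ size w' < size w.

(** Steps preserve primitivity, and by [primitive_step] a primitive word that admits no step has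
    length one. *)
Lemma machine_W_correct u t (b : bool) : cyclically_reduced u ->
  stat (run W u t).1 = Answer b -> b <-> primitive (reduce u).
Proof.
move=> red ans; have [m [ws [tau [t' [[ws0 wsS wsm] [_ _ _ halt_t' ans']]]]]] :=
  machine_W_search S_steps u.
have steps i : i <= m -> cyclically_reduced (ws i) /\
    (primitive (reduce (ws i)) <-> primitive (reduce u)).
  elim: i => [_|i IHi lt_im]; first by rewrite ws0.
  have step_i := wsS _ lt_im; have [_ prim] := IHi (ltnW lt_im).
  by split; [apply: whitehead_step_reduced step_i | rewrite (whitehead_step_primitive step_i)].
have [red_m prim_m] := steps m (leqnn m).
have -> : b = (size (ws m) == 1).
  have [nrun min_t'] := halt_t'; case: (ltnP t t') => [/min_t'|le_t]; first by rewrite ans.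
  by move: ans; rewrite (run_halted le_t nrun) ans' => -[].
rewrite -prim_m; split=> [|prim].
  by case: (ws m) => [|a []] // _; apply: primitive_gen.
by apply: contraT => /(primitive_step red_m prim)[v /wsm].
Qed.

Lemma machine_A_correct u t : cyclically_reduced u -> halts_at machine_A u t ->
  exists2 b : bool, stat (run machine_A u t).1 = Answer b & b <-> primitive (reduce u).
Proof.
move=> red [nrun _]; move: nrun; rewrite stat_machine_A.
have soundT (b : bool) : stat (run T u (busy_steps u t)).1 = Answer b -> b <-> primitive (reduce u).
  case/machine_T_sound => -> compl; split=> // prim.
  by case: (complete_not_primitive r_gt0 red compl).
have soundW (b : bool) := @machine_W_correct u (busy_steps u t) b red.
case: (stat (run T u _).1) soundT => [||b] soundT; last by exists b => //; apply: soundT.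
  by case: (stat (run W u _).1) soundW => [||b] // soundW _; exists b => //; apply: soundW.
by case: (stat (run W u _).1) soundW => [||b] // soundW _; exists b => //; apply: soundW.
Qed.

Lemma machine_A_time u : exists t, [/\ halts_at machine_A u t,
    t <= (size u).+1 + search_bound S (size u)
  & forall k, 0 < k <= size u -> complete_graph (whitehead_graph (take k u)) -> t <= k].
Proof.
have [m [ws [tau [tW [_ [_ _ /andP[_ le_tW] _ ans]]]]]] := machine_W_search S_steps u.
have [t le_t halt_t] := machine_A_halts (or_intror ans).
exists t; split=> //; first exact: leq_trans le_tW.
move=> k le_k compl; have [tT le_tT ansT] := machine_T_complete le_k compl.
have [t' le_t' [nrun' _]] := machine_A_halts (or_introl ansT).
have [_ min_t] := halt_t; rewrite leqNgt; apply/negP => lt_kt.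
by move/negP: nrun'; apply; apply: min_t;
  apply: leq_ltn_trans le_t' (leq_ltn_trans le_tT lt_kt).
Qed.

End Parallel.

(** * Cyclic reduction on a deque *)

Section CyclicReductionMachine.
Variable r : nat.
Implicit Types (a b c : letter r) (u v w p s : seq (letter r)).
Local Notation sym := (symbol r void).

(* inl None: at the first letter; inl (Some a): at the last letter, the first one
   being a; inr false: the last letter has been erased; inr true: finished. *)
Definition rstate : finType := (option (letter r) + bool)%type.

Definition rstat (q : rstate) : status := if q is inr true then Stopped else Running.

Definition rdelta (q : rstate) (x : sym) : rstate * (sym * move) :=
  match q with
  | inl None => if sym_letter x is Some a then (inl (Some a), (x, ToLast))
                else (inr true, (x, Stay))
  | inl (Some a) => if x == letter_sym (linv a) then (inr false, (None, ToFirst))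
                    else (inr true, (x, ToFirst))
  | inr false => (inl None, (None, GoRight))
  | inr true => (q, (x, Stay))
  end.

Definition machine_R : machine r 2 void :=
  machine3 (inl None : rstate) rstat (fun q (s0 s1 s2 : sym) =>
    ((rdelta q s0).1, (rdelta q s0).2, (s1, Stay), (s2, Stay))).

Definition on_deque (q : rstate) (t : tape r void) : config machine_R :=
  (q, triple t (blank_tape r) (blank_tape r)).

Lemma step_on_deque q t : running (rstat q) ->
  step (on_deque q t) = on_deque (rdelta q (tape_read t)).1 (act (rdelta q (tape_read t)).2 t).
Proof. by move=> run_q; rewrite /on_deque step_machine3. Qed.

Lemma act_to_last p c :
  act (letter_sym (head c (rcons p c)), ToLast) (scan_right [::] (rcons p c)) =
  scan_right p [:: c].
Proof.
have -> : act (letter_sym (head c (rcons p c)), ToLast) (scan_right [::] (rcons p c)) =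
    tape_move ToLast (scan_right [::] (rcons p c)) by case: p.
by rewrite /tape_move contents_left /cells /encode map_rcons rev_rcons.
Qed.

Lemma contents_scan p s : tape_contents (scan_right p s) = cells (p ++ s).
Proof.
rewrite -contents_left /tape_contents /scan_right /= revK.
by rewrite /cells /encode map_cat.
Qed.

Lemma act_to_first p c :
  act (letter_sym c, ToFirst) (scan_right p [:: c]) = scan_right [::] (rcons p c).
Proof.
by rewrite /act /tape_move -[tape_write _ _]/(scan_right p [:: c]) contents_scan cats1.
Qed.

Lemma act_erase_to_first p c :
  act (None, ToFirst) (scan_right p [:: c]) = scan_right [::] p.
Proof.
by rewrite /act /tape_move -[tape_write _ _]/(scan_right p [::]) contents_scan cats0.
Qed.

(** Stripping a pair of end letters takes three steps and shortens the word by two, so the factor 3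
    is generous; the last comparison takes at most two steps. *)
Definition strip_time u := 3 * (size u - size (cyclic_reduction u)) + 2.

Lemma machine_R_run u : exists2 t, t <= strip_time u &
  iter t (@step _ _ _ machine_R) (on_deque (inl None) (scan_right [::] u)) =
  on_deque (inr true) (scan_right [::] (cyclic_reduction u)).
Proof.
have to_last a p c : head c (rcons p c) = a ->
    step (on_deque (inl None) (scan_right [::] (rcons p c))) =
    on_deque (inl (Some a)) (scan_right p [:: c]).
  move=> <-; rewrite step_on_deque // -act_to_last; by case: p.
have to_end a p c : c != linv a ->
    step (on_deque (inl (Some a)) (scan_right p [:: c])) =
    on_deque (inr true) (scan_right [::] (rcons p c)).
  move=> ne; have /negbTE ne' : letter_sym c != letter_sym (linv a).
    by apply: contraNneq ne => -[->].
  by rewrite step_on_deque // /rdelta read_right ne' act_to_first.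
have to_strip a p : step (on_deque (inl (Some a)) (scan_right p [:: linv a])) =
    on_deque (inr false) (scan_right [::] p).
  by rewrite step_on_deque // /rdelta read_right eqxx act_erase_to_first.
elim/seq_ends_ind: u => [|a|a v b [t le_t IHt]].
- exists 1 => //; rewrite /= step_on_deque //.
- exists 2; rewrite /strip_time ?leq_addl //=.
  by rewrite (to_last a [::] a) // to_end // eq_sym linv_neq.
rewrite -rcons_cons /strip_time rcons_cons cyclic_reductionE.
case: (b =P linv a) => [->|/eqP ne].
  exists (t + 3).
    have le_core := size_cyclic_reduction v.
    rewrite /= size_rcons; move: le_t le_core; rewrite /strip_time.
    by move: (size v) (size (cyclic_reduction v)) => n m; lia.
  rewrite iterD /= -rcons_cons (to_last a) // to_strip step_on_deque //.
  by rewrite [act _ _]act_pop.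
exists 2; first by rewrite leq_addl.
by rewrite /= -rcons_cons (to_last a) // to_end.
Qed.

Lemma machine_R_reduces u : exists t, [/\ t <= strip_time u, halts_at machine_R u t
  & (run machine_R u t).2 = input_tapes 2 void (cyclic_reduction u)].
Proof.
have inputE w : input_tapes 2 void w = triple (scan_right [::] w) (blank_tape r) (blank_tape r).
  by apply/ffunP=> i; rewrite !ffunE; case: i => [[|[|[|]]]].
have [t le_t run_t] := machine_R_run u.
have runE : run machine_R u t = on_deque (inr true) (scan_right [::] (cyclic_reduction u)).
  by rewrite -run_t /run inputE.
have [|t' le_t' [halt_t' run_t']] := @halts_exists _ _ _ machine_R u t; first by rewrite runE.
exists t'; split=> //; first exact: leq_trans le_t' le_t.
by rewrite run_t' runE inputE.
Qed.

End CyclicReductionMachine.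

(** * Runs of one machine after another, and time functions *)

Section SequentialRun.
Variables (r k : nat) (X : finType) (M1 M2 : machine r k X).
Variables (u v : seq (letter r)) (t1 : nat).
Hypothesis halt1 : halts_at M1 u t1.
Hypothesis tapes1 : (run M1 u t1).2 = input_tapes k X v.

(** [seq_enter] turns a halting state of [M1] into the start of [M2] immediately, so the hand-over
    costs no step and the two times simply add. *)
Lemma run_seq_first t : t <= t1 ->
  run (seq_machine M1 M2) u t = (seq_enter M2 (run M1 u t).1, (run M1 u t).2).
Proof.
elim: t => // t IHt lt_t; rewrite /run !iterS -!/(run _ _ _) IHt 1?ltnW //.
have run_t := halt1.2 t lt_t.
case: (run M1 u t) run_t => q tp /= run_q.
by rewrite /step /= /seq_enter run_q /=.
Qed.

Lemma run_seq_second t :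
  run (seq_machine M1 M2) u (t + t1) = (inr (run M2 v t).1, (run M2 v t).2).
Proof.
elim: t => [|t IHt].
  by rewrite run_seq_first // /seq_enter (negbTE halt1.1) tapes1.
rewrite addSn /run !iterS -!/(run _ _ _) IHt.
case: (run M2 v t) => q tp; rewrite /step /=.
by case: (running (stat q)).
Qed.

Lemma seq_halts t : halts_at M2 v t -> halts_at (seq_machine M1 M2) u (t + t1).
Proof.
case=> nrun busy; split; first by rewrite run_seq_second.
move=> s lt_s; case: (ltnP s t1) => [lt_st1|le_t1].
  rewrite (run_seq_first (ltnW lt_st1)) /seq_enter.
  by have -> := halt1.2 s lt_st1.
rewrite -(subnK le_t1) run_seq_second; apply: busy.
by rewrite ltn_subLR // addnC.
Qed.

End SequentialRun.

(** The time function is a bounded search for the first halting step up to [B u]. *)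
Lemma halting_time (r k : nat) (X : finType) (M : machine r k X)
    (P : pred (seq (letter r))) (B : seq (letter r) -> nat) :
    (forall u, P u -> exists2 t, t <= B u & halts_at M u t) ->
  exists time : seq (letter r) -> nat,
    forall u, P u -> halts_at M u (time u) /\ time u <= B u.
Proof.
move=> ex; exists (fun u => find (fun t => ~~ running (stat (run M u t).1)) (iota 0 (B u).+1)).
move=> u /ex[t le_t [nrun busy]]; set f := find _ _.
have -> : f = t; last by [].
have has_t : has (fun t => ~~ running (stat (run M u t).1)) (iota 0 (B u).+1).
  by apply/hasP; exists t; rewrite ?mem_iota.
have lt_f : f < (B u).+1 by move: has_t; rewrite has_find size_iota.
have := nth_find 0 has_t; rewrite -/f nth_iota // add0n => nrun_f.
apply/eqP; rewrite eqn_leq; apply/andP; split; rewrite leqNgt; apply/negP => lt_ft.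
  have := before_find 0 lt_ft; rewrite nth_iota; last exact: ltn_trans lt_ft lt_f.
  by rewrite add0n nrun.
by rewrite busy in nrun_f.
Qed.

(** * Sums over reduced words *)

Section ReducedSums.
Variable r : nat.
Implicit Types (a b c : letter r) (u v w : seq (letter r)).
Implicit Types f g : seq (letter r) -> rat.
Local Open Scope ring_scope.

(** An unnormalized expectation conditioned on the prefix [w]: the sum runs over the reduced
    extensions of [w] by n letters. *)
Definition wsum n w f : rat :=
  \sum_(t : n.-tuple (letter r) | freely_reduced (w ++ t)) f (w ++ t).

Lemma wsum0 w f : wsum 0 w f = if freely_reduced w then f w else 0.
Proof.
rewrite /wsum; case: ifP => red_w.
  rewrite (big_pred1 [tuple]) ?cats0 // => t /=.
  by rewrite tuple0 /= cats0 red_w eqxx.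
by rewrite big_pred0 // => t; rewrite tuple0 /= cats0.
Qed.

Lemma wsumS n w f : wsum n.+1 w f = \sum_a wsum n (rcons w a) f.
Proof.
rewrite /wsum; under [RHS]eq_bigr do under eq_bigl do rewrite cat_rcons.
rewrite pair_big_dep /=.
rewrite (reindex (fun p : letter r * n.-tuple (letter r) => [tuple of p.1 :: p.2])) /=.
  by apply: eq_bigr => p _; rewrite cat_rcons.
exists (fun t => (thead t, [tuple of behead t])) => [[a t] _|t _] /=.
  by congr (_, _); apply: val_inj.
by apply: val_inj; rewrite /= [in RHS](tuple_eta t).
Qed.

Lemma wsum_unreduced n w f : ~~ freely_reduced w -> wsum n w f = 0.
Proof.
move=> unred; rewrite /wsum big_pred0 // => t.
by apply: contraNF unred => /freely_reduced_cat[].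
Qed.

Lemma wsum_add m n w f : wsum (m + n) w f = wsum m w (fun v => wsum n v f).
Proof.
elim: m w => [|m IHm] w; last by rewrite addSn !wsumS; apply: eq_bigr.
by rewrite wsum0; case: ifP => // /negbT/wsum_unreduced->.
Qed.

Lemma wsum1 w f : wsum 1 w f = \sum_(a | freely_reduced (rcons w a)) f (rcons w a).
Proof. by rewrite wsumS [RHS]big_mkcond; apply: eq_bigr => a _; rewrite wsum0. Qed.

Lemma wsum_le n w f g :
  (forall t, size t = n -> freely_reduced (w ++ t) -> f (w ++ t) <= g (w ++ t)) ->
  wsum n w f <= wsum n w g.
Proof. by move=> le_fg; apply: ler_sum => t; apply: le_fg; rewrite size_tuple. Qed.

Lemma wsumD n w f g : wsum n w (fun v => f v + g v) = wsum n w f + wsum n w g.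
Proof. exact: big_split. Qed.

Lemma wsumZ n w (k : rat) f : wsum n w (fun v => k * f v) = k * wsum n w f.
Proof. by rewrite /wsum mulr_sumr. Qed.

Lemma wsum_cst n w (k : rat) : wsum n w (fun=> k) = k * wsum n w (fun=> 1).
Proof. by rewrite -wsumZ mulr1. Qed.

(** The number 2r - 1 of letters that may follow a given letter in a reduced word. *)
Definition branching : rat := (2 * r)%N.-1%:R.

Lemma card_letter_neq a : #|[pred b | b != a]| = (2 * r).-1.
Proof. by rewrite cardC1 card_prod card_ord card_bool mulnC. Qed.

Lemma wsum1_count n w : w != [::] -> freely_reduced w ->
  wsum n w (fun=> 1) = branching ^+ n.
Proof.
elim: n w => [|n IHn] w w_n0 red_w; first by rewrite wsum0 red_w.
case/lastP: w w_n0 red_w => [|w a] // _ red_w.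
rewrite wsumS (bigID (fun b => b != linv a)) /= addrC big1 ?add0r => [|b]; last first.
  move/negPn/eqP->; rewrite wsum_unreduced // freely_reduced_rcons.
  by case: w {red_w} => [|c w]; rewrite /= ?last_rcons eqxx.
rewrite (eq_bigr (fun=> branching ^+ n)) => [|b ne].
  by rewrite sumr_const card_letter_neq -[LHS]mulr_natr -exprSr.
rewrite IHn //; first by case: (w).
by rewrite freely_reduced_rcons red_w; case: (w) => [|c w'] /=; rewrite ?last_rcons ne.
Qed.

Definition reduced_count n := wsum n [::] (fun=> 1).

Lemma reduced_count0 : reduced_count 0 = 1. Proof. by rewrite /reduced_count wsum0. Qed.

Lemma reduced_countS n : reduced_count n.+1 = (2 * r)%:R * branching ^+ n.
Proof.
rewrite /reduced_count wsumS (eq_bigr (fun=> branching ^+ n)) => [|a _].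
  by rewrite sumr_const card_prod card_ord card_bool -[LHS]mulr_natl mulnC.
by rewrite wsum1_count.
Qed.

Lemma card_words n (P : pred (seq (letter r))) :
  (forall u, P u -> freely_reduced u) ->
  #|words n P|%:R = wsum n [::] (fun u => (P u)%:R).
Proof.
move=> Pred; rewrite /wsum /= -sum1_card natr_sum [in RHS]big_mkcond [in LHS]big_mkcond /=.
apply: eq_bigr => t _; rewrite inE; case: ifP => [/Pred->|] //.
by case: ifP.
Qed.

Lemma sum_words n (P : pred (seq (letter r))) (f : seq (letter r) -> nat) g :
  (forall u, P u -> freely_reduced u) -> (forall u, P u -> (f u)%:R <= g u) ->
  (forall u, 0 <= g u) ->
  \sum_(u in words n P) (f u)%:R <= wsum n [::] g.
Proof.
move=> Pred le_fg g_ge0; rewrite /wsum /= [leLHS]big_mkcond [leRHS]big_mkcond /=.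
apply: ler_sum => t _; rewrite inE; case: ifP => [Pt|_].
  by rewrite Pred // le_fg.
by case: ifP.
Qed.

Hypothesis r_gt0 : (0 < r)%N.

Lemma branching_ge1 : 1 <= branching.
Proof. by rewrite ler1n; case: r r_gt0 => // n _; rewrite mulnS. Qed.

Lemma reduced_count_gt0 n : 0 < reduced_count n.
Proof.
have b_gt0 : 0 < branching := lt_le_trans ltr01 branching_ge1.
case: n => [|n]; first by rewrite reduced_count0.
by rewrite reduced_countS mulr_gt0 ?exprn_gt0 // ltr0n muln_gt0.
Qed.

(** * Waiting for a complete Whitehead graph *)

Lemma whitehead_graph_catr u v : whitehead_graph v \subset whitehead_graph (u ++ v).
Proof.
elim: u => //= a u IHu; apply: subset_trans IHu _.
apply/subsetP=> e; rewrite !inE /=; case: (u ++ v) => [|b s] //=.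
by rewrite inE orbC => ->.
Qed.

(** A pair x, y is joined by appending x y^-1 or y x^-1. Since x and y differ, both are reduced and
    at least one does not cancel against the end of [w]. Each pair costs exactly two letters, so the
    length is the same for all [w]. *)
Lemma exists_extension (ps : seq (letter r * letter r)) w :
    w != [::] -> freely_reduced w -> all (fun p => p.1 != p.2) ps ->
  exists t, [/\ size t = (size ps).*2, freely_reduced (w ++ t) &
    forall p, p \in ps -> (p \in whitehead_graph (w ++ t)) ||
                          ((p.2, p.1) \in whitehead_graph (w ++ t))].
Proof.
elim: ps w => [|[x y] ps IHps] w w_n0 red_w; first by exists [::]; rewrite cats0.
rewrite /= => /andP[ne_xy ne_ps].
have [x' [y' [red_w' xyP]]] : exists x' y', freely_reduced (w ++ [:: x'; linv y']) /\
    ((x', y') = (x, y) \/ (x', y') = (y, x)).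
  have ext x' y' : x' != y' -> x' != linv (last x w) -> freely_reduced (w ++ [:: x'; linv y']).
    case: (w) w_n0 red_w => // a s _ red_s ne ne'; rewrite -cat_rcons cats1.
    rewrite !freely_reduced_rcons red_s /= last_rcons andbT.
    by rewrite ne' andbT (can_eq (@linvK r)) eq_sym ne.
  case: (x =P linv (last x w)) => [ex|/eqP nx].
    exists y, x; split; last by right.
    by apply: ext; rewrite ?[y == x]eq_sym // -ex eq_sym.
  by exists x, y; split; [apply: ext | left].
have w'_n0 : w ++ [:: x'; linv y'] != [::] by case: (w).
have [t [size_t red_t edges]] := IHps _ w'_n0 red_w' ne_ps.
exists ([:: x', linv y' & t]); rewrite -[_ :: _ :: t]/([:: x'; linv y'] ++ t) catA.
split=> //; first by rewrite /= size_t.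
move=> p; rewrite inE => /predU1P[->|]; last exact: edges.
have e : (x', y') \in whitehead_graph ((w ++ [:: x'; linv y']) ++ t).
  apply: (subsetP (whitehead_graph_catl _ _)); apply: (subsetP (whitehead_graph_catr _ _)).
  by rewrite !inE eqxx.
by case: xyP => -[<- <-]; rewrite /= e ?orbT.
Qed.

Lemma exists_complete_extension : exists2 L : nat, (0 < L)%N &
  forall w, w != [::] -> freely_reduced w ->
  exists t, [/\ size t = L, freely_reduced (w ++ t) &
    complete_graph (whitehead_graph (w ++ t))].
Proof.
pose ps := [seq p <- enum {: letter r * letter r} | p.1 != p.2].
have psP p : (p \in ps) = (p.1 != p.2) by rewrite mem_filter mem_enum andbT.
exists (size ps).*2.
  rewrite double_gt0 -has_predT; apply/hasP.
  by exists ((Ordinal r_gt0, false), (Ordinal r_gt0, true)); rewrite ?psP.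
move=> w w_n0 red_w; have [|t [size_t red_t edges]] := @exists_extension ps w w_n0 red_w.
  by apply/allP => p; rewrite psP.
exists t; split=> //; apply/forallP=> x; apply/forallP=> y; apply/implyP=> ne.
by have := edges (x, y); rewrite psP => /(_ ne).
Qed.

End ReducedSums.

Lemma eq_ler (x y : rat) : x = y -> (x <= y)%R.
Proof. by move->. Qed.

(** * Expected time from a geometric tail *)

Section Estimates.
Variable r : nat.
Implicit Types (a b c : letter r) (u v w : seq (letter r)).
Implicit Types f g : seq (letter r) -> rat.
Local Open Scope ring_scope.
Hypothesis r_gt0 : (0 < r)%N.
Local Notation q := (branching r).

Lemma branching_gt0 : 0 < q. Proof. exact: lt_le_trans ltr01 (branching_ge1 r_gt0). Qed.

Section GeometricTail.
Variables (L : nat) (beta K : rat) (f : seq (letter r) -> rat).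
Hypothesis L_gt0 : (0 < L)%N.
Hypothesis extend : forall w, w != [::] -> freely_reduced w ->
  exists t, [/\ size t = L, freely_reduced (w ++ t) &
    complete_graph (whitehead_graph (w ++ t))].
Hypotheses (beta_ge1 : 1 <= beta) (K_ge0 : 0 <= K).
(** With Q = [q ^+ L] continuations by one block, at most Q - 1 of them incomplete, this reads
    [1 + (Q - 1) * (2 * beta) <= 2 * Q]: the bound of [wsum_tail] reproduces itself over a block. *)
Hypothesis beta_small : (q ^+ L - 1) * (2 * beta) <= 2 * q ^+ L - 1.
(** The prefix consists of one letter followed by m blocks, because [extend] starts from a nonempty
    word. *)
Hypothesis f_complete : forall v m, (m * L < size v)%N ->
  complete_graph (whitehead_graph (take (m * L).+1 v)) -> f v <= K * beta ^+ m.
Hypothesis f_short : forall v m, (size v <= m * L)%N -> f v <= K * beta ^+ m.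

Local Opaque complete_graph.

(* Each block of L letters completes the graph with probability at least q ^- L,
   and costs a factor beta otherwise. *)
Lemma wsum_tail n w m : size w = (m * L).+1 -> freely_reduced w ->
  wsum n w f <= 2 * K * q ^+ n * beta ^+ m.+1.
Proof.
have q_gt0 := branching_gt0.
have Kb_ge0 i : 0 <= K * beta ^+ i by rewrite mulr_ge0 // exprn_ge0 // (le_trans ler01).
have [N] := ubnP n; elim: N n w m => // N IHN n w m; rewrite ltnS => le_nN size_w red_w.
have w_n0 : w != [::] by case: (w) size_w.
case: (ltnP n L) => [lt_nL|le_Ln].
  have : wsum n w f <= wsum n w (fun=> K * beta ^+ m.+1).
    apply: wsum_le => t size_t _; apply: f_short.
    by rewrite size_cat size_w size_t mulSn addSn addnC ltn_add2r.
  rewrite wsum_cst wsum1_count // => /le_trans; apply.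
  have -> : 2 * K * q ^+ n * beta ^+ m.+1 = 2 * (K * beta ^+ m.+1 * q ^+ n) by ring.
  have : 0 <= K * beta ^+ m.+1 * q ^+ n by rewrite mulr_ge0 // exprn_ge0 // ltW.
  by lra.
rewrite -(subnKC le_Ln) wsum_add; set n' := (n - L)%N.
have lt_n'N : (n' < N)%N by apply: leq_trans le_nN; rewrite ltn_subrL L_gt0 (leq_trans L_gt0).
pose D := K * q ^+ n' * beta ^+ m.+1.
have D_ge0 : 0 <= D by rewrite /D -mulrA [q ^+ n' * _]mulrC mulrA mulr_ge0 // exprn_ge0 // ltW.
have size_ext t : size t = L -> size (w ++ t) = (m.+1 * L).+1.
  by move=> size_t; rewrite size_cat size_w size_t mulSn addSn addnC.
have bad t : size t = L -> freely_reduced (w ++ t) ->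
    wsum n' (w ++ t) f <= 2 * beta * D.
  move=> size_t red_wt; apply: le_trans (IHN _ _ _ lt_n'N (size_ext t size_t) red_wt) _.
  by rewrite /D exprS; apply: eq_ler; ring.
have good t : size t = L -> freely_reduced (w ++ t) ->
    complete_graph (whitehead_graph (w ++ t)) -> wsum n' (w ++ t) f <= D.
  move=> size_t red_wt compl; have wt_n0 : w ++ t != [::] by case: (w) w_n0.
  apply: (@le_trans _ _ (wsum n' (w ++ t) (fun=> K * beta ^+ m.+1))).
    apply: wsum_le => t' _ _; have size_wt := size_ext t size_t.
    apply: f_complete; first by rewrite size_cat size_wt ltn_addr.
    by rewrite -size_wt take_size_cat.
  by rewrite wsum_cst wsum1_count // /D mulrAC.
have [t0 [size_t0 red_t0 compl_t0]] := extend w_n0 red_w.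
have t0P : size t0 == L by apply/eqP.
have count_ext : \sum_(t : L.-tuple (letter r) | freely_reduced (w ++ t)) 1 = q ^+ L.
  by rewrite -[RHS](wsum1_count L w_n0 red_w).
(* The completing block [t0] contributes at most [D], and each of the other blocks at most
   [2 * beta * D]. *)
rewrite {1}/wsum (bigD1 (Tuple t0P)) //=; move: count_ext;
  rewrite (bigD1 (Tuple t0P)) //= => count_ext.
have -> : 2 * K * q ^+ (L + n') * beta ^+ m.+1 = 2 * q ^+ L * D.
  by rewrite /D exprD; ring.
have rest : \sum_(t : L.-tuple (letter r) | freely_reduced (w ++ t) && (t != Tuple t0P))
    wsum n' (w ++ t) f <= (q ^+ L - 1) * (2 * beta * D).
  rewrite -count_ext addrAC subrr add0r mulr_suml; apply: ler_sum => t /andP[red_t _].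
  by rewrite mul1r bad // size_tuple.
apply: le_trans (lerD (good _ size_t0 red_t0 compl_t0) rest) _.
move: beta_small D_ge0; move: (q ^+ L) => Q hQ hD.
have : (Q - 1) * (2 * beta) * D <= (2 * Q - 1) * D by rewrite ler_wpM2r.
by lra.
Qed.

Lemma wsum_expected n : wsum n [::] f <= 2 * K * beta * reduced_count r n.
Proof.
have q_gt0 := branching_gt0.
case: n => [|n].
  rewrite wsum0 reduced_count0 /= mulr1; apply: le_trans (f_short (m := 0) _) _ => //.
  by rewrite expr0; move: K_ge0 beta_ge1; nra.
rewrite wsumS reduced_countS;
  apply: (@le_trans _ _ (\sum_(a : letter r) 2 * K * q ^+ n * beta)).
  apply: ler_sum => a _; rewrite -[beta in leRHS]expr1.
  by apply: (@wsum_tail n [:: a] 0).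
rewrite sumr_const card_prod card_ord card_bool -mulr_natl mulnC.
by apply: eq_ler; ring.
Qed.

End GeometricTail.

Lemma bernoulli (x : rat) m : 0 <= x -> 1 + m%:R * x <= (1 + x) ^+ m.
Proof.
move=> x_ge0; elim: m => [|m IHm]; first by rewrite expr0 mul0r addr0.
rewrite exprS mulrSr; have m_ge0 : 0 <= m%:R :> rat by [].
have : (1 + x) * (1 + m%:R * x) <= (1 + x) * (1 + x) ^+ m by rewrite ler_wpM2l // addr_ge0.
by nra.
Qed.

Lemma cubic_bound (Q : rat) : 1 <= Q -> exists (beta C : rat),
  [/\ 1 <= beta, 0 <= C, (Q - 1) * (2 * beta) <= 2 * Q - 1
    & forall m : nat, (m.+1 ^ 3)%:R <= C * beta ^+ m].
Proof.
move=> Q_ge1; have Q_gt0 : 0 < Q by apply: lt_le_trans Q_ge1.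
(* For e at most 1, (1 + e)^3 is at most 1 + 7 e, and 14 e Q = 1 makes the excess 2 Q times 7 e
   equal to 1. The cube will absorb the cubic cost: by Bernoulli e (m + 1) is at most (1 + e)^m,
   which explains the constant e^-3. *)
have [e e_gt0 eQ] : exists2 e : rat, 0 < e & 14 * (e * Q) = 1.
  exists (14 * Q)^-1; first by rewrite invr_gt0 mulr_gt0.
  by rewrite mulrCA mulVf // mulf_neq0 // gt_eqF.
have e_ge0 := ltW e_gt0.
have e_le1 : e <= 1 by have := ler_wpM2l e_ge0 Q_ge1; rewrite mulr1; lra.
have s_ge0 : 0 <= e ^+ 2 by rewrite exprn_ge0.
have s_le : e ^+ 2 <= e by rewrite expr2 -[leRHS]mulr1 ler_wpM2l.
have c_le : e * e ^+ 2 <= e ^+ 2 by rewrite -[leRHS]mul1r ler_wpM2r.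
have beta_le : (1 + e) ^+ 3 <= 1 + 7 * e.
  have -> : (1 + e) ^+ 3 = 1 + 3 * e + 3 * e ^+ 2 + e * e ^+ 2 by ring.
  by lra.
exists ((1 + e) ^+ 3), (e^-1 ^+ 3); split.
- by apply: exprn_ege1; rewrite lerDl.
- by apply: exprn_ge0; rewrite invr_ge0.
- have Q1 : 0 <= (Q - 1) * 2 by rewrite mulr_ge0 // subr_ge0.
  have := ler_wpM2l Q1 beta_le; rewrite -mulrA.
  have -> : (Q - 1) * 2 * (1 + 7 * e) = 2 * Q - 2 + 14 * (e * Q) - 14 * e by ring.
  by rewrite eQ; lra.
move=> m; rewrite natrX -exprM mulnC exprM -exprMn; apply: lerXn2r.
- by rewrite nnegrE.
- by rewrite nnegrE mulr_ge0 ?invr_ge0 ?exprn_ge0 ?addr_ge0 // ltW.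
rewrite mulrC ler_pdivlMr //; apply: le_trans (bernoulli m e_ge0).
by rewrite mulrSr mulrDl mul1r addrC lerD2r.
Qed.

(** In rank one the only letter that may follow a letter in a reduced word is that letter itself. *)
Lemma rank1_last a w : 1%N = r -> freely_reduced (a :: w) -> last a w = a.
Proof.
move=> r1; elim: w a => //= b w IHw a; rewrite /freely_reduced /= => /andP[ne red].
have ba : b = a.
  case: a b ne {red} => [i x] [j y]; rewrite /linv xpair_eqE /=.
  have -> : j = i.
    apply: ord_inj; have := ltn_ord i; have := ltn_ord j; move: r1.
    by move: (nat_of_ord i) (nat_of_ord j); lia.
  by rewrite eqxx /=; case: x; case: y.
by rewrite ba in red *; apply: IHw.
Qed.

(** Among the 2r - 1 admissible last letters at most one cancels the first letter, which leaves at
    least half of them when r > 1. When r = 1 the word is a power of a letter and none cancels. *)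
Lemma cyclic_half n :
  reduced_count r n <= 2 * wsum n [::] (fun u => (cyclically_reduced u)%:R).
Proof.
case: n => [|[|n]].
- by rewrite reduced_count0 wsum0 /=.
- rewrite /reduced_count !wsumS mulr_sumr; apply: ler_sum => a _.
  by rewrite !wsum0 /= /cyclically_reduced /= eq_sym linv_neq.
rewrite /reduced_count -addn1 !wsum_add -wsumZ; apply: wsum_le => w size_w red_w.
have w_n0 : [::] ++ w != [::] by case: (w) size_w.
rewrite wsum1_count // expr1 wsum1.
case: w size_w red_w w_n0 => // a w size_w; rewrite !cat0s => red_w _.
rewrite (eq_bigr (fun c => (c != linv a)%:R)) => [|c red_c]; last first.
  by rewrite cyclically_reducedE red_c.
rewrite -natr_sum -natrM ler_nat.
rewrite (eq_bigl (fun c => c != linv (last a w))) => [|c]; last first.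
  by rewrite freely_reduced_rcons red_w andbT.
rewrite -big_mkcondr sum1_card.
case: (last a w =P a) => [->|/eqP ne].
  rewrite (eq_card (B := [pred b | b != linv a])) => [|c]; last by rewrite /in_mem /= andbb.
  by rewrite card_letter_neq leq_pmull.
have r_gt1 : (1 < r)%N.
  rewrite ltn_neqAle r_gt0 andbT; apply: contra_neq ne => r1.
  exact: rank1_last red_w.
have := cardC (pred2 (linv (last a w)) (linv a)).
rewrite card2 (can_eq (@linvK r)) ne card_prod card_ord card_bool.
have -> : #|[predC pred2 (linv (last a w)) (linv a)]| =
    #|[pred i | i != linv (last a w) & i != linv a]|.
  by apply: eq_card => c; rewrite !inE negb_or.
by move: r_gt1; move: #|_| => k; lia.
Qed.

End Estimates.

(** * A contracting recursion for the time including cyclic reduction *)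

Section ReductionTime.
Variable r : nat.
Implicit Types (a b c : letter r) (u v w : seq (letter r)).
Local Open Scope ring_scope.
Hypothesis r_gt0 : (0 < r)%N.
Local Notation q := (branching r).
Variables (F : seq (letter r) -> rat) (B : rat).
Hypotheses (F_ge0 : forall u, 0 <= F u) (B_ge0 : 0 <= B).
Hypothesis F_mean : forall n, wsum n [::] F <= B * reduced_count r n.

Definition total_time u : rat := (strip_time u)%:R + F (cyclic_reduction u).

(** The share of [total_time] passed on to the word without its end letters; 6 is the change of
    [strip_time] when the length drops by two. *)
Definition inner_time u : rat :=
  if strip_ends u == u then 0 else 6 + total_time (strip_ends u).

Lemma total_time_ge0 u : 0 <= total_time u.
Proof. by rewrite addr_ge0. Qed.

Lemma total_time_strip a v :
  total_time (a :: rcons v (linv a)) = 6 + total_time v.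
Proof.
rewrite /total_time cyclic_reductionE eqxx addrA -natrD; congr (_%:R + _).
rewrite /strip_time cyclic_reductionE eqxx /= size_rcons.
by have := size_cyclic_reduction v; move: (size v) (size _) => n m; lia.
Qed.

Lemma total_time_fixed u : cyclic_reduction u = u -> total_time u = 2 + F u.
Proof. by move=> fix_u; rewrite /total_time /strip_time fix_u subnn. Qed.

Lemma total_time_le u : total_time u <= 2 + F u + inner_time u.
Proof.
elim/seq_ends_ind: u => [|a|a v b _].
- by rewrite total_time_fixed // /inner_time eqxx addr0.
- by rewrite total_time_fixed // /inner_time eqxx addr0.
rewrite /inner_time strip_endsE; case: (b =P linv a) => [->|/eqP ne].
  rewrite total_time_strip ifN; last first.
    by apply/eqP => /(congr1 size); rewrite /= size_rcons; move: (size v); lia.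
  by have := F_ge0 (a :: rcons v (linv a)); lra.
by rewrite eqxx addr0 total_time_fixed // cyclic_reductionE (negbTE ne).
Qed.

(** For a given first letter [a] and a given middle word, only the last letter [linv a] contributes;
    so each reduced middle word is counted at most 2r times. *)
Lemma inner_time_count n :
  wsum n.+2 [::] inner_time <=
  (2 * r)%:R * (6 * reduced_count r n + wsum n [::] total_time).
Proof.
rewrite wsumS -[(2 * r)%N](_ : #|{: letter r}| = _); last first.
  by rewrite card_prod card_ord card_bool mulnC.
rewrite mulr_natl -sumr_const; apply: ler_sum => a _; rewrite [rcons _ _]/=.
rewrite -addn1 wsum_add -wsum_cst -wsumD.
apply: (@le_trans _ _ (wsum n [:: a] (fun v => 6 + total_time (behead v)))).
  apply: wsum_le => v _ red_v; rewrite wsum1 cat1s [behead _]/=.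
  rewrite (bigID (fun b => b == linv a)) /= [X in _ + X]big1 ?addr0 => [|b /andP[_ ne]].
    rewrite big_mkcondl /= big_pred1_eq.
    case: ifP => _; last by rewrite addr_ge0 // total_time_ge0.
    rewrite /inner_time strip_endsE eqxx ifN //.
    by apply/eqP => /(congr1 size); rewrite /= size_rcons; move: (size v); lia.
  by rewrite /inner_time strip_endsE (negbTE ne) eqxx.
rewrite /wsum [leLHS]big_mkcond [leRHS]big_mkcond /=.
apply: ler_sum => t _; case: ifP => [red_t|_].
  by rewrite (freely_reduced_behead red_t).
by case: ifP => // _; rewrite addr_ge0 // total_time_ge0.
Qed.

Lemma inner_time_rank1 n : 1%N = r -> wsum n.+2 [::] inner_time = 0.
Proof.
move=> r1; rewrite /wsum big1 // => t /=; rewrite /inner_time.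
case: t => t /= _; elim/seq_ends_ind: t => [_|a _|a v b _ red]; rewrite ?eqxx //.
rewrite strip_endsE; case: (b =P linv a) red => [->|_]; last by rewrite eqxx.
by move/(rank1_last r_gt0 r1) => /eqP; rewrite last_rcons (negbTE (linv_neq a)).
Qed.

(** With 2r = q + 1 and q at least 3, this comes down to 2 (q + 1) being at most q^2, or to 2 being
    at most q when n = 0. *)
Lemma reduced_count_double n : (1 < r)%N ->
  2 * (2 * r)%:R * reduced_count r n <= reduced_count r n.+2.
Proof.
move=> r_gt1; have q3 : 3 <= q by rewrite ler_nat; lia.
have rq : (2 * r)%:R = q + 1 :> rat by rewrite /branching natr1 prednK // muln_gt0.
have := reduced_count_gt0 r_gt0 n.
case: n => [|n] gt0; rewrite ?reduced_count0 !reduced_countS rq.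
  by rewrite expr1; nra.
have p_ge0 : 0 <= (q + 1) * q ^+ n by rewrite mulr_ge0 ?exprn_ge0 //; lra.
rewrite !exprS; have -> : (q + 1) * (q * (q * q ^+ n)) = (q * q) * ((q + 1) * q ^+ n) by ring.
by apply: ler_wpM2r => //; nra.
Qed.

(** A mean bound X at length n yields 2 + B + (6 + X) / 2 at length n + 2, and X = 2 (5 + B) is the
    fixed point. In rank one the inner term vanishes for words of length at least two. *)
Lemma total_time_mean n :
  wsum n [::] total_time <= 2 * (5 + B) * reduced_count r n.
Proof.
have le_cst : 2 + B <= 2 * (5 + B) by move: B_ge0; lra.
have first_terms k : wsum k [::] (fun u => 2 + F u) <= (2 + B) * reduced_count r k.
  by rewrite wsumD wsum_cst [leRHS]mulrDl lerD.
have base k : (k < 2)%N -> wsum k [::] total_time <= 2 * (5 + B) * reduced_count r k.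
  move=> lt_k2; apply: (@le_trans _ _ ((2 + B) * reduced_count r k)).
    apply: le_trans (first_terms k); apply: wsum_le => u size_u _.
    rewrite total_time_fixed //; case: u size_u => [|a [|b u]] //= size_u.
    by rewrite -size_u in lt_k2.
  by apply: ler_wpM2r; [exact/ltW/reduced_count_gt0 | exact: le_cst].
have [N] := ubnP n; elim: N n => // N IHN [|[|n]] le_n; [exact: base | exact: base |].
have gt0 := reduced_count_gt0 r_gt0 n.+2.
apply: (@le_trans _ _ (wsum n.+2 [::] (fun u => 2 + F u) + wsum n.+2 [::] inner_time)).
  by rewrite -wsumD; apply: wsum_le => u _ _; apply: total_time_le.
apply: le_trans (lerD (first_terms _) (lexx _)) _.
case: (ltnP 1 r) => [r_gt1|r_le1]; last first.
  rewrite inner_time_rank1 ?addr0; last by apply/eqP; rewrite eqn_leq r_gt0.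
  by apply: ler_wpM2r; [exact: ltW | exact: le_cst].
have IH : wsum n [::] total_time <= 2 * (5 + B) * reduced_count r n.
  exact/IHN/ltnW.
have := inner_time_count n; have := reduced_count_double n r_gt1.
have r2 : 0 <= (2 * r)%:R :> rat by [].
have IHr := ler_wpM2l r2 IH; rewrite mulrDr.
set X := wsum n.+2 _ _; set G := wsum n _ _ in IHr *.
have : 0 <= (5 + B) * ((2 * r)%:R * reduced_count r n).
  by rewrite !mulr_ge0 ?addr_ge0 // ltW // reduced_count_gt0.
move: (reduced_count r n.+2) gt0 IHr => M gt0 IHr pos dbl inner.
have dblB : (5 + B) * (2 * (2 * r)%:R * reduced_count r n) <= (5 + B) * M.
  by rewrite ler_wpM2l // addr_ge0.
have E1 : (2 * r)%:R * (2 * (5 + B) * reduced_count r n) =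
    (5 + B) * (2 * (2 * r)%:R * reduced_count r n) by ring.
have E2 : (2 * r)%:R * (6 * reduced_count r n) = 3 * (2 * (2 * r)%:R * reduced_count r n) by ring.
have -> : 2 * (5 + B) * M = 2 * ((5 + B) * M) by ring.
have -> : (2 + B) * M = (5 + B) * M - 3 * M by ring.
rewrite E1 in IHr; rewrite E2 in inner; lra.
Qed.

End ReductionTime.

(** * Expected times *)

Lemma halts_unique (r k : nat) (X : finType) (M : machine r k X) u s t :
  halts_at M u s -> halts_at M u t -> s = t.
Proof.
move=> [ns hs] [nt ht]; apply/eqP; rewrite eqn_leq.
apply/andP; split; rewrite leqNgt; apply/negP.
  by move/hs; apply/negP.
by move/ht; apply/negP.
Qed.

Section ExpectedTime.
Variables (r : nat) (S : seq (images r)).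
Hypothesis r_gt0 : 0 < r.
Hypothesis S_steps : forall w w', whitehead_step w w' <->
  exists2 f, f \in S & w' = substituted f w /\ size w' < size w.
Implicit Types (u v w : seq (letter r)).
Local Notation A := (machine_A S).
Local Open Scope ring_scope.

Local Opaque complete_graph.

Lemma machine_A_mean : exists (time : seq (letter r) -> nat) (B : rat),
  [/\ forall u, halts_at A u (time u), 0 <= B
    & forall n, wsum n [::] (fun u => (time u)%:R) <= B * reduced_count r n].
Proof.
have [L L_gt0 extend] := exists_complete_extension r_gt0.
have Q_ge1 : 1 <= branching r ^+ L by rewrite exprn_ege1 // branching_ge1.
have [beta [C [beta_ge1 C_ge0 beta_small cubic]]] := cubic_bound Q_ge1.
have [time timeP] : exists time : seq (letter r) -> nat, forall u,
    [/\ halts_at A u (time u), (time u <= (size u).+1 + search_bound S (size u))%N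
      & forall k, (0 < k <= size u)%N -> complete_graph (whitehead_graph (take k u)) ->
        (time u <= k)%N].
  have [time timeP] := @halting_time r 2 void A predT
    (fun u => (size u).+1 + search_bound S (size u))%N (fun u _ =>
      let: ex_intro t (And3 halt_t le_t _) := machine_A_time S_steps u in
      ex_intro2 _ _ t le_t halt_t).
  exists time => u; have [halt_u le_u] := timeP u isT.
  have [t [halt_t _ le_t]] := machine_A_time S_steps u.
  by split=> //; rewrite (halts_unique halt_u halt_t).
(* For z = [(size u).+1] the time bound is 43 N z^3 + 4 z, with N the size of [S], hence at most
   [C0] times the cube of any y with y at least z. *)
pose C0 := (43 * size S + 4)%N.
pose K : rat := (C0 * L ^ 3)%:R * C.
have K_ge0 : 0 <= K by rewrite mulr_ge0.
have boundK x m : (x <= C0 * (L * m.+1) ^ 3)%N -> x%:R <= K * beta ^+ m.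
  rewrite expnMn mulnA => le_x; rewrite /K -mulrA.
  apply: (@le_trans _ _ ((C0 * L ^ 3)%:R * (m.+1 ^ 3)%:R)); first by rewrite -natrM ler_nat.
  by rewrite ler_wpM2l.
have block m : (m * L < L * m.+1)%N by rewrite mulnS mulnC -[ltnLHS]add0n ltn_add2r.
exists time, (2 * K * beta); split=> [u||n].
- by have [] := timeP u.
- by rewrite !mulr_ge0 // (le_trans ler01).
apply: (wsum_expected r_gt0 L_gt0 extend beta_ge1 K_ge0 beta_small).
- move=> v m lt_size compl; apply: boundK; have [_ _ le_t] := timeP v.
  apply: leq_trans (le_t _ _ compl) _; first by rewrite lt_size.
  apply: leq_trans (block m) _; rewrite -[leqLHS]mul1n; apply: leq_mul;
    first by rewrite /C0 addnS.
  by rewrite -[leqLHS]expn1 leq_pexp2l // muln_gt0 L_gt0.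
move=> v m le_size; apply: boundK; have [_ le_t _] := timeP v.
apply: leq_trans le_t _;
  have lt_size : (size v < L * m.+1)%N := leq_ltn_trans le_size (block m).
move: (L * m.+1)%N lt_size => y; move: (size v) => x; rewrite /search_bound /round_bound /C0.
move: (size S) => s lt_xy.
have : (x.+1 * x.+1 <= y * y)%N by apply: leq_mul.
have : (x.+1 * (x.+1 * x.+1) <= y * (y * y))%N by rewrite !leq_mul.
have y_gt0 : (0 < y)%N by apply: leq_ltn_trans lt_xy.
have : (y <= y * y)%N by apply: leq_pmull.
have : (y * y <= y * (y * y))%N by rewrite mulnA; apply: leq_pmulr.
have -> : (y ^ 3 = y * (y * y))%N by rewrite !expnS expn0 muln1.
move=> le3 le2 lez3 _; have lez : (x.+1 <= y * (y * y))%N.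
  exact: leq_trans lt_xy (leq_trans le2 le3).
move: lez lez3; move: x.+1 => z lez lez3.
have -> : (z + z * (s * (43 * (z * z)) + 3) = (43 * s) * (z * (z * z)) + 4 * z)%N by ring.
rewrite mulnDl; apply: leq_add; first by apply: leq_mul.
by rewrite leq_pmul2l.
Qed.

(** The total time over cyclically reduced words is at most that over all reduced words, and by
    [cyclic_half] the normalizing count is at least half as large; hence the factor 2. *)
Lemma machine_A_expected : constant_expected_time (@cyclically_reduced r) A.
Proof.
have [time [B [halt_time B_ge0 mean]]] := machine_A_mean.
exists time; split=> [u _ //|]; exists (2 * B) => n; rewrite /expectation.
have half := cyclic_half r_gt0 n.
have gt0 := reduced_count_gt0 r_gt0 n.
rewrite (card_words _ (@cyclically_reduced_free r)) ler_pdivrMr; last by lra.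
apply: le_trans (sum_words n (g := fun u => (time u)%:R) (@cyclically_reduced_free r) _ _) _ => //.
apply: le_trans (mean n) _; rewrite -mulrA mulrCA; exact: ler_wpM2l.
Qed.

Lemma machine_RA_expected :
  constant_expected_time (@freely_reduced r) (seq_machine (machine_R r) A).
Proof.
have [time [B [halt_time B_ge0 mean]]] := machine_A_mean.
have [|time2 time2P] := @halting_time r 2 void (seq_machine (machine_R r) A)
    (@freely_reduced r) (fun u => time (cyclic_reduction u) + strip_time u)%N.
  move=> u _; have [t [le_t halt_t tapes]] := machine_R_reduces u.
  exists (time (cyclic_reduction u) + t)%N; first by rewrite leq_add2l.
  exact: (seq_halts halt_t tapes (halt_time (cyclic_reduction u))).
exists time2; split=> [u red_u|]; first by have [] := time2P u red_u.
exists (2 * (5 + B)) => n; rewrite /expectation (card_words _ (fun u => id)).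
have -> : wsum n [::] (fun u => (freely_reduced u)%:R) = reduced_count r n.
  by rewrite /reduced_count /wsum; apply: eq_bigr => t ->.
rewrite ler_pdivrMr ?reduced_count_gt0 //.
apply: le_trans (total_time_mean r_gt0 _ B_ge0 mean n); last by move=> u.
apply: sum_words => // u; last by rewrite addr_ge0.
by move/time2P => [_]; rewrite /total_time -natrD ler_nat addnC.
Qed.

End ExpectedTime.

Theorem theorem1 (r : nat) (hr : 0 < r) :
  exists (kW k : nat) (XW X : finType)
         (W : machine r kW XW) (A : machine r k X),
    [/\ classical W /\ runs_whitehead W,
        classical A /\
          runs_in_parallel (@cyclically_reduced r) A (machine_T r) W,
        decides_primitivity (@cyclically_reduced r) A /\
          constant_expected_time (@cyclically_reduced r) A
      & exists R : machine r k X,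
          [/\ reduces_cyclically R,
              decides_primitivity (@freely_reduced r) (seq_machine R A)
            & constant_expected_time (@freely_reduced r) (seq_machine R A)]].
Proof.
have [S S_steps] := whitehead_images r.
exists 2, 2, void, void, (machine_W S), (machine_A S); split.
- split; first exact: machine_W_classical.
  exists (@tape1) => u red_u.
  have [m [ws [tau [t [ws_steps [tau_homo tau_ws /andP[le_t _] halt_t ans]]]]]] :=
    machine_W_search S_steps u.
  by exists m, ws, tau, t.
- by split; [apply: machine_A_classical | apply: machine_A_parallel].
- split; last exact: machine_A_expected.
  move=> u red_u; have [t [halt_t _ _]] := machine_A_time S_steps u.
  have [b ans b_prim] := machine_A_correct hr S_steps red_u halt_t.
  by exists t, b; rewrite reduce_word in b_prim.
exists (machine_R r); split.
- move=> u _; have [t [_ halt_t tapes]] := machine_R_reduces u; by exists t.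
- move=> u red_u; have [t1 [_ halt1 tapes1]] := machine_R_reduces u.
  have [t2 [halt2 _ _]] := machine_A_time S_steps (cyclic_reduction u).
  have [b ans b_prim] := machine_A_correct hr S_steps (cyclic_reductionP red_u) halt2.
  exists (t2 + t1), b; split; first exact: (seq_halts halt1 tapes1 halt2).
    by rewrite (run_seq_second (machine_A S) halt1 tapes1).
  by rewrite b_prim primitive_cyclic_reduction reduce_word.
exact: machine_RA_expected.
Qed.
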